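(* Let $0<\alpha<1$ and let $T>0$ be a fixed constant. Let $u\in L^\infty(0,T;H^2(0,1))$, with $\partial_t^\alpha u\in L^\infty(0,T;L^2(0,1))$, be a solution to the time-fractional diffusion equation $$\partial_t^\alpha u(x,t)-\partial_x^2u(x,t)=0,\quad (x,t)\in(0,1)\times(0,T),$$ where $\partial_t^\alpha$ is the Caputo derivative of order $\alpha$ in $t$. Let $I$ be a non-empty open subinterval of $(0,1)$. If $u\equiv 0$ in $I\times[0,T]$, then $$u(x,t)=0,\quad (x,t)\in[0,1]\times[0,T].$$ No initial condition and no boundary condition is imposed on $u$.
   Context: For $0<\alpha<1$ the Caputo derivative is defined by $$\partial_t^\alpha \phi(t)=\frac{1}{\Gamma(1-\alpha)}\int_0^t\frac{\phi'(\tau)}{(t-\tau)^\alpha}\,d\tau,\quad t>0,$$ where $\Gamma$ is the Gamma function and, as is usual for this formula, $\phi$ is absolutely continuous in $t$, so that $\phi'$ is its integrable almost-everywhere derivative; for a function $u(x,t)$ it is applied in the variable $t$ for fixed $x$. The class of solutions considered consists of functions with $u\in L^\infty(0,T;H^2(0,1))$ and $\partial_t^\alpha u\in L^\infty(0,T;L^2(0,1))$. *)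

(* Defs.v *)
From HB Require Import structures.
From mathcomp Require Import all_boot all_order all_algebra.
From mathcomp Require Import all_classical all_reals all_analysis.

Set Implicit Arguments.
Unset Strict Implicit.
Unset Printing Implicit Defensive.

Import Order.TTheory GRing.Theory Num.Theory.
Import numFieldNormedType.Exports.

Local Open Scope classical_set_scope.
Local Open Scope ring_scope.

Section Defs.
Context {R : realType}.
Local Notation mu := (@lebesgue_measure R).
Local Notation unit_oo := [set` `]0%R, 1%R[ : interval R].

Definition Gamma (z : R) : R :=
  \int[mu]_(s in `]0, +oo[) (s `^ (z - 1) * expR (- s)).

Definition absolutely_continuous (a b : R) (f : R -> R) : Prop :=
  forall e : R, 0 < e -> exists2 d : R, 0 < d &
    forall (n : nat) (l r : 'I_n -> R),
      (forall i, a <= l i /\ l i <= r i /\ r i <= b) ->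
      (forall i j, i != j -> `]l i, r i[ `&` `]l j, r j[ = set0) ->
      \sum_(i < n) (r i - l i) < d ->
      \sum_(i < n) `|f (r i) - f (l i)| < e.

(* For absolutely continuous [phi], [derive1 phi] is the a.e. derivative and the
   integral converges absolutely for a.e. [t]; on the exceptional null sets
   both operators return unspecified values. *)
Definition caputo (alpha : R) (phi : R -> R) (t : R) : R :=
  (Gamma (1 - alpha))^-1 *
  \int[mu]_(tau in `]0, t[) (derive1 phi tau / (t - tau) `^ alpha).

(* Norms and spaces on the interval (0,1).  Functions are total on [R]; their
   values outside (0,1) are irrelevant. *)
Definition L2norm (f : R -> R) : \bar R :=
  'N[mu]_(2%:E)[EFin \o (f \_ unit_oo)].

(* [measurable_fun] is Borel measurability, whence the a.e. equal
   representative: membership only depends on the a.e. class of [f]. *)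
Definition L2 : set (R -> R) := [set f : R -> R | exists g : R -> R,
  [/\ measurable_fun unit_oo g, ae_eq mu unit_oo f g & (L2norm g < +oo)%E]].

Definition test_function (phi : R -> R) : Prop :=
  (forall (n : nat) (x : R), derivable (derive1n n phi) x 1) /\
  exists c d : R, [/\ 0 < c, d < 1 &
    forall x, x \notin `[c, d] -> phi x = 0].

Definition is_weak_derivative (f g : R -> R) : Prop :=
  [/\ L2 f, L2 g & forall phi, test_function phi ->
    \int[mu]_(x in `]0, 1[) (f x * derive1 phi x) =
    - \int[mu]_(x in `]0, 1[) (g x * phi x)].

(* Weak derivatives are unique up to a.e. equality on (0,1); [weakD f] is one
   of them, and 0 if there is none. *)
Definition weakD (f : R -> R) : R -> R :=
  xget (cst 0) [set g | is_weak_derivative f g].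

Definition H2 : set (R -> R) := [set f |
  is_weak_derivative f (weakD f) /\
  is_weak_derivative (weakD f) (weakD (weakD f))].

Definition H2norm (f : R -> R) : \bar R :=
  ((L2norm f ^+ 2 + L2norm (weakD f) ^+ 2 + L2norm (weakD (weakD f)) ^+ 2)
     `^ 2^-1)%E.

(* Bochner spaces L^oo(0,T;X), for a function space [X] with norm [N]. *)
Definition simple_valued (X : set (R -> R)) (s : R -> R -> R) : Prop :=
  exists (m : nat) (A : 'I_m -> set R) (f : 'I_m -> R -> R),
    [/\ forall i, measurable (A i), forall i, X (f i) &
        forall t x, s t x = \sum_(i < m) \1_(A i) t * f i x].

Definition strongly_measurable (X : set (R -> R)) (N : (R -> R) -> \bar R)
    (T : R) (v : R -> R -> R) : Prop :=
  exists2 s : nat -> R -> R -> R, forall n, simple_valued X (s n) &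
    {ae mu, forall t, t \in `]0, T[ -> N (s n t \- v t) @[n --> \oo] --> 0%E}.

Definition Linfty (X : set (R -> R)) (N : (R -> R) -> \bar R)
    (T : R) (v : R -> R -> R) : Prop :=
  [/\ {ae mu, forall t, t \in `]0, T[ -> X (v t)},
      strongly_measurable X N T v &
      exists M : R, {ae mu, forall t, t \in `]0, T[ -> (N (v t) <= M%:E)%E}].

End Defs.

(* Main.v *)
(* Testing the equation against smooth [phi] with compact support in (0,1) turns
   it into a Volterra equation in time for [<u(t), phi>], and no boundary term
   appears. Its Laplace transform over (0,T) gives, for all [s > 0] and all [phi],
   which may depend on [s],
     | int_0^T e^(-st) <u(t), phi'' - s^alpha phi> dt
       + s^alpha <u(0), phi> int_0^T e^(-st) dt | <= e^(-sT) C(s, phi),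
   with [C] affine in [s^alpha] and linear in the sizes of [phi] and [phi''].
   Put [l = s^(alpha/2)] and let the cut-offs below rise inside [I].
   - With [phi = theta(x) e^(-lx)], [theta = 1] between [I] and [X], this shows that
     [int u(x,0) theta(x) e^(l(X-x)) dx] grows subexponentially in [l]. By
     Phragmen's lemma [u(.,0)] vanishes between [I] and [X], for every [X < 1].
   - With [phi = chi f], [f'' - l^2 f = psi], [psi] supported to the right of [I] and
     [f = 0] to the right of [psi], the size of [phi] is at most [C e^l], and
     [l = o(s)]. Hence [int_0^T e^(s(T-t)) <u(t), psi> dt] grows subexponentially in
     [s], and Phragmen's lemma, now in time, gives [<u(t), psi> = 0] for a.e. [t].
   The reflection [x -> 1 - x] handles the left of [I]. *)

Require Import Defs.
From HB Require Import structures.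
From mathcomp Require Import all_boot all_order all_algebra.
From mathcomp Require Import all_classical all_reals all_analysis.
From mathcomp Require Import measurable_realfun.
From mathcomp Require Import ring lra.

Set Implicit Arguments.
Unset Strict Implicit.
Unset Printing Implicit Defensive.

Import Order.TTheory GRing.Theory Num.Theory.
Import numFieldNormedType.Exports.

Local Open Scope classical_set_scope.
Local Open Scope ring_scope.

(** * Fubini's theorem and changes of variables for real-valued integrals *)

(** The order of the two steps is forced. The second one multiplies the Laplace estimate by
    [e^(sT)], so a non-zero [<u(0), phi>] would contribute a term of exponential size in [s]; as no
    initial condition is imposed, [u(.,0)] must be shown to vanish on the support of [phi]
    beforehand. In the first step [<u(0), phi>] is itself the unknown, and can be isolated because
    its factor, the integral of [e^(-st)] over []0, T[], is only polynomially small in [s]. A second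
    obstacle is measurability. The hypotheses give continuity in [x] for every [t] and absolute
    continuity in [t] for a.e. [x], while Fubini's theorem asks for functions measurable in [(x,t)].
    So [u] is composed with the projections onto [[0,1]] and [[0,T]], and its time derivative is
    replaced by an upper limit of difference quotients. That this upper limit integrates back to [u]
    for a.e. [x] is Lebesgue's theorem on absolutely continuous functions, obtained here from the
    Radon-Nikodym theorem for Lebesgue-Stieltjes measures. *)

Section integral_ae_eq.
Context d (T : measurableType d) (R : realType).
Variable mu : {measure set T -> \bar R}.
Import HBNNSimple.

Let nnint (f : T -> \bar R) := ereal_sup [set sintegral mu h |
  h in [set h : {nnsfun T >-> R} | forall x, ((h x)%:E <= f x)%E]].

Let nnint_le (f g : T -> \bar R) : (forall x, (0 <= g x)%E) ->
  {ae mu, forall x, f x = g x} -> (nnint f <= nnint g)%E.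
Proof.
move=> g0 [N [mN N0 fgN]]; apply: ge_ereal_sup => _ /= [h hf <-].
pose h' := proj_nnsfun h (measurableC mN).
have -> : sintegral mu h = sintegral mu h'.
  rewrite -!integralT_nnsfun; apply: ge0_ae_eq_integral.
  - by [].
  - by apply/measurable_EFinP; exact: measurable_funPT.
  - by apply/measurable_EFinP; exact: measurable_funPT.
  - by move=> x _; rewrite lee_fin fun_ge0.
  - by move=> x _; rewrite lee_fin fun_ge0.
  - exists N; split => // x /=; apply: contra_notP => Nx _.
    by rewrite mindicE mem_set ?mulr1.
apply: ereal_sup_ubound; exists h' => //= x.
rewrite mindicE; have [xN|xN] := pselect (N x).
  by rewrite memNset ?mulr0//=; apply.
rewrite mem_set// mulr1.
have -> : g x = f x by apply/esym; apply: contra_notP xN => fgx; exact: fgN.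
exact: hf.
Qed.

(* No measurability is needed: [f] and [g] are the same function for the
   simple functions that ignore the null set where they differ. *)
Lemma integral_ae_eq (D : set T) (f g : T -> \bar R) :
  ae_eq mu D f g -> (\int[mu]_(x in D) f x = \int[mu]_(x in D) g x)%E.
Proof.
move=> fg.
have fgD : {ae mu, forall x, (f \_ D) x = (g \_ D) x}.
  apply: filterS fg => x fgx; rewrite /patch; case: ifPn => // /set_mem; exact: fgx.
rewrite /integral; congr (_ - _)%E; apply/eqP; rewrite eq_le.
  apply/andP; split; apply: nnint_le => //; apply: filterS fgD => x e;
  by rewrite !funeposE e.
apply/andP; split; apply: nnint_le => //; apply: filterS fgD => x e;
by rewrite !funenegE e.
Qed.

Lemma Rintegral_ae_eq (D : set T) (f g : T -> R) :
  ae_eq mu D f g -> \int[mu]_(x in D) f x = \int[mu]_(x in D) g x.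
Proof.
move=> fg; congr fine; apply: integral_ae_eq.
by apply: filterS fg => x e /e ->.
Qed.

End integral_ae_eq.

Section Rfubini.
Context d1 d2 (T1 : measurableType d1) (T2 : measurableType d2) (R : realType).
Variable m1 : {sigma_finite_measure set T1 -> \bar R}.
Variable m2 : {sigma_finite_measure set T2 -> \bar R}.
Variables (A : set T1) (B : set T2) (f : T1 -> T2 -> R).
Hypotheses (mA : measurable A) (mB : measurable B).
Hypothesis mf : measurable_fun (A `*` B) (fun z => f z.1 z.2).
Hypothesis fy : (\int[m1]_(x in A) \int[m2]_(y in B) `|f x y|%:E < +oo)%E.

Let mAB : measurable (A `*` B). Proof. exact: measurableX. Qed.

Let g : T1 * T2 -> \bar R := (fun z => (f z.1 z.2)%:E) \_ (A `*` B).

Let mg : measurable_fun setT g.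
Proof. by apply/(measurable_restrictT _ mAB); exact: measurableT_comp. Qed.

Let gA x : A x -> (fun y => g (x, y)) = (EFin \o f x) \_ B.
Proof.
move=> Ax; apply/funext => y; rewrite /g /patch.
have [yB|yB] := boolP (y \in B).
  by rewrite mem_set//; split => //; exact/set_mem.
by rewrite memNset// => -[_ /mem_set]; exact/negP.
Qed.

Let gAN x : ~ A x -> (fun y => g (x, y)) = cst 0%E.
Proof. by move=> Ax; apply/funext => y; rewrite /g /patch memNset// => -[]. Qed.

Let gB y : B y -> (fun x => g (x, y)) = (EFin \o f^~ y) \_ A.
Proof.
move=> By; apply/funext => x; rewrite /g /patch.
have [xA|xA] := boolP (x \in A).
  by rewrite mem_set//; split => //; exact/set_mem.
by rewrite memNset// => -[/mem_set] + _; exact/negP.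
Qed.

Let gBN y : ~ B y -> (fun x => g (x, y)) = cst 0%E.
Proof. by move=> By; apply/funext => x; rewrite /g /patch memNset// => -[]. Qed.

Let ig : (m1 \x m2)%E.-integrable setT g.
Proof.
apply/integrable12ltyP => //; apply: le_lt_trans fy.
rewrite [leRHS]integral_mkcond le_eqVlt; apply/orP; left; apply/eqP.
apply: eq_integral => x _; rewrite /patch; case: ifPn => xA.
  rewrite [RHS]integral_mkcond; apply: eq_integral => y _.
  have /(congr1 (@^~ y)) -> := gA (set_mem xA).
  by rewrite /patch; case: ifPn => //= _; rewrite normr0.
rewrite -[RHS](integral0 m2 setT); apply: eq_integral => y _.
have /(congr1 (@^~ y)) -> : (fun y => g (x, y)) = cst 0%E.
  by apply: gAN => /mem_set; exact/negP.
by rewrite /= normr0.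
Qed.

Let F x := (\int[m2]_y g (x, y))%E.
Let G y := (\int[m1]_x g (x, y))%E.

Let FA x : A x -> F x = (\int[m2]_(y in B) (f x y)%:E)%E.
Proof. by move=> Ax; rewrite /F gA// -integral_mkcond. Qed.

Let GB y : B y -> G y = (\int[m1]_(x in A) (f x y)%:E)%E.
Proof. by move=> By; rewrite /G gB// -integral_mkcond. Qed.

Let FAE : F = F \_ A.
Proof.
apply/funext => x; rewrite /patch; case: ifPn => // xA.
by rewrite /F gAN ?integral0// => /mem_set; exact/negP.
Qed.

Let GBE : G = G \_ B.
Proof.
apply/funext => x; rewrite /patch; case: ifPn => // xA.
by rewrite /G gBN ?integral0// => /mem_set; exact/negP.
Qed.

Let iF : m1.-integrable A F.
Proof.
by apply/(integrable_mkcond _ mA); rewrite -FAE; exact: integrable_fubini_F.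
Qed.

Let iG : m2.-integrable B G.
Proof.
apply/(integrable_mkcond _ mB); rewrite -GBE; rewrite /G.
have mG : measurable_fun setT G by exact: (measurable_fubini_G ig).
apply/integrableP; split => //.
have /integrableP[_ ig'] := ig.
rewrite (fubini_tonelli2 (abse \o g)) in ig'; last 2 first.
  by apply: measurableT_comp.
  by move=> z; exact: abse_ge0.
apply: le_lt_trans ig'; apply: ge0_le_integral => //.
- by apply: measurableT_comp.
- apply: (measurable_fun_fubini_tonelli_G (abse \o g)); last by move=> z; exact: abse_ge0.
  by apply: measurableT_comp.
- move=> y _; apply: le_abse_integral => //.
  exact: measurableT_comp.
Qed.

Lemma Rfubini_ae2 :
  {ae m2, forall y, B y -> m1.-integrable A (EFin \o f^~ y)}.
Proof.
have := ae_integrable2 ig; apply: filterS => x + Ax.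
by rewrite gB// => /(integrable_mkcond _ mA).
Qed.

Let fine_int1 x : A x -> (\int[m2]_(y in B) f x y)%R = fine (F x).
Proof. by move=> Ax; rewrite FA. Qed.

Let fine_int2 y : B y -> (\int[m1]_(x in A) f x y)%R = fine (G y).
Proof. by move=> Ax; rewrite GB. Qed.

Let integrable_fine d (T : measurableType d)
    (m : {measure set T -> \bar R}) (D : set T) (h : T -> \bar R) :
  measurable D -> m.-integrable D h -> m.-integrable D (EFin \o (fine \o h)).
Proof.
move=> mD ih; have [mh _] := integrableP _ _ _ ih.
apply: (le_integrable mD _ _ ih).
  by apply/measurable_EFinP; exact: measurableT_comp.
by move=> x Dx /=; case: (h x) => //=; rewrite ?normr0 ?leey.
Qed.

Lemma Rfubini_integrable1 :
  m1.-integrable A (EFin \o (fun x => \int[m2]_(y in B) f x y)).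
Proof.
apply: eq_integrable (integrable_fine mA iF) => // x /set_mem Ax.
by rewrite /= fine_int1.
Qed.

Lemma Rfubini_integrable2 :
  m2.-integrable B (EFin \o (fun y => \int[m1]_(x in A) f x y)).
Proof.
apply: eq_integrable (integrable_fine mB iG) => // x /set_mem Ax.
by rewrite /= fine_int2.
Qed.

(** The [fine] in the inner real-valued integrals alters them only where the extended-real inner
    integral is infinite, which is a null set because [F] and [G] are integrable. *)
Lemma Rfubini : \int[m1]_(x in A) \int[m2]_(y in B) f x y =
                \int[m2]_(y in B) \int[m1]_(x in A) f x y.
Proof.
have h1 : (\int[m1]_(x in A) (\int[m2]_(y in B) f x y)%:E =
           \int[m1]_(x in A) F x)%E.
  apply: integral_ae_eq; have := integrable_ae mA iF.
  by apply: filterS => x Fx Ax; rewrite fine_int1// fineK// Fx.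
have h2 : (\int[m2]_(y in B) (\int[m1]_(x in A) f x y)%:E =
           \int[m2]_(y in B) G y)%E.
  apply: integral_ae_eq; have := integrable_ae mB iG.
  by apply: filterS => x Fx Ax; rewrite fine_int2// fineK// Fx.
congr fine; rewrite h1 h2 integral_mkcond -FAE [RHS]integral_mkcond -GBE.
exact: Fubini.
Qed.

End Rfubini.

Section affine_substitution.
Context {R : realType}.
Local Notation mu := (@lebesgue_measure R).
Variables (a b : R).
Hypothesis a0 : a != 0.
Let phi x := a * x + b.

Let mphi : measurable_fun setT (phi : measurableTypeR R -> measurableTypeR R).
Proof. by apply: measurable_funD => //; exact: measurable_funM. Qed.

Let na : {nonneg R} := NngNum (normr_ge0 a).

Let push : {measure set (measurableTypeR R) -> \bar R} :=
  measure_function_pushforward__canonical__measure_function_Measure mu mphi.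

(** By uniqueness of Lebesgue measure: [|a|] times the image measure agrees with it on half-open
    intervals. For [a < 0] the preimage of such an interval is closed on the other side, hence the
    two cases. *)
Lemma lebesgue_measure_affine (A : set R) : measurable A ->
  mu A = (`|a|%:E * mu (phi @^-1` A))%E.
Proof.
move=> mA; apply: (@lebesgue_measure_unique R (mscale na push)) => // _ [[p q] _ <-] /=.
rewrite /mscale /= /pushforward /phi.
have [pq|pq] := leP q p.
  rewrite set_itv_ge ?bnd_simp -?leNgt// preimage_set0 !measure0 mule0//.
have [agt0|alt0|/eqP] := ltgtP a 0; last by rewrite (negbTE a0).
  have -> : (fun x => a * x + b) @^-1` `]p, q] = `[(q - b) / a, (p - b) / a[%classic.
    apply/seteqP; split => x /=; rewrite !in_itv/= ler_ndivrMr// ltr_ndivlMr//;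
      rewrite lerBrDr ltrBlDr [x * a]mulrC => /andP[-> ->//].
  rewrite !lebesgue_measure_itv/= !lte_fin pq ltr_ndivlMr// divfK// ltrD2r pq.
  by rewrite -!EFinD -EFinM ltr0_norm//; congr EFin; field.
have -> : (fun x => a * x + b) @^-1` `]p, q] = `](p - b) / a, (q - b) / a]%classic.
  apply/seteqP; split => x /=; rewrite !in_itv/= ler_pdivlMr// ltr_pdivrMr//;
    rewrite lerBrDr ltrBlDr [x * a]mulrC => /andP[-> ->//].
rewrite !lebesgue_measure_itv/= !lte_fin pq ltr_pdivlMr// divfK// ltrD2r pq.
by rewrite -!EFinD -EFinM gtr0_norm//; congr EFin; field.
Qed.

Lemma ge0_integral_affine (D : set R) (f : R -> \bar R) : measurable D ->
  measurable_fun D f -> (forall x, D x -> (0 <= f x)%E) ->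
  (\int[mu]_(x in D) f x =
   `|a|%:E * \int[mu]_(x in phi @^-1` D) f (a * x + b)%R)%E.
Proof.
move=> mD mf f0.
rewrite -(ge0_integral_pushforward mphi)//; last by move=> x /set_mem/f0.
rewrite -(@ge0_integral_mscale _ _ _ push D mD na f)//.
by apply: eq_measure_integral => A mA _; exact: lebesgue_measure_affine.
Qed.

End affine_substitution.

Lemma Rintegral_reflect {R : realType} (c : R) (D : set R) (f : R -> R) :
  measurable D -> measurable_fun D f ->
  \int[@lebesgue_measure R]_(x in D) f x =
  \int[@lebesgue_measure R]_(x in [set x | D (c - x)]) f (c - x).
Proof.
move=> mD mf; congr fine; rewrite integralE [RHS]integralE.
have N1 : (-1 : R) != 0 by rewrite oppr_eq0 oner_eq0.
have mf' : measurable_fun D (EFin \o f) by exact/measurable_EFinP.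
have E x : -1 * x + c = c - x by rewrite mulN1r addrC.
have ED : (fun x => -1 * x + c) @^-1` D = [set x | D (c - x)].
  by apply/seteqP; split => x /=; rewrite E.
congr (_ - _)%E.
  rewrite (@ge0_integral_affine R (-1) c N1 D ((EFin \o f)^\+)%E)//; last first.
    exact: measurable_funepos.
  rewrite normrN normr1 mul1e ED; apply: eq_integral => x _.
  by rewrite !funeposE /= E.
rewrite (@ge0_integral_affine R (-1) c N1 D ((EFin \o f)^\-)%E)//; last first.
  exact: measurable_funeneg.
rewrite normrN normr1 mul1e ED; apply: eq_integral => x _.
by rewrite !funenegE /= E.
Qed.

Section triangle.
Context {R : realType}.
Local Notation mu := (@lebesgue_measure R).
Variables (r : R) (f : R -> R -> R).
Hypothesis mf : measurable_fun setT (fun z : R * R => f z.1 z.2).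
Hypothesis fy :
  (\int[mu]_(y in `]0%R, r[) \int[mu]_(x in `]y, r[) `|f x y|%:E < +oo)%E.

(** Zero extension from the triangle [0 < y < x < r] to the square, with the outer variable first,
    so that Fubini's theorem on a product set applies. *)
Let g (y x : R) := if y < x then f x y else 0.

Let mg : measurable_fun setT (fun z : R * R => g z.1 z.2).
Proof.
apply: measurable_fun_ifT => //; first exact: measurable_fun_ltr.
apply: (measurableT_comp mf (measurable_fun_pair _ _)) => //.
Qed.

Let g1E y : 0 < y -> g y \_ `]0, r[ = (f^~ y) \_ `]y, r[.
Proof.
move=> y0; apply/funext => x; rewrite /patch/= !mem_setE !in_itv/= /g.
by case: (ltP y x) => yx; rewrite ?if_same// (lt_trans y0 yx).
Qed.

Let g2E x : x < r -> (fun y => g y x) \_ `]0, r[ = f x \_ `]0, x[.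
Proof.
move=> xr; apply/funext => y; rewrite /patch/= !mem_setE !in_itv/= /g.
by case: (ltP y x) => yx; rewrite ?if_same ?andbF// !andbT (lt_trans yx xr) andbT.
Qed.

Let int1 y : 0 < y ->
  \int[mu]_(x in `]0, r[) g y x = \int[mu]_(x in `]y, r[) f x y.
Proof. by move=> y0; rewrite Rintegral_mkcond g1E// -Rintegral_mkcond. Qed.

Let int2 x : x < r ->
  \int[mu]_(y in `]0, r[) g y x = \int[mu]_(y in `]0, x[) f x y.
Proof. by move=> y0; rewrite Rintegral_mkcond g2E// -Rintegral_mkcond. Qed.

Let gy : (\int[mu]_(y in `]0%R, r[) \int[mu]_(x in `]0%R, r[) `|g y x|%:E < +oo)%E.
Proof.
apply: le_lt_trans fy; rewrite le_eqVlt; apply/orP; left; apply/eqP.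
apply: eq_integral => y; rewrite inE/= in_itv/= => /andP[y0 yr].
rewrite integral_mkcond [RHS]integral_mkcond; congr integral.
apply/funext => x; have /(congr1 (fun h => `|h x|%:E)) := g1E y0.
by rewrite /patch; case: ifPn; case: ifPn => // _ _; rewrite !normr0.
Qed.

Let mgr : measurable_fun (`]0, r[ `*` `]0, r[) (fun z : R * R => g z.1 z.2).
Proof. exact: measurable_funTS. Qed.

Lemma Rfubini_triangle_ae2 :
  {ae mu, forall x, `]0, r[%classic x -> mu.-integrable `]0, x[ (EFin \o f x)}.
Proof.
have := Rfubini_ae2 (m1 := mu) (m2 := mu) (measurable_itv _) (measurable_itv _) mgr gy.
apply: filterS => y + yr => /(_ yr) /integrable_mkcond => /(_ (measurable_itv _)).
move: yr; rewrite /= in_itv/= => /andP[_ y0].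
rewrite restrict_EFin g2E// -restrict_EFin => ?.
exact/integrable_mkcond.
Qed.

Lemma Rfubini_triangle_integrable1 :
  mu.-integrable `]0, r[ (EFin \o (fun y => \int[mu]_(x in `]y, r[) f x y)).
Proof.
have := Rfubini_integrable1 (m1 := mu) (m2 := mu) (measurable_itv _) (measurable_itv _) mgr gy.
apply: eq_integrable => //= y; rewrite inE/= in_itv/= => /andP[y0 _].
by rewrite int1.
Qed.

Lemma Rfubini_triangle_integrable2 :
  mu.-integrable `]0, r[ (EFin \o (fun x => \int[mu]_(y in `]0, x[) f x y)).
Proof.
have := Rfubini_integrable2 (m1 := mu) (m2 := mu) (measurable_itv _) (measurable_itv _) mgr gy.
apply: eq_integrable => //= y; rewrite inE/= in_itv/= => /andP[_ y0].
by rewrite int2.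
Qed.

Lemma Rfubini_triangle :
  \int[mu]_(x in `]0, r[) \int[mu]_(y in `]0, x[) f x y =
  \int[mu]_(y in `]0, r[) \int[mu]_(x in `]y, r[) f x y.
Proof.
have := Rfubini (m1 := mu) (m2 := mu) (measurable_itv _) (measurable_itv _) mgr gy.
under eq_Rintegral.
  move=> y; rewrite inE/= in_itv/= => /andP[y0 _]; rewrite int1//; over.
move=> ->; apply: eq_Rintegral => y; rewrite inE/= in_itv/= => /andP[_ y0].
by rewrite int2.
Qed.

End triangle.

(** * Power kernels and the Gamma function *)

Section ftc_variants.
Context {R : realType}.
Local Notation mu := (@lebesgue_measure R).

Lemma continuous_FTC2_is_derive (F f : R -> R) (a b : R) : a <= b ->
  (forall x, x \in `[a, b] -> is_derive x 1 F (f x)) ->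
  (forall x, x \in `[a, b] -> {for x, continuous f}) ->
  (\int[mu]_(x in `[a, b]) (f x)%:E = (F b - F a)%:E)%E.
Proof.
rewrite le_eqVlt => /predU1P[<- _ _|ab Ff cf].
  by rewrite subrr set_itv1 integral_set1.
have cF x : x \in `[a, b] -> {for x, continuous F}.
  by move=> /Ff ?; apply/differentiable_continuous/derivable1_diffP; exact: ex_derive.
rewrite (@continuous_FTC2 _ f F)//.
- by apply: continuous_in_subspaceT => x /set_mem; exact: cf.
- split.
  + by move=> x /subset_itv_oo_cc /Ff ?; exact: ex_derive.
  + by apply: cvg_at_right_filter; apply: cF; rewrite in_itv/= lexx ltW.
  + by apply: cvg_at_left_filter; apply: cF; rewrite in_itv/= lexx ltW.
- move=> x /subset_itv_oo_cc /Ff h.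
  by rewrite derive1E; exact: derive_val.
Qed.

(** The integrand is singular at 0, so the fundamental theorem of calculus is used on
    [[c / (n + 2), c]], and monotone convergence gives the limit. *)
Lemma integral_powRN (c al : R) : 0 < c -> 0 < al -> al < 1 ->
  (\int[mu]_(x in `]0%R, c[) (x `^ (- al))%:E =
   (c `^ (1 - al) / (1 - al))%:E)%E.
Proof.
move=> c0 al0 al1; have al1' : 0 < 1 - al by rewrite subr_gt0.
pose S (n : nat) : set R := `[c / n.+2%:R, c]%classic.
have e0 (n : nat) : 0 < c / n.+2%:R by rewrite divr_gt0.
have ec (n : nat) : c / n.+2%:R <= c.
  by rewrite ler_pdivrMr// ler_peMr ?(ltW c0)// ler1n.
have mf D : measurable_fun D (fun x : R => (x `^ (- al))%:E).
  by apply/measurable_EFinP; apply: measurable_funTS; exact: measurable_powR.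
have US : \bigcup_n S n = `]0, c]%classic.
  apply/seteqP; split => [x [n _]|x]; rewrite /S /= !in_itv/=.
    by move=> /andP[h ->]; rewrite (lt_le_trans _ h).
  move=> /andP[x0 xc]; have [n _ hn] := near_infty_natSinv_lt (PosNum (divr_gt0 x0 c0)).
  exists n => //; rewrite /S /= in_itv/= xc andbT.
  have := hn n (leqnn n) => /= h.
  rewrite ler_pdivrMr//; move: h; rewrite ltr_pdivlMr// mulrC => /ltW.
  rewrite ler_pdivrMr// => /le_trans; apply.
  by rewrite ler_pM2l// ler_nat.
have ndS : nondecreasing_seq S.
  move=> m n mn; apply/subsetPset => x; rewrite /S/= !in_itv/= => /andP[h ->].
  rewrite andbT; apply: le_trans h; rewrite ler_pM2l// lef_pV2 ?posrE//.
  by rewrite ler_nat.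
have cvg1 : (\int[mu]_(x in S n) (x `^ (- al))%:E @[n --> \oo] -->
    \int[mu]_(x in `]0%R, c]) (x `^ (- al))%:E)%E.
  rewrite -US; apply: ge0_nondecreasing_set_cvg_integral => //.
  - by move=> n; exact: measurable_itv.
  - by move=> n; exact: mf.
  - by move=> n x _; rewrite lee_fin powR_ge0.
have FE n : (\int[mu]_(x in S n) (x `^ (- al))%:E =
    (c `^ (1 - al) / (1 - al) - (c / n.+2%:R) `^ (1 - al) / (1 - al))%:E)%E.
  apply: (@continuous_FTC2_is_derive (fun x => x `^ (1 - al) / (1 - al))) => //.
    move=> x; rewrite in_itv/= => /andP[h _].
    have x0 : 0 < x by exact: lt_le_trans h.
    have h1 := is_derive1_powR (1 - al) x0.
    apply: (is_derive_eq (is_deriveM h1 (is_derive_cst ((1 - al)^-1) x 1))).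
    rewrite scaler0 add0r /GRing.scale/= mulKf ?gt_eqF//.
    by congr (_ `^ _); ring.
  move=> x; rewrite in_itv/= => /andP[h _].
  have x0 : 0 < x by exact: lt_le_trans h.
  apply/differentiable_continuous/derivable1_diffP.
  by apply: derivable_powR; rewrite in_itv/= x0.
rewrite integral_itv_bndo_bndc; last exact: mf.
have /cvg_lim <-// := cvg1.
apply/cvg_lim => //.
under eq_fun do rewrite FE.
apply: cvg_EFin; first by apply: nearW.
rewrite -[X in _ --> X]subr0; apply: cvgB; first exact: cvg_cst.
rewrite -[X in _ --> X](mul0r (1 - al)^-1); apply: cvgMl.
have /cvg_at_rightP := powR_cvg0 al1'; apply; split => //.
rewrite -[X in _ --> X](mulr0 c); apply: cvgMr.
by have := @cvg_harmonic R; rewrite -(@cvg_shiftS R harmonic).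
Qed.

End ftc_variants.

Section kernels.
Context {R : realType}.
Local Notation mu := (@lebesgue_measure R).
Implicit Types al s t T : R.

Lemma measurable_powR_affine (a b p : R) (D : set R) :
  measurable_fun D (fun x => (a * x + b) `^ p).
Proof.
apply: measurable_funTS; apply: (measurableT_comp (measurable_powR p)).
by apply: measurable_funD => //; exact: measurable_funM.
Qed.

Lemma measurable_powRBl (b p : R) (D : set R) :
  measurable_fun D (fun x => (x - b) `^ p).
Proof.
have := @measurable_powR_affine 1 (- b) p D.
by under eq_fun do rewrite mul1r.
Qed.

Lemma measurable_powRBr (b p : R) (D : set R) :
  measurable_fun D (fun x => (b - x) `^ p).
Proof.
have := @measurable_powR_affine (-1) b p D.
by under eq_fun do rewrite mulN1r addrC.
Qed.

Lemma integral_powRN_left (c d al : R) : c < d -> 0 < al -> al < 1 ->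
  (\int[mu]_(x in `]c, d[) ((x - c) `^ (- al))%:E =
   ((d - c) `^ (1 - al) / (1 - al))%:E)%E.
Proof.
move=> cd al0 al1; have dc : 0 < d - c by rewrite subr_gt0.
rewrite -[RHS](integral_powRN dc al0 al1).
rewrite (@ge0_integral_affine _ 1 c (oner_neq0 _) `]c, d[)//.
- rewrite normr1 mul1e; congr integral.
    apply/seteqP; split => x /=; rewrite !in_itv/= mul1r ltrDr ltrBrDr;
    by move=> /andP[-> ->].
  by apply/funext => x; rewrite mul1r addrK.
- by apply/measurable_EFinP; exact: measurable_powRBl.
- by move=> x _; rewrite lee_fin powR_ge0.
Qed.

Lemma integral_powRN_right (c d al : R) : c < d -> 0 < al -> al < 1 ->
  (\int[mu]_(x in `]c, d[) ((d - x) `^ (- al))%:E =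
   ((d - c) `^ (1 - al) / (1 - al))%:E)%E.
Proof.
move=> cd al0 al1; have dc : 0 < d - c by rewrite subr_gt0.
rewrite -[RHS](integral_powRN dc al0 al1).
have N1 : (-1 : R) != 0 by rewrite oppr_eq0 oner_eq0.
rewrite (@ge0_integral_affine _ (-1) d N1 `]c, d[)//.
- rewrite normrN normr1 mul1e; congr integral.
    apply/seteqP; split => x /=; rewrite !in_itv/= mulN1r;
    by move=> /andP[? ?]; apply/andP; split; lra.
  by apply/funext => x; rewrite mulN1r opprD opprK addrCA subrr addr0.
- by apply/measurable_EFinP; exact: measurable_powRBr.
- by move=> x _; rewrite lee_fin powR_ge0.
Qed.

Lemma measurable_expRN s (D : set R) : measurable_fun D (fun r => expR (- (s * r))).
Proof.
have h : measurable_fun D (fun r => - (s * r)).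
  by apply: measurableT_comp => //; apply: (measurable_funM (f := cst s) (g := id)).
exact: (measurableT_comp _ h).
Qed.

Lemma integral_expRN_itv s t T : t <= T ->
  (\int[mu]_(r in `]t, T[) (s * expR (- (s * r)))%:E =
   (expR (- (s * t)) - expR (- (s * T)))%:E)%E.
Proof.
move=> tT; rewrite integral_itv_bndo_bndc; last first.
  by apply/measurable_EFinP; apply: measurable_funM => //; exact: measurable_expRN.
rewrite integral_itv_obnd_cbnd; last first.
  by apply/measurable_EFinP; apply: measurable_funM => //; exact: measurable_expRN.
have -> : expR (- (s * t)) - expR (- (s * T)) =
    - expR (- (s * T)) - - expR (- (s * t)) by ring.
apply: (@continuous_FTC2_is_derive _ (fun r => - expR (- (s * r)))) => //.
- move=> x _; apply: is_derive_eq.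
  by rewrite /GRing.scale/= ; ring.
- move=> x _; apply: cvgMr.
  apply: (continuous_comp (f := fun x => - (s * x))); last exact: continuous_expR.
  by apply: cvgN; apply: cvgMr; exact: cvg_id.
Qed.

Lemma measurable_gamma_integrand al (D : set R) :
  measurable_fun D (fun x : R => x `^ (- al) * expR (- x)).
Proof.
apply: measurable_funM; first by apply: measurable_funTS; exact: measurable_powR.
by have := @measurable_expRN 1 D; under eq_fun do rewrite mul1r.
Qed.

(** What has to be proved is finiteness, since [Gamma] is the [fine] of this integral. On []0, 1[]
    the integrand is at most [x^-al], and beyond 1 at most the density of the exponential law. *)
Lemma integral_Gamma al : 0 < al -> al < 1 ->
  (\int[mu]_(x in `]0%R, +oo[) (x `^ (- al) * expR (- x))%:E =
   (Gamma (1 - al))%:E)%E.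
Proof.
move=> al0 al1.
have GE : 1 - al - 1 = - al by ring.
rewrite /Gamma GE fineK//.
have g0 x : 0 <= x `^ (- al) * expR (- x) by rewrite mulr_ge0 ?powR_ge0 ?expR_ge0.
rewrite ge0_fin_numE; last by apply: integral_ge0 => x _; rewrite lee_fin.
have -> : `]0, +oo[%classic = `]0, 1[%classic `|` `[1, +oo[%classic :> set R.
  apply/seteqP; split => x /=; rewrite !in_itv/= !andbT.
    by move=> x0; have [?|?] := ltP x 1; [left|right]; rewrite ?x0.
  by move=> [/andP[]//|x1]; rewrite (lt_le_trans _ x1).
rewrite ge0_integral_setU//=; last 3 first.
- apply/measurable_EFinP; exact: measurable_gamma_integrand.
- by move=> x _; rewrite lee_fin.
- rewrite disj_set2E; apply/eqP/seteqP; split => // x [] /=; rewrite !in_itv/= andbT.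
  by move=> /andP[_ x1]; rewrite leNgt x1.
apply: lte_add_pinfty.
  apply: (@le_lt_trans _ _ (\int[mu]_(x in `]0%R, 1%R[) (x `^ (- al))%:E)%E).
    apply: ge0_le_integral => //.
    - by move=> x _; rewrite lee_fin.
    - apply/measurable_EFinP; exact: measurable_gamma_integrand.
    - by apply/measurable_EFinP/measurable_funTS; exact: measurable_powR.
    - move=> x; rewrite /= in_itv/= => /andP[x0 _].
      by rewrite lee_fin ler_piMr ?powR_ge0// -expR0 ler_expR oppr_le0 ltW.
  by rewrite integral_powRN// ltry.
apply: (@le_lt_trans _ _ (\int[mu]_(x in `[1%R, +oo[) (exponential_pdf 1 x)%:E)%E).
  apply: ge0_le_integral => //.
  - by move=> x _; rewrite lee_fin.
  - apply/measurable_EFinP; exact: measurable_gamma_integrand.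
  - by apply/measurable_EFinP/measurable_funTS; exact: measurable_exponential_pdf.
  - move=> x; rewrite /= in_itv/= andbT => x1.
    rewrite lee_fin /exponential_pdf patchE mem_set; last first.
      by rewrite /= in_itv/= andbT (le_trans ler01).
    rewrite mul1r mulN1r ler_piMl ?expR_ge0// powRN invf_le1.
      by rewrite -(powRr0 x) ler_powR// ltW.
    by rewrite powR_gt0// (lt_le_trans ltr01).
have /integrableP[_] := @integrable_exponential_pdf R 1 ltr01.
apply: le_lt_trans.
have mabs D : measurable_fun D (fun x => `|(exponential_pdf 1 x)%:E| : \bar R)%E.
  apply: measurableT_comp => //.
  by apply/measurable_EFinP/measurable_funTS; exact: measurable_exponential_pdf.
apply: (@le_trans _ _ (\int[mu]_(x in `[1%R, +oo[) `|(exponential_pdf 1 x)%:E|)%E).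
  apply: ge0_le_integral => //.
  - by move=> x _; rewrite lee_fin exponential_pdf_ge0.
  - by apply/measurable_EFinP/measurable_funTS; exact: measurable_exponential_pdf.
  - exact: mabs.
  - by move=> x _; rewrite lee_fin ler_norm.
by apply: ge0_subset_integral => //; exact: mabs.
Qed.

(** On []0, 1[] the integrand is at least [e^-1 x^-al]. *)
Lemma Gamma_gt0 al : 0 < al -> al < 1 -> 0 < Gamma (1 - al).
Proof.
move=> al0 al1; rewrite -lte_fin -integral_Gamma//.
have h : (0 < (expR (-1))%:E * (1%R `^ (1 - al) / (1 - al))%:E)%E.
  by rewrite -EFinM lte_fin powR1 mul1r mulr_gt0 ?expR_gt0// invr_gt0 subr_gt0.
apply: (lt_le_trans h); rewrite -integral_powRN// -ge0_integralZl//; last 2 first.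
- by apply/measurable_EFinP/measurable_funTS; exact: measurable_powR.
- by move=> x _; rewrite lee_fin powR_ge0.
apply: (@le_trans _ _ (\int[mu]_(x in `]0%R, 1%R[) (x `^ (- al) * expR (- x))%:E)%E).
  apply: ge0_le_integral => //.
  - by move=> x _; rewrite -EFinM lee_fin mulr_ge0 ?expR_ge0 ?powR_ge0.
  - apply/measurable_EFinP/measurable_funM => //.
    by apply/measurable_funTS; exact: measurable_powR.
  - apply/measurable_EFinP; exact: measurable_gamma_integrand.
  - move=> x; rewrite /= in_itv/= => /andP[x0 x1].
    by rewrite -EFinM lee_fin mulrC ler_wpM2l ?powR_ge0// ler_expR lerN2 ltW.
apply: ge0_subset_integral => //.
- apply/measurable_EFinP; exact: measurable_gamma_integrand.
- by move=> x _; rewrite lee_fin mulr_ge0 ?expR_ge0 ?powR_ge0.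
- by move=> x /=; rewrite !in_itv/= andbT => /andP[].
Qed.

(** Substitution [r = x / s + t] in the integral defining [Gamma (1 - al)]. *)
Lemma integral_laplace_powRN s t al : 0 < s -> 0 < al -> al < 1 ->
  (\int[mu]_(r in `]t, +oo[) (s * expR (- (s * r)) * (r - t) `^ (- al))%:E =
   (s `^ al * expR (- (s * t)) * Gamma (1 - al))%:E)%E.
Proof.
move=> s0 al0 al1.
have s'0 : s^-1 != 0 by rewrite gt_eqF// invr_gt0.
rewrite (@ge0_integral_affine _ s^-1 t s'0)//; last 2 first.
- apply/measurable_EFinP/measurable_funM; last exact: measurable_powRBl.
  by apply: measurable_funM => //; exact: measurable_expRN.
- by move=> x _; rewrite lee_fin !mulr_ge0 ?expR_ge0 ?powR_ge0 ?ltW.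
rewrite gtr0_norm ?invr_gt0//.
have -> : (fun x => s^-1 * x + t) @^-1` `]t, +oo[ = `]0, +oo[%classic.
  by apply/seteqP; split => x /=; rewrite !in_itv/= !andbT ltrDr pmulr_rgt0 ?invr_gt0.
rewrite (_ : (s `^ al * _ * _)%:E = (s^-1%:E * ((s * s `^ al * expR (- (s * t)))%:E * (Gamma (1 - al))%:E))%E); last first.
  by rewrite -!EFinM; congr EFin; field; rewrite gt_eqF.
congr (_ * _)%E; rewrite -integral_Gamma// -ge0_integralZl//; last 3 first.
- apply/measurable_EFinP; exact: measurable_gamma_integrand.
- by move=> x _; rewrite lee_fin mulr_ge0 ?expR_ge0 ?powR_ge0.
- by rewrite lee_fin !mulr_ge0 ?expR_ge0 ?powR_ge0 ?ltW.
apply: eq_integral => x; rewrite inE/= in_itv/= andbT => x0.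
rewrite -EFinM addrK powRM ?invr_ge0 ?ltW//; congr EFin.
have -> : expR (- (s * (s^-1 * x + t))) = expR (- (s * t)) * expR (- x).
  by rewrite -expRD; congr expR; field; rewrite gt_eqF.
have -> : s^-1 `^ (- al) = s `^ al by rewrite -powR_inv1 ?ltW// -powRrM mulN1r opprK.
by ring.
Qed.

End kernels.

(** * Laplace transform of a Volterra equation on a bounded interval *)

Section kernel_triangle.
Context {R : realType}.
Local Notation mu := (@lebesgue_measure R).
Variables (T C : R) (k : R -> R -> R) (K h : R -> R).
Hypothesis mk : measurable_fun setT (fun z : R * R => k z.1 z.2).
Hypothesis k0 : forall x y, 0 <= k x y.
Hypothesis mh : measurable_fun setT h.
Hypothesis ih : mu.-integrable `]0, T[ (EFin \o h).
Hypothesis kK : forall y, 0 < y < T ->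
  (\int[mu]_(x in `]y, T[) (k x y)%:E = (K y)%:E)%E.
Hypothesis KC : forall y, 0 < y < T -> K y <= C.

Let f x y := k x y * h y.

Let mf : measurable_fun setT (fun z : R * R => f z.1 z.2).
Proof. by apply: measurable_funM => //; exact: (measurableT_comp mh). Qed.

Let mky y D : measurable_fun D (k^~ y).
Proof.
apply: measurable_funTS.
by apply: (measurableT_comp (g := fun x => (x, y)) mk); exact: measurable_fun_pair.
Qed.

Let K0 y : 0 < y < T -> 0 <= K y.
Proof.
by move=> yT; rewrite -lee_fin -kK//; apply: integral_ge0 => x _; rewrite lee_fin.
Qed.

Let iky y : 0 < y < T -> mu.-integrable `]y, T[ (EFin \o k^~ y).
Proof.
move=> yT; apply/integrableP; split; first by apply/measurable_EFinP; exact: mky.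
under eq_integral do rewrite /= ger0_norm//.
by rewrite kK// ltry.
Qed.

Let fy : (\int[mu]_(y in `]0%R, T[) \int[mu]_(x in `]y, T[) `|f x y|%:E < +oo)%E.
Proof.
have /integrableP[mh' hy] := ih.
have [T0|T0] := leP T 0.
  by rewrite set_itv_ge ?bnd_simp -?leNgt// integral_set0 ltry.
have C0 : 0 <= C.
  have T2 : 0 < T / 2 < T by apply/andP; split; lra.
  by rewrite (le_trans (K0 T2)) ?KC.
apply: (@le_lt_trans _ _ (\int[mu]_(y in `]0%R, T[) (C%:E * `|(h y)%:E|))%E).
  rewrite le_eqVlt.
  under eq_integral.
    move=> y; rewrite inE/= in_itv/= => yT.
    under eq_integral do rewrite normrM (ger0_norm (k0 _ _)) EFinM.
    rewrite ge0_integralZr//; last 2 first.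
    - by apply/measurable_EFinP; exact: mky.
    - by move=> x _; rewrite lee_fin.
    rewrite kK//.
    over.
  rewrite -le_eqVlt.
  have mKh : measurable_fun `]0, T[ (fun y => (K y)%:E * `|h y|%:E)%E.
    apply: emeasurable_funM; last first.
      by apply/measurable_EFinP; apply: measurableT_comp => //; exact: measurable_funTS.
    (* The measurability of [K] comes from Tonelli's theorem: on []0, T[] it is the inner integral
       of [k] cut off to [y < x < T]. *)
    pose F (y : R) := (\int[mu]_x ((fun z : R * R => (if (z.1 < z.2) && (z.2 < T) then k z.2 z.1 else 0)%:E) (y, x)))%E.
    have mF : measurable_fun setT F.
      apply: measurable_fun_fubini_tonelli_F => /=; last first.
        by move=> z; case: ifPn; rewrite lee_fin.
      apply/measurable_EFinP/measurable_fun_ifT => //.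
        apply: measurable_and; first exact: measurable_fun_ltr.
        exact: measurable_fun_ltr.
      apply: (measurableT_comp (g := fun z : R * R => (z.2, z.1)) mk).
      exact: measurable_fun_pair.
    apply: (eq_measurable_fun F); last exact: measurable_funTS.
    move=> y; rewrite inE/= in_itv/= => yT.
    rewrite -kK// /F [RHS]integral_mkcond; congr integral.
    apply/funext => x /=; rewrite /patch/= mem_setE in_itv/=.
    by case: ifPn.
  apply: ge0_le_integral => //.
  - move=> y; rewrite /= in_itv/= => yT.
    by rewrite -EFinM lee_fin mulr_ge0// K0.
  - apply: emeasurable_funM => //; exact: measurableT_comp.
  - move=> y; rewrite /= in_itv/= => yT.
    by rewrite -!EFinM lee_fin ler_wpM2r// KC.
rewrite ge0_integralZl//.
- by apply: lte_mul_pinfty => //; rewrite lee_fin.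
- exact: measurableT_comp.
Qed.

Lemma kernel_triangle_inner y : 0 < y < T ->
  \int[mu]_(x in `]y, T[) (k x y * h y) = K y * h y.
Proof.
move=> yT; rewrite RintegralZr//; last exact: iky.
by congr (_ * _); rewrite /Rintegral kK.
Qed.

(** The bound [C] on [K] makes [k x y * h y] absolutely integrable over the triangle [y < x < T];
    after exchanging the integrals, only [k] depends on the inner variable. *)
Lemma kernel_triangle :
  \int[mu]_(x in `]0, T[) \int[mu]_(y in `]0, x[) (k x y * h y) =
  \int[mu]_(y in `]0, T[) (K y * h y).
Proof.
rewrite (Rfubini_triangle mf fy); apply: eq_Rintegral => y.
by rewrite inE/= in_itv/=; exact: kernel_triangle_inner.
Qed.

Lemma kernel_triangle_integrable :
  mu.-integrable `]0, T[ (EFin \o (fun y => K y * h y)).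
Proof.
have := Rfubini_triangle_integrable1 mf fy; apply: eq_integrable => // y.
by rewrite inE/= in_itv/= => yT; rewrite /= kernel_triangle_inner.
Qed.

Lemma kernel_triangle_integrable2 : mu.-integrable `]0, T[
  (EFin \o (fun x => \int[mu]_(y in `]0, x[) (k x y * h y))).
Proof. exact: (Rfubini_triangle_integrable2 mf fy). Qed.

Lemma kernel_triangle_ae : {ae mu, forall x, `]0, T[%classic x ->
  mu.-integrable `]0, x[ (EFin \o (fun y => k x y * h y))}.
Proof. exact: (Rfubini_triangle_ae2 mf fy). Qed.

End kernel_triangle.

Section Rintegrable.
Context d (T : measurableType d) (R : realType).
Variables (mu : {measure set T -> \bar R}) (D : set T).
Hypothesis mD : measurable D.
Implicit Types f g : T -> R.

Lemma RintegrableB f g : mu.-integrable D (EFin \o f) ->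
  mu.-integrable D (EFin \o g) ->
  mu.-integrable D (EFin \o (fun x => f x - g x)).
Proof.
move=> fi gi; have := integrableB mD fi gi.
by apply: eq_integrable => // x _; rewrite /= EFinB.
Qed.

Lemma RintegrableD f g : mu.-integrable D (EFin \o f) ->
  mu.-integrable D (EFin \o g) ->
  mu.-integrable D (EFin \o (fun x => f x + g x)).
Proof.
move=> fi gi; have := integrableD mD fi gi.
by apply: eq_integrable => // x _; rewrite /= EFinD.
Qed.

Lemma RintegrableZl (c : R) f : mu.-integrable D (EFin \o f) ->
  mu.-integrable D (EFin \o (fun x => c * f x)).
Proof.
move=> fi; have := integrableZl mD c fi.
by apply: eq_integrable => // x _; rewrite /= EFinM.
Qed.

End Rintegrable.

Section laplace.
Context {R : realType}.
Local Notation mu := (@lebesgue_measure R).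
Variables (al T s : R) (w w2 : R -> R) (w0 : R).
Hypotheses (al0 : 0 < al) (al1 : al < 1) (T0 : 0 < T) (s0 : 0 < s).
Hypotheses (mw : measurable_fun setT w) (mw2 : measurable_fun setT w2).
Hypothesis iw : mu.-integrable `]0, T[ (EFin \o w).
Hypothesis iw2 : mu.-integrable `]0, T[ (EFin \o w2).
Hypothesis w2E : forall r, 0 < r < T -> \int[mu]_(t in `]0, r[) w2 t =
  (Gamma (1 - al))^-1 * \int[mu]_(t in `]0, r[) ((r - t) `^ (- al) * (w t - w0)).

Let G := Gamma (1 - al) : R.
Let G0 : 0 < G. Proof. exact: Gamma_gt0. Qed.

Let h t := G^-1 * (w t - w0).

Let mh : measurable_fun setT h.
Proof. by apply: measurable_funM => //; exact: measurable_funB. Qed.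

Let icst (c : R) : mu.-integrable `]0, T[ (EFin \o cst c).
Proof.
apply/integrableP; split; first by apply/measurable_EFinP; exact: measurable_cst.
rewrite (eq_integral (cst `|c|%:E)) ?integral_cst//= lebesgue_measure_itv/= lte_fin T0 oppr0 adde0 -EFinM.
exact: ltry.
Qed.

Let iww0 : mu.-integrable `]0, T[ (EFin \o (fun t => w t - w0)).
Proof. by apply: RintegrableB => //; exact: icst. Qed.

Let ih : mu.-integrable `]0, T[ (EFin \o h).
Proof. by apply: RintegrableZl. Qed.

(** The Volterra equation at [r] is multiplied by [s e^(-sr)] and integrated over []0, T[]. The two
    sides then have the kernels [k1] and [k2], and [K1], [K2] appear when the integral over [r] is
    carried out first. The factor [s] makes [K1] a plain difference of exponentials. *)
Let k1 (r t : R) := s * expR (- (s * r)).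
Let K1 t := expR (- (s * t)) - expR (- (s * T)).

Let k2 (r t : R) := s * expR (- (s * r)) * (r - t) `^ (- al).
Let K2 t := \int[mu]_(r in `]t, T[) k2 r t.

Let mk1 : measurable_fun setT (fun z : R * R => k1 z.1 z.2).
Proof.
apply: measurable_funM => //.
exact: (measurableT_comp (@measurable_expRN R s setT)).
Qed.

Let mk2 : measurable_fun setT (fun z : R * R => k2 z.1 z.2).
Proof.
apply: measurable_funM => //.
apply: (measurableT_comp (@measurable_powR R (- al))).
exact: measurable_funB.
Qed.

Let k10 x y : 0 <= k1 x y.
Proof. by rewrite mulr_ge0 ?expR_ge0// ltW. Qed.

Let k20 x y : 0 <= k2 x y.
Proof. by rewrite mulr_ge0 ?powR_ge0 ?k10. Qed.

(** The integral of [k2] over all of []t, +oo[] is explicit, so the difference is its tail beyond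
    [T]. There [(r - t)^-al <= (r - T)^-al], which bounds the tail by the explicit integral started
    at [T]. *)
Let k2_bounds t : 0 < t < T -> exists2 K,
  (\int[mu]_(r in `]t, T[) (k2 r t)%:E = K%:E)%E &
  0 <= s `^ al * expR (- (s * t)) * G - K <= s `^ al * expR (- (s * T)) * G.
Proof.
move=> /andP[t0 tT].
have mk D : measurable_fun D (fun r => (k2 r t)%:E).
  apply/measurable_EFinP; apply: measurable_funTS.
  apply: (measurableT_comp (g := fun x => (x, t)) mk2); exact: measurable_fun_pair.
have k0 x : (0 <= (k2 x t)%:E)%E by rewrite lee_fin.
have := @integral_laplace_powRN R s t al s0 al0 al1.
have -> : `]t, +oo[%classic = `]t, T[%classic `|` `[T, +oo[%classic :> set R.
  apply/seteqP; split => x /=; rewrite !in_itv/= !andbT.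
    by move=> x0; have [?|?] := ltP x T; [left|right]; rewrite ?x0.
  by move=> [/andP[]//|x1]; rewrite (lt_le_trans _ x1).
rewrite ge0_integral_setU//=; last 3 first.
- exact: (mk _).
- by move=> x _; exact: k0.
- rewrite disj_set2E; apply/eqP/seteqP; split => // x [] /=; rewrite !in_itv/= andbT.
  by move=> /andP[_ x1]; rewrite leNgt x1.
rewrite -integral_itv_obnd_cbnd; last exact: mk.
set I1 := (X in (X + _)%E); set I2 := (X in (_ + X)%E) => I12.
have I10 : (0 <= I1)%E by apply: integral_ge0 => x _; exact: k0.
have I20 : (0 <= I2)%E by apply: integral_ge0 => x _; exact: k0.
have I2T : (I2 <= (s `^ al * expR (- (s * T)) * G)%:E)%E.
  rewrite -[leRHS](integral_laplace_powRN T s0 al0 al1); apply: ge0_le_integral => //.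
  - by move=> x _; exact: k0.
  - exact: mk.
  - apply/measurable_EFinP/measurable_funM; last exact: measurable_powRBl.
    by apply: measurable_funM => //; exact: measurable_expRN.
  - move=> r; rewrite /= in_itv/= andbT => rT.
    rewrite lee_fin ler_wpM2l ?mulr_ge0 ?expR_ge0 ?(ltW s0)//.
    rewrite !powRN lef_pV2 ?posrE ?powR_gt0 ?subr_gt0//; last exact: lt_trans rT.
    by rewrite ge0_ler_powR ?nnegrE ?subr_ge0 ?ltW// ?ler_ltB//; lra.
have I1f : I1 \is a fin_num.
  rewrite ge0_fin_numE//; apply: (@le_lt_trans _ _ (I1 + I2)%E); first exact: leeDl.
  by rewrite I12 ltry.
have I2f : I2 \is a fin_num by rewrite ge0_fin_numE// (le_lt_trans I2T)// ltry.
exists (fine I1); first by rewrite fineK.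
rewrite -(fineK I1f) -(fineK I2f) in I12 I20 I2T.
move: I12 => [<-]; rewrite addrAC subrr add0r -!lee_fin I20/=.
exact: I2T.
Qed.

Let k1K1 t : 0 < t < T -> (\int[mu]_(r in `]t, T[) (k1 r t)%:E = (K1 t)%:E)%E.
Proof. by move=> /andP[_ /ltW]; exact: integral_expRN_itv. Qed.

Let k2K2 t : 0 < t < T -> (\int[mu]_(r in `]t, T[) (k2 r t)%:E = (K2 t)%:E)%E.
Proof. by move=> /k2_bounds[K KE _]; rewrite /K2 /Rintegral KE. Qed.

Let K2_bounds t : 0 < t < T ->
  0 <= s `^ al * expR (- (s * t)) * G - K2 t <= s `^ al * expR (- (s * T)) * G.
Proof. by move=> /k2_bounds[K KE]; rewrite /K2 /Rintegral KE. Qed.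

Let K1_le t : 0 < t < T -> K1 t <= 1.
Proof.
move=> /andP[t0 _]; rewrite lerBlDr (@le_trans _ _ 1)//; last first.
  by rewrite lerDl expR_ge0.
by rewrite -expR0 ler_expR oppr_le0 mulr_ge0 ?ltW.
Qed.

Let K2_le t : 0 < t < T -> K2 t <= s `^ al * G.
Proof.
move=> tT; have /andP[+ _] := K2_bounds tT; rewrite subr_ge0 => /le_trans; apply.
rewrite ler_wpM2r ?(ltW G0)// ler_piMr ?powR_ge0// -expR0 ler_expR oppr_le0.
by case/andP: tT => t0 _; rewrite mulr_ge0 ?ltW.
Qed.

Let main_eq : \int[mu]_(t in `]0, T[) (K1 t * w2 t) =
              \int[mu]_(t in `]0, T[) (K2 t * h t).
Proof.
rewrite -(kernel_triangle mk1 k10 mw2 iw2 k1K1 K1_le).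
rewrite -(kernel_triangle mk2 k20 mh ih k2K2 K2_le).
apply: Rintegral_ae_eq.
have := kernel_triangle_ae mk2 k20 mh ih k2K2 K2_le.
apply: filterS; first exact: (ae_filter_ringOfSetsType mu).
move=> r + rT => /(_ rT) ik2h.
move: rT; rewrite /= in_itv/= => /andP[r0 rT].
have ir2 : mu.-integrable `]0, r[ (EFin \o w2).
  by apply: integrableS iw2 => //; apply: subset_itvl; rewrite bnd_simp ltW.
rewrite /k1 RintegralZl// w2E ?r0//.
pose c := s * expR (- (s * r)) * G^-1.
have c0 : c != 0 by rewrite !mulf_neq0 ?invr_eq0 ?gt_eqF ?expR_gt0.
have iw0 : mu.-integrable `]0, r[
    (EFin \o (fun t => (r - t) `^ (- al) * (w t - w0))).
  have : mu.-integrable `]0, r[ (EFin \o (fun t => c^-1 * (k2 r t * h t))).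
    exact: RintegrableZl.
  apply: eq_integrable => // t _.
  rewrite /=; congr EFin; rewrite /c /k2 /h; field.
  by rewrite !gt_eqF ?expR_gt0.
rewrite mulrA -/c -RintegralZl//; apply: eq_Rintegral => t _.
by rewrite /c /k2 /h; ring.
Qed.

Let iexp g : mu.-integrable `]0, T[ (EFin \o g) ->
  mu.-integrable `]0, T[ (EFin \o (fun t => expR (- (s * t)) * g t)).
Proof.
move=> ig; have [mg _] := integrableP _ _ _ ig.
apply: le_integrable ig => //.
  apply/measurable_EFinP/measurable_funM; first exact: measurable_expRN.
  exact/measurable_EFinP.
move=> t; rewrite /= in_itv/= => /andP[t0 _].
rewrite lee_fin normrM ler_piMl// ger0_norm ?expR_ge0//.
by rewrite -expR0 ler_expR oppr_le0 mulr_ge0 ?ltW.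
Qed.

(* Up to the tail over [(T, +oo)], the Laplace transform of the kernel
   [(r - t)^-al] is [Gamma (1 - al) * s^(al - 1)]; the tail carries the factor
   [expR (- (s * T))]. *)
Lemma laplace_volterra :
  `|\int[mu]_(t in `]0, T[) (expR (- (s * t)) * w2 t) -
    s `^ al * \int[mu]_(t in `]0, T[) (expR (- (s * t)) * (w t - w0))| <=
  expR (- (s * T)) * (\int[mu]_(t in `]0, T[) `|w2 t| +
    s `^ al * \int[mu]_(t in `]0, T[) `|w t - w0|).
Proof.
have iK2h := kernel_triangle_integrable mk2 k20 mh ih k2K2 K2_le.
have iab g : mu.-integrable `]0, T[ (EFin \o g) ->
    mu.-integrable `]0, T[ (EFin \o (fun t => `|g t|)).
  by move=> /integrable_abse.
have E1 : \int[mu]_(t in `]0, T[) (K1 t * w2 t) =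
    \int[mu]_(t in `]0, T[) (expR (- (s * t)) * w2 t) -
    expR (- (s * T)) * \int[mu]_(t in `]0, T[) w2 t.
  rewrite -RintegralZl// -RintegralB//; last 2 first.
  - exact: iexp.
  - exact: RintegrableZl.
  by apply: eq_Rintegral => t _; rewrite mulrBl.
have iE := iexp iww0.
have isE : mu.-integrable `]0, T[
    (EFin \o (fun t => s `^ al * (expR (- (s * t)) * (w t - w0)))).
  exact: RintegrableZl.
have E2 : \int[mu]_(t in `]0, T[) (K2 t * h t) -
    s `^ al * \int[mu]_(t in `]0, T[) (expR (- (s * t)) * (w t - w0)) =
    \int[mu]_(t in `]0, T[) (K2 t * h t - s `^ al * (expR (- (s * t)) * (w t - w0))).
  by rewrite -RintegralZl// -RintegralB.
rewrite (_ : _ - _ = expR (- (s * T)) * \int[mu]_(t in `]0, T[) w2 t +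
  (\int[mu]_(t in `]0, T[) (K2 t * h t) -
    s `^ al * \int[mu]_(t in `]0, T[) (expR (- (s * t)) * (w t - w0)))); last first.
  by rewrite -main_eq E1; ring.
rewrite mulrDr; apply: le_trans (ler_normD _ _) _; apply: lerD.
  by rewrite normrM ger0_norm ?expR_ge0// ler_wpM2l ?expR_ge0// le_normr_Rintegral.
have iD : mu.-integrable `]0, T[ (EFin \o (fun t =>
    K2 t * h t - s `^ al * (expR (- (s * t)) * (w t - w0)))).
  exact: RintegrableB.
rewrite E2; apply: le_trans (le_normr_Rintegral _ _) _ => //.
rewrite mulrA -RintegralZl//; last exact: iab.
apply: le_Rintegral => //.
- exact: iab.
- by apply: RintegrableZl => //; exact: iab.
move=> t; rewrite /= in_itv/= => /K2_bounds /andP[h1 h2].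
rewrite (_ : _ - _ = - ((s `^ al * expR (- (s * t)) * G - K2 t) * h t)); last first.
  by rewrite /h; field; rewrite gt_eqF.
rewrite normrN normrM ger0_norm// /h normrM [`|G^-1|]gtr0_norm ?invr_gt0//.
rewrite mulrA ler_wpM2r// ler_pdivrMr//; apply: le_trans h2 _.
by rewrite [X in X * _ <= _]mulrC.
Qed.

End laplace.

(** * Phragmen's uniqueness lemma for Laplace transforms *)

Section Rdominated.
Context d (T : measurableType d) (R : realType).
Variables (mu : {measure set T -> \bar R}) (D : set T).
Hypothesis mD : measurable D.
Variables (f_ : nat -> T -> R) (f g : T -> R).
Hypothesis mf_ : forall n, measurable_fun D (f_ n).
Hypothesis mf : measurable_fun D f.
Hypothesis f_f : {ae mu, forall x, D x -> f_ n x @[n --> \oo] --> f x}.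
Hypothesis ig : mu.-integrable D (EFin \o g).
Hypothesis f_g : forall n x, D x -> `|f_ n x| <= g x.

Lemma Rdominated_convergence :
  \int[mu]_(x in D) f_ n x @[n --> \oo] --> \int[mu]_(x in D) f x.
Proof.
have mE n : measurable_fun D (EFin \o f_ n) by exact/measurable_EFinP.
have mEf : measurable_fun D (EFin \o f) by exact/measurable_EFinP.
have fE : {ae mu, forall x, D x -> (EFin \o f_ n) x @[n --> \oo] --> (EFin \o f) x}.
  by apply: filterS f_f => x h Dx; apply: cvg_EFin; [exact: nearW|exact: h].
have fg : {ae mu, forall x n, D x -> (`|(EFin \o f_ n) x| <= (EFin \o g) x)%E}.
  by apply: aeW => x n Dx; rewrite lee_fin f_g.
have [fi _] := dominated_convergence mD mE mEf fE ig fg.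
rewrite -(fineK (integrable_fin_num mD fi)).
exact: fine_cvg.
Qed.

End Rdominated.

Section phragmen.
Context {R : realType}.
Local Notation mu := (@lebesgue_measure R).

Lemma series_exp_coeff_le (x : R) n : 0 <= x -> series (exp_coeff x) n <= expR x.
Proof.
move=> x0; apply: nondecreasing_cvgn_le; last exact: is_cvg_series_exp_coeff.
by apply: nondecreasing_series => k _ _; exact: exp_coeff_ge0.
Qed.

Lemma norm_series_exp_coeff_le (x : R) n : `|series (exp_coeff x) n| <= expR `|x|.
Proof.
apply: le_trans (series_exp_coeff_le n (normr_ge0 x)).
rewrite /series/=; apply: le_trans (ler_norm_sum _ _ _) _.
by apply: ler_sum => i _; rewrite /exp_coeff/= normrM normrX normfV normr_nat.
Qed.

Lemma cvg_expRNn (a : R) : 0 < a -> expR (- (a * n%:R)) @[n --> \oo] --> 0.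
Proof.
move=> a0.
have -> : (fun n : nat => expR (- (a * n%:R))) = (fun n => expR (- a) ^+ n).
  by apply/funext => n; rewrite -expRM_natl; congr expR; ring.
by apply: cvg_expr; rewrite ger0_norm ?expR_ge0// expR_lt1 oppr_lt0.
Qed.

Definition lt_ind (p y : R) : R := (y < p)%R%:R.

Lemma measurable_lt_ind p (D : set R) : measurable_fun D (lt_ind p).
Proof.
apply: measurable_funTS.
have -> : lt_ind p = (fun y => if y < p then 1 else 0).
  by apply/funext => y; rewrite /lt_ind; case: ltP.
by apply: measurable_fun_ifT => //; exact: measurable_fun_ltr.
Qed.

Variables (D : set R) (f : R -> R) (c q : R).
Hypothesis mD : measurable D.
Hypothesis Dc : forall x, D x -> c <= x.
Hypothesis intf : mu.-integrable D (EFin \o f).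
Hypothesis f_growth : forall e, 0 < e -> exists C, forall n : nat,
  `|\int[mu]_(y in D) (expR (n%:R * (q - y)) * f y)| <= C * expR (e * n%:R).

Let mf : measurable_fun D f.
Proof. by have [/measurable_EFinP] := integrableP _ _ _ intf. Qed.

Let iabs : mu.-integrable D (EFin \o (fun y => `|f y|)).
Proof. exact: (integrable_abse intf). Qed.

Let imul (g : R -> R) (B : R) : measurable_fun D g ->
  (forall y, D y -> `|g y| <= B) -> mu.-integrable D (EFin \o (fun y => g y * f y)).
Proof.
move=> mg gB.
have : mu.-integrable D (EFin \o (fun y => B * `|f y|)) by exact: RintegrableZl.
apply: le_integrable => //; first exact/measurable_EFinP/measurable_funM.
move=> y Dy; rewrite lee_fin !normrM normr_id ler_wpM2r//.
by apply: le_trans (gB _ Dy) _; exact: ler_norm.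
Qed.

Let mexp (a b : R) : measurable_fun D (fun y => expR (a * (b - y))).
Proof.
have h : measurable_fun D (fun y => a * (b - y)).
  by apply: (measurable_funM (f := cst a)) => //; exact: measurable_funB.
exact: (measurableT_comp _ h).
Qed.

Let exp_bound (a b y : R) : 0 <= a -> D y -> `|expR (a * (b - y))| <= expR (a * (b - c)).
Proof.
move=> a0 Dy; rewrite ger0_norm ?expR_ge0// ler_expR ler_wpM2l//.
by rewrite lerB// Dc.
Qed.

(* [phi p n] converges to the indicator of [y < p] as [n] grows, while its
   expansion in powers of [expR (n * (p - y))] reduces the integral against [f]
   to the integrals bounded by [f_growth]. *)
Let phi (p : R) (n : nat) (y : R) := 1 - expR (- expR (n%:R * (p - y))).

(** The term of order [k + 1] of the expansion of [phi] is a multiple of [expR ((k + 1) n (p - y))].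
    Compared with [q] in place of [p] it gains [expR (- (k + 1) n e)], half of which pays for the
    growth of the integrals. What remains is at most [expR (- e n / 2) / (k + 1)!], and the
    factorials sum to at most [expR 1]. Only integer parameters [(k + 1) n] occur, so growth along
    the integers suffices. *)
Let phi_int_bound (p e C : R) (n : nat) : 0 < e -> p + e <= q -> 0 <= C ->
  (forall n : nat, `|\int[mu]_(y in D) (expR (n%:R * (q - y)) * f y)| <=
     C * expR (e / 2 * n%:R)) ->
  `|\int[mu]_(y in D) (phi p n y * f y)| <= C * (expR 1 * expR (- (e / 2 * n%:R))).
Proof.
move=> e0 peq C0 hC.
pose S (K : nat) (y : R) := 1 - series (exp_coeff (- expR (n%:R * (p - y)))) K.+1.
pose t (k : nat) (y : R) : R := - (-1) ^+ k.+1 / (k.+1)`!%:R *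
  expR (k.+1%:R * (n%:R * (p - y))).
have SE K y : S K y = \sum_(0 <= k < K) t k y.
  rewrite /S /series/= big_nat_recl//= /exp_coeff/= expr0 fact0 divr1.
  rewrite opprD addNKr -sumrN; apply: eq_bigr => k _.
  by rewrite /t (expRM_natl k.+1) [in LHS]exprNn !mulNr mulrAC.
have mS K : measurable_fun D (S K).
  have -> : S K = (fun y => \sum_(0 <= k < K) t k y) by apply/funext => y; rewrite SE.
  apply: measurable_sum => k; apply: measurable_funM => //.
  by have := @mexp (k.+1%:R * n%:R) p; under eq_fun do rewrite -mulrA.
(* The lower bound [c] of [D] makes the partial sums bounded on [D] uniformly in [K], as dominated
   convergence requires. *)
have bS K y : D y -> `|S K y| <= 1 + expR (expR (n%:R * (p - c))).
  move=> Dy; apply: le_trans (ler_normB _ _) _; rewrite normr1 lerD2l.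
  apply: le_trans (norm_series_exp_coeff_le _ _) _.
  rewrite normrN ler_expR; exact: exp_bound.
have mphi : measurable_fun D (phi p n).
  apply: measurable_funB => //; apply: (measurableT_comp (f := expR)) => //.
  by apply: measurableT_comp => //; exact: mexp.
have cS : \int[mu]_(y in D) (S K y * f y) @[K --> \oo] -->
    \int[mu]_(y in D) (phi p n y * f y).
  apply: (@Rdominated_convergence _ _ _ mu D mD _ _
    (fun y => (1 + expR (expR (n%:R * (p - c)))) * `|f y|)).
  - by move=> K; apply: measurable_funM; [exact: mS|exact: mf].
  - exact: measurable_funM.
  - apply: aeW => y Dy; apply: cvgMl; apply: cvgB; first exact: cvg_cst.
    have := is_cvg_series_exp_coeff (- expR (n%:R * (p - y))).
    by rewrite -(@cvg_shiftS R).
  - exact: RintegrableZl.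
  - by move=> K y Dy; rewrite normrM ler_wpM2r// bS.
have tE k y : t k y * f y = (- (-1) ^+ k.+1 / (k.+1)`!%:R *
    expR (- ((k.+1 * n)%:R * (q - p)))) * (expR ((k.+1 * n)%:R * (q - y)) * f y).
  rewrite /t -!mulrA; congr (_ * (_ * _)); rewrite [RHS]mulrA -expRD; congr (expR _ * _).
  by rewrite natrM; ring.
have ik k : mu.-integrable D (EFin \o (fun y => expR ((k.+1 * n)%:R * (q - y)) * f y)).
  by apply: (@imul _ (expR ((k.+1 * n)%:R * (q - c)))) => // y Dy; exact: exp_bound.
have it k : mu.-integrable D (EFin \o (fun y => t k y * f y)).
  under [X in EFin \o X]eq_fun do rewrite tE.
  exact: RintegrableZl.
have bt k : `|\int[mu]_(y in D) (t k y * f y)| <=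
    C * expR (- (e / 2 * n%:R)) * exp_coeff 1 k.+1.
  under eq_Rintegral do rewrite tE.
  rewrite RintegralZl// !normrM normrN normrX normrN1 expr1n mul1r normfV normr_nat.
  rewrite (ger0_norm (expR_ge0 _)) /exp_coeff/= expr1n div1r.
  rewrite [leRHS]mulrC -mulrA ler_pM2l ?invr_gt0 ?ltr0n ?fact_gt0//.
  apply: le_trans (ler_wpM2l (expR_ge0 _) (hC _)) _.
  rewrite mulrCA ler_wpM2l// -expRD ler_expR natrM.
  have k1 : (1 : R) <= k.+1%:R by rewrite ler1n.
  have n0 : (0 : R) <= n%:R by [].
  have : k.+1%:R * n%:R * (q - p) >= k.+1%:R * n%:R * e.
    by rewrite ler_wpM2l ?mulr_ge0//; lra.
  have : e / 2 * (k.+1%:R * n%:R) >= e / 2 * n%:R.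
    by rewrite ler_wpM2l ?ler_peMl//; lra.
  lra.
have bI K : mu.-integrable D (EFin \o (fun y => S K y * f y)) /\
  `|\int[mu]_(y in D) (S K y * f y)| <=
    C * expR (- (e / 2 * n%:R)) * \sum_(0 <= k < K) exp_coeff 1 k.+1.
  elim: K => [|K [iK bK]].
    have S0 y : S 0 y = 0 by rewrite SE big_nil.
    split; first by apply: (@imul _ 0) => // y _; rewrite S0 normr0.
    under eq_Rintegral do rewrite S0 mul0r.
    by rewrite Rintegral_cst// mul0r normr0 big_nil mulr0.
  have SS y : S K.+1 y * f y = S K y * f y + t K y * f y.
    by rewrite !SE big_nat_recr//= mulrDl.
  split.
    have : mu.-integrable D (EFin \o (fun y => S K y * f y + t K y * f y)).
      exact: RintegrableD.
    by apply: eq_integrable => // y _; rewrite /= SS.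
  under eq_Rintegral do rewrite SS.
  rewrite RintegralD// big_nat_recr//= mulrDr.
  by apply: le_trans (ler_normD _ _) _; exact: lerD.
have Sle K : \sum_(0 <= k < K) exp_coeff 1 k.+1 <= expR 1 :> R.
  apply: le_trans (series_exp_coeff_le K.+1 ler01).
  by rewrite /series/= big_nat_recl//= lerDr exp_coeff_ge0.
have hn : `|\int[mu]_(y in D) (S K y * f y)| @[K --> \oo] -->
    `|\int[mu]_(y in D) (phi p n y * f y)| by exact: cvg_norm.
rewrite -(cvg_lim (@Rhausdorff R) hn).
apply: limr_le; first by apply/cvg_ex; eexists; exact: hn.
apply: nearW => K; have [_ /le_trans] := bI K; apply.
by rewrite [expR 1 * _]mulrC mulrA ler_wpM2l ?mulr_ge0 ?expR_ge0.
Qed.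

Lemma phragmen_int0 p : p < q -> \int[mu]_(y in D) (lt_ind p y * f y) = 0.
Proof.
move=> pq; pose e := q - p; have e0 : 0 < e by rewrite subr_gt0.
have [C0 hC0] := f_growth (divr_gt0 e0 (ltr0Sn R 1)).
pose C := `|C0|.
have hC (n : nat) : `|\int[mu]_(y in D) (expR (n%:R * (q - y)) * f y)| <=
    C * expR (e / 2 * n%:R).
  by apply: le_trans (hC0 n) _; rewrite ler_wpM2r ?expR_ge0// ler_norm.
have bnd n := @phi_int_bound p e C n e0 (ltac:(by rewrite /e; lra))
  (normr_ge0 _) hC.
have cvg0 : \int[mu]_(y in D) (phi p n y * f y) @[n --> \oo] --> 0.
  apply: norm_cvg0.
  apply: (@squeeze_cvgr _ _ _ _ (cst 0) (fun n => C * (expR 1 * expR (- (e / 2 * n%:R))))).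
  - by apply: nearW => n; rewrite normr_ge0 bnd.
  - exact: cvg_cst.
  - rewrite -[X in _ --> X](mulr0 C); apply: cvgMr.
    rewrite -[X in _ --> X](mulr0 (expR 1)); apply: cvgMr.
    by apply: cvg_expRNn; lra.
have mphi n : measurable_fun D (phi p n).
  apply: measurable_funB => //; apply: (measurableT_comp (f := expR)) => //.
  by apply: measurableT_comp => //; exact: mexp.
have cvg1 : \int[mu]_(y in D) (phi p n y * f y) @[n --> \oo] -->
    \int[mu]_(y in D) (lt_ind p y * f y).
  apply: (@Rdominated_convergence _ _ _ mu D mD _ _ (fun y => `|f y|)).
  - by move=> K; apply: measurable_funM; [exact: mphi|exact: mf].
  - by apply: measurable_funM => //; exact: measurable_lt_ind.
  (* At [y = p] the value of [phi p n] is [1 - 1/e] for every [n], so this point is left out. *)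
  - exists [set p]; split => //; first exact: lebesgue_measure_set1.
    move=> y /=; apply: contra_notP => /eqP yp Dy.
    apply: cvgMl.
    have [ylp|ply|/eqP] := ltgtP y p; last by rewrite (negbTE yp).
      rewrite /lt_ind ylp -[X in _ --> X]subr0; apply: cvgB; first exact: cvg_cst.
      have a0 : 0 < p - y by rewrite subr_gt0.
      apply: (@squeeze_cvgr _ _ _ _ (cst 0) (fun n => expR (- ((p - y) * n%:R)))).
      + apply: nearW => n; rewrite expR_ge0/= ler_expR lerN2 mulrC.
        by apply: le_trans (expR_ge1Dx _); rewrite lerDr.
      + exact: cvg_cst.
      + exact: cvg_expRNn.
    rewrite /lt_ind ltNge (ltW ply)/= -[X in _ --> X](subrr 1).
    apply: cvgB; first exact: cvg_cst.
    rewrite -[X in _ --> X](@expR0 R); apply: continuous_cvg; first exact: continuous_expR.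
    rewrite -[X in _ --> X]oppr0; apply: cvgN.
    have -> : (fun n : nat => expR (n%:R * (p - y))) = (fun n : nat => expR (- ((y - p) * n%:R))).
      by apply/funext => n; congr expR; ring.
    by apply: cvg_expRNn; rewrite subr_gt0.
  - exact: iabs.
  - move=> n y Dy; rewrite normrM ler_piMl// /phi ger0_norm.
      by rewrite lerBlDr lerDl expR_ge0.
    by rewrite subr_ge0 -expR0 ler_expR oppr_le0 expR_ge0.
by rewrite -(cvg_lim (@Rhausdorff R) cvg1) (cvg_lim (@Rhausdorff R) cvg0).
Qed.

(** By [phragmen_int0] the primitive of [f] vanishes on []-oo, q[]; by Lebesgue's differentiation
    theorem its derivative is [f] almost everywhere. *)
Lemma phragmen : {ae mu, forall y, D y -> y < q -> f y = 0}.
Proof.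
pose g := f \_ D.
have ig : mu.-integrable setT (EFin \o g).
  by have := (integrable_mkcond (mu := mu) (EFin \o f) mD).1 intf; rewrite restrict_EFin.
have locg : locally_integrable setT g by apply: open_integrable_locally; [exact: openT|].
have igy y : mu.-integrable `]-oo, y] (EFin \o g).
  exact: integrableS ig.
have := FTC1Ny igy locg.
apply: filterS; first exact: (ae_filter_ringOfSetsType mu).
move=> x [_ gx] Dx xq.
have <- : g x = f x by rewrite /g patchE mem_set.
rewrite -gx derive1E.
rewrite (@near_eq_derive _ _ _ _ (cst 0))//; first exact: derive_cst.
near=> y.
have yq : y < q by near: y; exact: lt_nbhsl.
rewrite -Rintegral_itv_bndo_bndc; last first.
  by apply: integrableS ig.
rewrite -[RHS](phragmen_int0 yq) Rintegral_mkcond [RHS]Rintegral_mkcond.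
apply: eq_Rintegral => z _; rewrite /g /patch/= !mem_setE in_itv/= /lt_ind.
by have [zy|zy] := ltP z y; case: ifPn => // _; rewrite ?mul1r ?mul0r.
Unshelve. all: by end_near. Qed.

End phragmen.

(** * Smooth cut-off functions and the one-dimensional Helmholtz equation *)

Section smooth.
Context {R : realType}.
Implicit Types (f g F G : R -> R) (a b c x y : R) (n k : nat).

(** [n]-fold differentiability with the successive derivatives given as witnesses, so that closure
    under sums, products and affine substitutions goes by induction without computing [derive1n]. *)
Fixpoint Ck n f : Prop :=
  if n is n'.+1 then exists2 g, (forall x, is_derive x 1 f (g x)) & Ck n' g
  else True.

Definition smooth f := forall n, Ck n f.

Lemma derive1_funE f g : (forall x, is_derive x 1 f (g x)) -> (derive1 f) = g.
Proof. by move=> fg; apply/funext => x; rewrite derive1E; exact: derive_val. Qed.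

Lemma is_derive_continuous f g : (forall x, is_derive x 1 f (g x)) -> continuous f.
Proof.
move=> fg x; apply/differentiable_continuous/derivable1_diffP.
by have := fg x => ?; exact: ex_derive.
Qed.

Lemma CkW n f : Ck n.+1 f -> Ck n f.
Proof. by elim: n f => // n IH f [g fg /IH ?]; exists g. Qed.

Lemma smooth_derive1 f : smooth f -> smooth (derive1 f).
Proof. by move=> sf n; have [g fg Cg] := sf n.+1; rewrite (derive1_funE fg). Qed.

Lemma smooth_is_derive f : smooth f -> forall x, is_derive x 1 f ((derive1 f) x).
Proof. by move=> sf x; have [g fg _] := sf 1; rewrite (derive1_funE fg). Qed.

Lemma smooth_continuous f : smooth f -> continuous f.
Proof. by move/smooth_is_derive/is_derive_continuous. Qed.

Lemma smooth_derivable f n x : smooth f -> derivable (derive1n n f) x 1.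
Proof.
move=> sf; have sn : smooth (derive1n n f).
  by elim: n => // n; rewrite derive1nS; exact: smooth_derive1.
by have := smooth_is_derive sn x => ?; exact: ex_derive.
Qed.

Lemma derivable_smooth f : (forall n x, derivable (derive1n n f) x 1) -> smooth f.
Proof.
move=> df n; suff H k : Ck n (derive1n k f) by exact: (H 0).
elim: n k => // n IH k; exists (derive1n k.+1 f); last exact: IH.
by move=> x; rewrite derive1nS derive1E; apply/derivableP/df.
Qed.

Lemma smooth_primitive F f : (forall x, is_derive x 1 F (f x)) -> smooth f -> smooth F.
Proof. by move=> Ff sf [//|n]; exists f. Qed.

Lemma CkD n f g : Ck n f -> Ck n g -> Ck n (fun x => f x + g x).
Proof.
elim: n f g => // n IH f g [f' ff Cf] [g' gg Cg].
exists (fun x => f' x + g' x); last exact: IH.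
by move=> x; have := ff x; have := gg x => *; exact: is_deriveD.
Qed.

Lemma CkM n f g : Ck n f -> Ck n g -> Ck n (fun x => f x * g x).
Proof.
elim: n f g => // n IH f g Cf Cg.
have [f' ff Cf'] := Cf; have [g' gg Cg'] := Cg.
exists (fun x => f x * g' x + g x * f' x).
  by move=> x; have := ff x; have := gg x => *; exact: is_deriveM.
by apply: CkD; apply: IH => //; exact: CkW.
Qed.

Lemma smooth_cst c : smooth (cst c).
Proof.
move=> n; elim: n c => // n IH c; exists (cst 0) => // x.
exact: is_derive_cst.
Qed.

Lemma smoothD f g : smooth f -> smooth g -> smooth (fun x => f x + g x).
Proof. by move=> sf sg n; exact: CkD. Qed.

Lemma smoothM f g : smooth f -> smooth g -> smooth (fun x => f x * g x).
Proof. by move=> sf sg n; exact: CkM. Qed.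

Lemma smoothZ c f : smooth f -> smooth (fun x => c * f x).
Proof. by move=> sf; apply: smoothM => //; exact: smooth_cst. Qed.

Lemma is_derive_affine f g a b x : is_derive (a * x + b) 1 f (g (a * x + b)) ->
  is_derive x 1 (fun x => f (a * x + b)) (a * g (a * x + b)).
Proof.
move=> h.
have h1 : is_derive x 1 (fun x => a * x + b) a.
  apply: (is_derive_eq (is_deriveD (is_deriveM (is_derive_cst a x 1)
    (is_derive_id x 1)) (is_derive_cst b x 1))).
  by rewrite /GRing.scale/= mulr1 mulr0 !addr0.
have := @is_derive1_comp _ f (fun x => a * x + b) x _ _ h h1.
by rewrite /comp mulrC.
Qed.

Lemma smooth_affine f a b : smooth f -> smooth (fun x => f (a * x + b)).
Proof.
move=> sf n; elim: n f sf => // n IH f sf.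
exists (fun x => a * (derive1 f) (a * x + b)).
  by move=> x; apply: is_derive_affine; exact: smooth_is_derive.
apply: CkM; first exact: smooth_cst.
by apply: (IH (derive1 f)); exact: smooth_derive1.
Qed.

Lemma smooth_expR : smooth expR.
Proof. by elim=> // n IH; exists expR => // x; exact: is_derive_expR. Qed.

Lemma smooth_expRM a : smooth (fun x => expR (a * x)).
Proof.
have := @smooth_affine expR a 0 smooth_expR.
by under eq_fun do rewrite addr0.
Qed.

(* The functions [x |-> x^-k exp(-1/x)], extended by [0] to the left of [0],
   have linear combinations of functions of the same family as derivatives. *)
Definition flat k x : R := if 0 < x then x ^- k * expR (- x^-1) else 0.

(** A single term of the exponential series at [1/x] gives [expR (1/x) >= x^-(k+2) / (k+2)!]. The
    quadratic bound is what yields the zero derivative at 0. *)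
Lemma flat_le k x : 0 < x -> flat k x <= (k.+2)`!%:R * x ^+ 2.
Proof.
move=> x0; rewrite /flat x0.
have h : x ^- k.+2 <= (k.+2)`!%:R * expR x^-1.
  have := @series_exp_coeff_le R x^-1 k.+3; rewrite invr_ge0 ltW// => /(_ isT).
  rewrite /series/= big_nat_recr//= => h.
  have : exp_coeff x^-1 k.+2 <= expR x^-1.
    apply: le_trans h; rewrite lerDr sumr_ge0// => i _.
    by rewrite exp_coeff_ge0// invr_ge0 ltW.
  by rewrite /exp_coeff/= ler_pdivrMr ?ltr0n ?fact_gt0// mulrC exprVn.
rewrite expRN ler_pdivrMr ?expR_gt0//.
have -> : x ^- k = x ^- k.+2 * x ^+ 2.
  by rewrite -addn2 exprD; field; rewrite expf_neq0 gt_eqF.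
by rewrite [leRHS]mulrAC ler_wpM2r ?exprn_ge0// ltW.
Qed.

Lemma flat_ge0 k x : 0 <= flat k x.
Proof. by rewrite /flat; case: ltP => // x0; rewrite mulr_ge0 ?invr_ge0 ?exprn_ge0 ?expR_ge0// ltW. Qed.

Lemma is_derive_sqr_bound f C : (forall x, `|f x| <= C * x ^+ 2) -> is_derive (0 : R) 1 f 0.
Proof.
move=> fC; have f0 : f 0 = 0.
  by apply/eqP; rewrite -normr_le0 (le_trans (fC 0))// expr0n mulr0.
have C0 : 0 <= C by have := le_trans (normr_ge0 _) (fC 1); rewrite expr1n mulr1.
have h : h^-1 *: (f (h *: 1 + 0) - f 0) @[h --> 0^'] --> (0 : R).
  apply/cvgr0Pnorm_le => e e0.
  near=> h.
  have hn0 : h != 0 by near: h; exact: nbhs_dnbhs_neq.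
  rewrite f0 subr0 addr0 /GRing.scale/= mulr1 normrM normfV.
  rewrite ler_pdivrMl ?normr_gt0// (le_trans (fC h))//.
  rewrite -(real_normK (num_real h)) expr2 mulrA [leRHS]mulrC ler_wpM2r//.
  have he : `|h| <= e / (C + 1).
    near: h; apply: dnbhs0_le; rewrite divr_gt0//; lra.
  apply: (@le_trans _ _ (C * (e / (C + 1)))); first by rewrite ler_wpM2l.
  by rewrite mulrA ler_pdivrMr; nra.
split; last exact/cvg_lim.
by apply/cvg_ex; exists 0.
Unshelve. all: by end_near. Qed.

Lemma is_derive_flat k x : is_derive x 1 (flat k) (flat k.+2 x - k%:R * flat k.+1 x).
Proof.
have [x0|x0|->] := ltgtP x 0.
- rewrite /flat !ltNge (ltW x0)/= mulr0 subr0.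
  apply: (near_eq_is_derive (f := cst 0)) => //.
    near=> y; rewrite ltNge ltW//; near: y; exact: lt_nbhsl.
- rewrite /flat x0.
  apply: (near_eq_is_derive (f := fun y => y^-1 ^+ k * expR (- y^-1))) => //.
    near=> y; rewrite exprVn ifT//; near: y; exact: lt_nbhsr.
  have h1 : is_derive x 1 (fun y : R => y^-1) (- x ^- 2).
    apply: DeriveDef; first by apply: derivableV => //; rewrite gt_eqF.
    rewrite (@deriveV _ _ id) ?gt_eqF//.
    by rewrite derive_id /GRing.scale/= mulr1.
  have h2 (v : R) : is_derive v 1 (fun v => v ^+ k * expR (- v))
      (v ^+ k * - expR (- v) + expR (- v) * (k%:R * v ^+ k.-1)).
    apply: is_deriveM.
      have -> : (fun v : R => v ^+ k) = id ^+ k by apply/funext => y; rewrite exprfctE.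
      apply: (is_derive_eq (is_deriveX k (is_derive_id v 1))).
      by rewrite /GRing.scale/= mulr1.
    apply: (is_derive_eq (is_derive1_comp (is_derive_expR (- v)) (is_deriveNid v 1))).
    by rewrite mulrN1.
  have := is_derive1_comp (h2 x^-1) h1; rewrite /comp => h.
  apply: (is_derive_eq h); rewrite -!exprVn.
  by case: k {h h2} => [|k] /=; rewrite ?mul0r !exprS; ring.
- have f0 j : flat j 0 = 0 by rewrite /flat ltxx.
  rewrite !f0 mulr0 subr0.
  apply: (@is_derive_sqr_bound _ (k.+2)`!%:R) => y.
  rewrite ger0_norm ?flat_ge0//; have [y0|y0] := ltP 0 y; first exact: flat_le.
  by rewrite /flat ltNge y0/= mulr_ge0 ?sqr_ge0.
Unshelve. all: by end_near. Qed.

Lemma smooth_flat k : smooth (flat k).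
Proof.
move=> n; elim: n k => // n IH k.
exists (fun x => flat k.+2 x - k%:R * flat k.+1 x); first exact: is_derive_flat.
apply: CkD => //; under eq_fun do rewrite -mulNr.
by apply: CkM => //; exact: smooth_cst.
Qed.

Definition bump a b x := flat 0 (x - a) * flat 0 (b - x).

Lemma smooth_bump a b : smooth (bump a b).
Proof.
apply: smoothM.
  have := @smooth_affine (flat 0) 1 (- a) (smooth_flat 0).
  by under eq_fun do rewrite mul1r.
have := @smooth_affine (flat 0) (-1) b (smooth_flat 0).
by under eq_fun do rewrite mulN1r addrC.
Qed.

Lemma bump_ge0 a b x : 0 <= bump a b x.
Proof. by rewrite mulr_ge0 ?flat_ge0. Qed.

Lemma bump_gt0 a b x : a < x < b -> 0 < bump a b x.
Proof.
move=> /andP[ax xb]; rewrite /bump /flat !subr_gt0 ax xb !expr0 invr1 !mul1r.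
by rewrite mulr_gt0 ?expR_gt0.
Qed.

Lemma bump_eq0 a b x : ~~ (a < x < b) -> bump a b x = 0.
Proof.
rewrite negb_and -!leNgt => /orP[xa|bx]; rewrite /bump /flat !subr_gt0.
  by rewrite ltNge xa mul0r.
by rewrite [x < b]ltNge bx mulr0.
Qed.

End smooth.

Section test_functions.
Context {R : realType}.
Local Notation mu := (@lebesgue_measure R).
Implicit Types (f g F P : R -> R) (a b c p q x y z : R).

Lemma MVT_is_derive F f x y : x < y -> (forall z, is_derive z 1 F (f z)) ->
  exists2 z, x < z < y & F y - F x = f z * (y - x).
Proof.
move=> xy Ff; have [|z] := @MVT _ F f x y xy (fun z _ => Ff z).
  by apply: continuous_subspaceT; exact: (is_derive_continuous Ff).
by rewrite in_itv/= => ? ?; exists z.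
Qed.

Lemma is_derive_cmul c f x (df : R) : is_derive x 1 f df ->
  is_derive x 1 (fun x => c * f x) (c * df).
Proof.
move=> h; apply: (is_derive_eq (is_deriveM (is_derive_cst c x 1) h)).
by rewrite scaler0 addr0.
Qed.

Lemma is_derive_add f g x (df dg : R) : is_derive x 1 f df -> is_derive x 1 g dg ->
  is_derive x 1 (fun x => f x + g x) (df + dg).
Proof. by move=> h1 h2; exact: is_deriveD. Qed.

Lemma compact_primitive g p q : p < q -> continuous g ->
  (forall x, x <= p -> g x = 0) -> (forall x, q <= x -> g x = 0) ->
  exists P, [/\ forall x, is_derive x 1 P (g x), forall x, x <= p -> P x = 0 &
    forall x, q <= x -> P x = P q].
Proof.
move=> pq cg gp gq.
have mg : measurable_fun setT g by exact: continuous_measurable_fun.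
have igpq : mu.-integrable `[p, q] (EFin \o g).
  apply: continuous_compact_integrable; first exact: segment_compact.
  exact: continuous_subspaceT.
have ig u : mu.-integrable `]-oo, u] (EFin \o g).
  apply: (@integrableS _ _ _ mu setT) => //.
  have := (integrable_mkcond (mu := mu) (EFin \o g) (measurable_itv `[p, q])).1 igpq.
  apply: eq_integrable => // x _; rewrite /patch mem_setE in_itv/=.
  case: ifPn => //; rewrite negb_and -!ltNge => /orP[/ltW/gp ->//|/ltW/gq ->//].
exists (fun x => \int[mu]_(t in `]-oo, x]) g t).
have dP x : is_derive x 1 (fun x => \int[mu]_(t in `]-oo, x]) g t) (g x).
  have xx1 : x < x + 1 by rewrite ltrDl.
  have ax : ((-oo%O : itv_bound R) < BRight x)%E by rewrite ltNyr.
  have [dP <-] := continuous_FTC1 xx1 (ig (x + 1)) ax (cg x).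
  by rewrite derive1E; apply/derivableP.
have P0 x : x <= p -> \int[mu]_(t in `]-oo, x]) g t = 0.
  move=> xp; transitivity (\int[mu]_(t in `]-oo, x]) (0 : R)); last first.
    by rewrite Rintegral_cst// mul0r.
  apply: eq_Rintegral => y; rewrite inE/= in_itv/= => yx.
  by rewrite gp// (le_trans yx).
split=> // x; rewrite le_eqVlt => /predU1P[->//|qx].
have [z /andP[qz zx]] := MVT_is_derive qx dP.
by rewrite gq ?ltW// mul0r => /eqP; rewrite subr_eq0 => /eqP.
Qed.

(** Primitive of a bump supported in [[p, q]], divided by its total mass, which is non-zero by the
    mean value theorem. *)
Lemma smooth_step p q : p < q -> exists s : R -> R, [/\ smooth s,
  forall x, x <= p -> s x = 0 & forall x, q <= x -> s x = 1].
Proof.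
move=> pq; have [|||P [dP P0 P1]] := @compact_primitive (bump p q) p q pq.
- exact/smooth_continuous/smooth_bump.
- by move=> x xp; rewrite bump_eq0// negb_and -leNgt xp.
- by move=> x xp; rewrite bump_eq0// negb_and -!leNgt xp orbT.
have Pq : P q != 0.
  have [z zpq] := MVT_is_derive pq dP; rewrite (P0 p)// subr0 => ->.
  by rewrite mulf_neq0 ?gt_eqF ?subr_gt0// bump_gt0.
exists (fun x => (P q)^-1 * P x); split.
- by apply: smoothZ; apply: (smooth_primitive dP); exact: smooth_bump.
- by move=> x /P0 ->; rewrite mulr0.
- by move=> x /P1 ->; rewrite mulVf.
Qed.

Lemma continuous_bounded01 f : continuous f ->
  exists2 C, 0 <= C & forall x, 0 <= x <= 1 -> `|f x| <= C.
Proof.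
move=> cf; have cnf : {within `[0, 1], continuous (fun x => `|f x|)}.
  by apply: continuous_subspaceT => x; apply: cvg_norm; exact: cf.
have [c _ h] := EVT_max ler01 cnf.
by exists `|f c| => // x x01; apply: h; rewrite in_itv.
Qed.

Lemma test_functionP f c d : smooth f -> 0 < c -> d < 1 ->
  (forall x, x < c -> f x = 0) -> (forall x, d < x -> f x = 0) -> test_function f.
Proof.
move=> sf c0 d1 fc fd; split; first by move=> n x; exact: smooth_derivable.
exists c, d; split => // x; rewrite in_itv/= negb_and -!ltNge.
by move=> /orP[/fc|/fd].
Qed.

Lemma test_function_smooth f : test_function f -> smooth f.
Proof. by move=> [df _]; exact: derivable_smooth. Qed.

Lemma derive1_eq0 f x : (\forall y \near x, f y = 0) -> derive1 f x = 0.
Proof.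
move=> fx; rewrite derive1E (@near_eq_derive _ _ _ _ (cst 0))//.
exact: derive_cst.
Qed.

Lemma test_function_derive1 f : test_function f -> test_function (derive1 f).
Proof.
move=> tf; have sf := test_function_smooth tf.
have [_ [c [d [c0 d1 fcd]]]] := tf.
apply: (@test_functionP _ c d) => //; first exact: smooth_derive1.
  move=> x xc; apply: derive1_eq0; near=> y; apply: fcd.
  rewrite in_itv/= negb_and -!ltNge; apply/orP; left.
  by near: y; exact: lt_nbhsl.
move=> x xc; apply: derive1_eq0; near=> y; apply: fcd.
rewrite in_itv/= negb_and -!ltNge; apply/orP; right.
by near: y; exact: lt_nbhsr.
Unshelve. all: by end_near. Qed.

Lemma smooth_derive1M f g : smooth f -> smooth g ->
  derive1 (fun x => f x * g x) = (fun x => derive1 f x * g x + f x * derive1 g x).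
Proof.
move=> sf sg; apply: derive1_funE => x.
have h1 := smooth_is_derive sf x; have h2 := smooth_is_derive sg x.
apply: (is_derive_eq (is_deriveM h1 h2)).
by rewrite /GRing.scale/= addrC mulrC.
Qed.

Lemma smooth_derive1D f g : smooth f -> smooth g ->
  derive1 (fun x => f x + g x) = (fun x => derive1 f x + derive1 g x).
Proof.
move=> sf sg; apply: derive1_funE => x.
have h1 := smooth_is_derive sf x; have h2 := smooth_is_derive sg x.
exact: is_deriveD.
Qed.

Lemma smooth_derive2M f g : smooth f -> smooth g ->
  derive1 (derive1 (fun x => f x * g x)) =
  (fun x => derive1 (derive1 f) x * g x + 2 * (derive1 f x * derive1 g x) +
    f x * derive1 (derive1 g) x).
Proof.
move=> sf sg; have sf' := smooth_derive1 sf; have sg' := smooth_derive1 sg.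
rewrite smooth_derive1M// smooth_derive1D; [|exact: smoothM|exact: smoothM].
rewrite (smooth_derive1M sf' sg) (smooth_derive1M sf sg'); apply/funext => x.
by rewrite mulrDl mul1r !addrA.
Qed.

(** Variation of constants from the right end. With [A(x)] and [B(x)] the integrals over [[x, q]] of
    [e^(lz) psi(z)] and [e^(-lz) psi(z)], the solution is [(e^(-lx) A(x) - e^(lx) B(x)) / (2l)],
    that is, the convolution of [psi] with [sinh(l(z - x)) / l] over [z > x]. The factor [expR l]
    comes from [|z - x| <= 1], and [1 <= l] absorbs the division by [l]. *)
Lemma helmholtz (l p q M : R) (psi : R -> R) : 1 <= l -> 0 <= p -> p < q -> q <= 1 ->
  smooth psi -> (forall x, x <= p -> psi x = 0) -> (forall x, q <= x -> psi x = 0) ->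
  (forall x, 0 <= x <= 1 -> `|psi x| <= M) ->
  exists phi, [/\ smooth phi, forall x, q <= x -> phi x = 0,
    forall x, derive1 (derive1 phi) x = l ^+ 2 * phi x + psi x,
    forall x, 0 <= x <= 1 -> `|phi x| <= M * expR l &
    forall x, 0 <= x <= 1 -> `|derive1 phi x| <= M * expR l].
Proof.
move=> l1 p0 pq q1 spsi psip psiq psiM.
have l0 : 0 < l by lra.
have M0 : 0 <= M by apply: le_trans (psiM 0 _); rewrite ?lexx ?ler01.
have prim (e : R) : exists A, [/\ smooth A, forall x, is_derive x 1 A (- (expR (e * x) * psi x)) &
   forall x, q <= x -> A x = 0].
  have sg : smooth (fun x => expR (e * x) * psi x).
    by apply: smoothM => //; exact: smooth_expRM.
  have [|||P [dP P0 P1]] := @compact_primitive (fun x => expR (e * x) * psi x) p q pq.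
  - exact: smooth_continuous.
  - by move=> x /psip ->; rewrite mulr0.
  - by move=> x /psiq ->; rewrite mulr0.
  have dA x : is_derive x 1 (fun x => P q - P x) (- (expR (e * x) * psi x)).
    have h := dP x; apply: (is_derive_eq (is_deriveB (is_derive_cst (P q) x 1) h)).
    by rewrite sub0r.
  exists (fun x => P q - P x); split => //.
    apply: (smooth_primitive dA).
    by under eq_fun do rewrite -mulN1r; exact: smoothZ.
  by move=> x /P1 ->; rewrite subrr.
have [A [sA dA A0]] := prim l; have [B [sB dB B0]] := prim (- l).
have dexp (e x : R) : is_derive x 1 (fun x => expR (e * x)) (e * expR (e * x)).
  by have := @is_derive_affine _ expR expR e 0 x (is_derive_expR _);
     under eq_fun do rewrite addr0; rewrite addr0.
pose f := fun x => (2 * l)^-1 * (expR (- l * x) * A x + (-1) * (expR (l * x) * B x)).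
pose f1 := fun x => - 2^-1 * (expR (- l * x) * A x + expR (l * x) * B x).
have EE x : expR (- l * x) * expR (l * x) = 1.
  by rewrite -expRD (_ : _ + _ = 0) ?expR0//; ring.
have EA x : is_derive x 1 (fun x => expR (- l * x) * A x)
   (- l * (expR (- l * x) * A x) - psi x).
  have h1 := dexp (- l) x; have h2 := dA x.
  apply: (is_derive_eq (is_deriveM h1 h2)).
  by rewrite /GRing.scale/= -[psi x in RHS]mul1r -(EE x); ring.
have EB x : is_derive x 1 (fun x => expR (l * x) * B x)
   (l * (expR (l * x) * B x) - psi x).
  have h1 := dexp l x; have h2 := dB x.
  apply: (is_derive_eq (is_deriveM h1 h2)).
  by rewrite /GRing.scale/= -[psi x in RHS]mul1r -(EE x); ring.
have df x : is_derive x 1 f (f1 x).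
  have := is_derive_cmul (2 * l)^-1 (is_derive_add (EA x) (is_derive_cmul (-1) (EB x))).
  move=> h; apply: (is_derive_eq h); rewrite /f1; field; lra.
have df1 x : is_derive x 1 f1 (l ^+ 2 * f x + psi x).
  have := is_derive_cmul (- 2^-1) (is_derive_add (EA x) (EB x)).
  move=> h; apply: (is_derive_eq h); rewrite /f; field; lra.
have f1E : derive1 f = f1 by exact: derive1_funE.
have bA x : 0 <= x <= 1 -> `|expR (- l * x) * A x| <= M * expR l.
  move=> /andP[x0 x1]; have [qx|xq] := leP q x.
    by rewrite A0// mulr0 normr0 mulr_ge0 ?expR_ge0.
  have [z /andP[xz zq]] := MVT_is_derive xq dA.
  rewrite A0// sub0r mulNr => /oppr_inj ->.
  rewrite !normrM !(ger0_norm (expR_ge0 _)) [`|q - x|]ger0_norm ?subr_ge0 ?(ltW xq)//.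
  rewrite [leLHS](_ : _ = expR (- l * x + l * z) * (`|psi z| * (q - x))); last first.
    by rewrite expRD; ring.
  rewrite mulrC; apply: ler_pM; rewrite ?mulr_ge0 ?expR_ge0 ?subr_ge0 ?(ltW xq)//.
    rewrite -[leRHS]mulr1; apply: ler_pM; rewrite ?subr_ge0 ?(ltW xq)//; last by lra.
    by apply: psiM; lra.
  by rewrite ler_expR; nra.
have bB x : 0 <= x <= 1 -> `|expR (l * x) * B x| <= M * expR l.
  move=> /andP[x0 x1]; have [qx|xq] := leP q x.
    by rewrite B0// mulr0 normr0 mulr_ge0 ?expR_ge0.
  have [z /andP[xz zq]] := MVT_is_derive xq dB.
  rewrite B0// sub0r mulNr => /oppr_inj ->.
  rewrite !normrM !(ger0_norm (expR_ge0 _)) [`|q - x|]ger0_norm ?subr_ge0 ?(ltW xq)//.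
  rewrite [leLHS](_ : _ = expR (l * x + - l * z) * (`|psi z| * (q - x))); last first.
    by rewrite expRD; ring.
  rewrite mulrC; apply: ler_pM; rewrite ?mulr_ge0 ?expR_ge0 ?subr_ge0 ?(ltW xq)//.
    rewrite -[leRHS]mulr1; apply: ler_pM; rewrite ?subr_ge0 ?(ltW xq)//; last by lra.
    by apply: psiM; lra.
  by rewrite ler_expR; nra.
exists f; split.
- apply: smoothZ; apply: smoothD; last first.
    by apply: smoothZ; apply: smoothM => //; exact: smooth_expRM.
  by apply: smoothM => //; exact: smooth_expRM.
- by move=> x qx; rewrite /f A0// B0// !mulr0 addr0 mulr0.
- by move=> x; rewrite f1E (derive1_funE df1).
- move=> x x01; rewrite /f normrM ger0_norm ?invr_ge0 ?mulr_ge0 ?(ltW l0)//.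
  rewrite mulN1r ler_pdivrMl ?mulr_gt0//.
  apply: le_trans (ler_normB _ _) _.
  apply: le_trans (lerD (bA _ x01) (bB _ x01)) _.
  have : 0 <= M * expR l by rewrite mulr_ge0 ?expR_ge0.
  by move: (M * expR l) => e e0; nra.
- move=> x x01; rewrite f1E /f1 mulNr normrN normrM [`|2^-1|]ger0_norm ?invr_ge0//.
  rewrite ler_pdivrMl//; apply: le_trans (ler_normD _ _) _.
  by apply: le_trans (lerD (bA _ x01) (bB _ x01)) _; lra.
Qed.

End test_functions.

(** * Absolutely continuous functions *)

Section absolute_continuity.
Context {R : realType}.
Implicit Types (a b : R) (f : R -> R).
Local Notation BV := bounded_variation.
Local Notation TV := total_variation.

(** Prepares for families indexed by pairs of an interval and a cell of its partition. *)
Lemma absolutely_continuous_fintype a b f : absolutely_continuous a b f ->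
  forall e : R, 0 < e -> exists2 d : R, 0 < d &
    forall (J : finType) (l r : J -> R),
      (forall i, a <= l i /\ l i <= r i /\ r i <= b) ->
      (forall i j, i != j -> `]l i, r i[ `&` `]l j, r j[ = set0) ->
      \sum_i (r i - l i) < d ->
      \sum_i `|f (r i) - f (l i)| < e.
Proof.
move=> acf e /acf[d d0 H]; exists d => // J l r lr disj.
have sumE (F : J -> R) : \sum_i F i = \sum_(i < #|J|) F (enum_val i).
  by rewrite (reindex (@enum_val J predT)) //; exact/onW_bij/enum_val_bij.
rewrite !sumE => /H; apply; first by move=> i; exact: lr.
by move=> i j ij; apply: disj; apply: contra_neq ij; exact: enum_val_inj.
Qed.

Lemma itv_partition_nth_homo l r s (m n : nat) : itv_partition l r s ->
  (m <= n)%N -> (n < (size s).+1)%N -> nth r (l :: s) m <= nth r (l :: s) n :> R.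
Proof.
move=> [ps _] mn ns.
have srt : sorted <=%R (l :: s).
  by rewrite /=; apply: sub_path ps => x y; exact: ltW.
by apply: (sorted_leq_nth le_trans le_refl r srt) => //; rewrite inE /= ?(leq_ltn_trans mn).
Qed.

(** The cells of partitions of disjoint intervals are again finitely many disjoint intervals, of the
    same total length by telescoping. *)
Lemma absolutely_continuous_variation a b f : absolutely_continuous a b f ->
  forall e : R, 0 < e -> exists2 d : R, 0 < d &
    forall (n : nat) (l r : 'I_n -> R) (s : 'I_n -> seq R),
      (forall i, a <= l i /\ l i <= r i /\ r i <= b) ->
      (forall i j, i != j -> `]l i, r i[ `&` `]l j, r j[ = set0) ->
      (forall i, itv_partition (l i) (r i) (s i)) ->
      \sum_(i < n) (r i - l i) < d ->
      \sum_(i < n) variation (l i) (r i) f (s i) < e.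
Proof.
move=> /absolutely_continuous_fintype acf e /acf[d d0 H].
exists d => // n l r s lr disj part sd.
pose J := {i : 'I_n & 'I_(size (s i))}.
pose pt (i : 'I_n) (k : nat) := nth (r i) (l i :: s i) k.
have := H J (fun p => pt (tag p) (tagged p)) (fun p => pt (tag p) (tagged p).+1).
have sigE (F : forall i : 'I_n, 'I_(size (s i)) -> R) :
    \sum_(p : J) F (tag p) (tagged p) = \sum_(i < n) \sum_(k < size (s i)) F i k.
  by rewrite (sig_big_dep (fun=> true) (fun _ _ => true) F).
rewrite (sigE (fun i (k : 'I_(size (s i))) => pt i k.+1 - pt i k)).
rewrite (sigE (fun i (k : 'I_(size (s i))) => `|f (pt i k.+1) - f (pt i k)|)).
have -> : \sum_(i < n) \sum_(k < size (s i)) (pt i k.+1 - pt i k) =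
    \sum_(i < n) (r i - l i).
  apply: eq_bigr => i _.
  rewrite -(big_mkord predT (fun k => pt i k.+1 - pt i k)) telescope_sumr//.
  by rewrite /pt (itv_partition_nth_size _ (part i)).
have -> : \sum_(i < n) \sum_(k < size (s i)) `|f (pt i k.+1) - f (pt i k)| =
    \sum_(i < n) variation (l i) (r i) f (s i).
  apply: eq_bigr => i _.
  by rewrite -(big_mkord predT (fun k => `|f (pt i k.+1) - f (pt i k)|)).
have ptge i (k : nat) : (k < (size (s i)).+1)%N -> l i <= pt i k.
  by move=> ks; exact: itv_partition_nth_ge.
have ptle i (k : nat) : (k < (size (s i)).+1)%N -> pt i k <= r i.
  by move=> ks; exact: itv_partition_nth_le.
apply => //.
  move=> [i k] /=; have [al [_ rb]] := lr i; split; [|split].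
  - by apply: le_trans al _; apply: ptge; rewrite ltnW// ltnS.
  - by apply: itv_partition_nth_homo => //; rewrite ltnS.
  - by apply: le_trans rb; apply: ptle; rewrite ltnS.
move=> [i k] [j k'] /= ne; have [ij|ij] := eqVneq i j; last first.
  apply/seteqP; split => // x [] /=; rewrite !in_itv/= => /andP[x1 x2] /andP[x3 x4].
  have : (`]l i, r i[ `&` `]l j, r j[) x; last by rewrite disj.
  split => /=; rewrite in_itv/=; apply/andP; split.
  - by apply: le_lt_trans x1; apply: ptge; rewrite ltnW// ltnS.
  - by apply: lt_le_trans x2 _; apply: ptle; rewrite ltnS.
  - by apply: le_lt_trans x3; apply: ptge; rewrite ltnW// ltnS.
  - by apply: lt_le_trans x4 _; apply: ptle; rewrite ltnS.
move: k k' ne; rewrite -{}ij => k k' ne.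
have kk' : k != k' by apply: contra_neq ne => ->.
apply/seteqP; split => // x [] /=; rewrite !in_itv/= => /andP[x1 x2] /andP[x3 x4].
have [lt|gt|eq] := ltngtP k k'; last by rewrite (val_inj eq) eqxx in kk'.
  have := itv_partition_nth_homo (part i) lt (ltnW (ltn_ord k')).
  by rewrite leNgt (lt_trans x3 x2).
have := itv_partition_nth_homo (part i) gt (ltnW (ltn_ord k)).
by rewrite leNgt (lt_trans x1 x4).
Qed.

(** With the [d] belonging to [e = 1], the interval is cut into [N] equal pieces shorter than [d],
    each of variation at most 1. *)
Lemma absolutely_continuous_BV a b f : a <= b -> absolutely_continuous a b f ->
  BV a b f.
Proof.
move=> ab acf; apply/bounded_variationP => //.
have [d d0 H] := absolutely_continuous_variation acf ltr01.
have small x y : a <= x -> x <= y -> y <= b -> y - x < d -> TV x y f \is a fin_num.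
  move=> ax xy yb yxd; apply/(bounded_variationP _ xy).
  exists 1 => _ [s part <-]; apply: ltW.
  have := H 1 (fun=> x) (fun=> y) (fun=> s); rewrite !big_ord1; apply => //.
  by move=> i j; rewrite !ord1 eqxx.
pose N := (Num.truncn ((b - a) / d)).+1.
pose h := (b - a) / N%:R.
have N0 : 0 < N%:R :> R by rewrite ltr0n.
have h0 : 0 <= h by rewrite divr_ge0 ?subr_ge0.
have hd : h < d.
  by rewrite ltr_pdivrMr// mulrC -ltr_pdivrMr//; exact: truncnS_gt.
have bE : b = a + N%:R * h by rewrite mulrC divfK ?gt_eqF// addrC subrK.
suff H2 k : (k <= N)%N -> TV a (a + k%:R * h) f \is a fin_num by rewrite {1}bE H2.
elim: k => [_|k IH kN]; first by rewrite mul0r addr0 total_variationxx.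
have k0 : a <= a + k%:R * h by rewrite lerDl mulr_ge0.
have kk : a + k%:R * h <= a + k.+1%:R * h by rewrite lerD2l ler_wpM2r// ler_nat.
rewrite (total_variationD f k0 kk) fin_numD IH ?(ltnW kN)//=.
apply: small => //.
  by rewrite [leRHS]bE lerD2l ler_wpM2r// ler_nat.
by rewrite opprD addrACA subrr add0r -mulrBl -natr1 addrAC subrr add0r mul1r.
Qed.

(** In each interval a partition is chosen whose variation misses the total one by at most
    [(e/2) / (n + 1)]; the variations along these partitions sum to less than [e/2]. Dividing by
    [n + 1] keeps the tolerance positive for the empty family. *)
Lemma absolutely_continuous_TV a b f : a <= b -> absolutely_continuous a b f ->
  absolutely_continuous a b (fun t => fine (TV a t f)).
Proof.
move=> ab acf; have bvf := absolutely_continuous_BV ab acf.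
have tvfin x y : a <= x -> x <= y -> y <= b -> TV x y f \is a fin_num.
  move=> ax xy yb; apply/(bounded_variationP _ xy).
  apply: (bounded_variationl xy yb); exact: (bounded_variationr ax (le_trans xy yb)).
have VE x y : a <= x -> x <= y -> y <= b ->
    fine (TV a y f) - fine (TV a x f) = fine (TV x y f).
  move=> ax xy yb; rewrite (total_variationD f ax xy) fineD.
  - by rewrite addrC addKr.
  - by apply: tvfin => //; exact: le_trans xy yb.
  - exact: tvfin.
move=> e e0; have e2 : 0 < e / 2 by rewrite divr_gt0.
have [d d0 H] := absolutely_continuous_variation acf e2.
exists d => // n l r lr disj sd.
have eta0 : 0 < e / 2 / n.+1%:R by rewrite divr_gt0.
have /choice[s hs] : forall i : 'I_n, exists s, itv_partition (l i) (r i) s /\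
    fine (TV (l i) (r i) f) <= variation (l i) (r i) f s + e / 2 / n.+1%:R.
  move=> i; have [al [lri rb]] := lr i.
  have tf := tvfin _ _ al lri rb.
  have [_ [_ [s part <-] <-]] := ub_ereal_sup_adherent eta0 tf.
  rewrite -/(TV (l i) (r i) f) -(fineK tf) -EFinB lte_fin => h.
  by exists s; split => //; rewrite -lerBlDr; exact: ltW.
have := H n l r s lr disj (fun i => (hs i).1) sd.
move=> h; apply: (@le_lt_trans _ _ (\sum_(i < n) (variation (l i) (r i) f (s i) + e / 2 / n.+1%:R))).
  apply: ler_sum => i _; have [al [lri rb]] := lr i.
  rewrite VE// ger0_norm ?fine_ge0 ?total_variation_ge0//.
  by have [] := hs i.
rewrite big_split/= sumr_const card_ord.
have : (e / 2 / n.+1%:R) *+ n <= e / 2.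
  rewrite -mulr_natr -mulrA ler_piMr ?(ltW e2)// mulrC ler_pdivrMr// mul1r.
  by rewrite ler_nat.
by move=> h2; have := ltr_leD h h2; rewrite -splitr.
Qed.

Lemma absolutely_continuousB a b f g : absolutely_continuous a b f ->
  absolutely_continuous a b g -> absolutely_continuous a b (fun x => f x - g x).
Proof.
move=> acf acg e e0; have e2 : 0 < e / 2 by rewrite divr_gt0.
have [d1 d10 H1] := acf _ e2; have [d2 d20 H2] := acg _ e2.
exists (Num.min d1 d2); first by rewrite lt_min d10.
move=> n l r lr disj; rewrite lt_min => /andP[s1 s2].
have h1 := H1 n l r lr disj s1; have h2 := H2 n l r lr disj s2.
apply: (@le_lt_trans _ _ (\sum_(i < n) (`|f (r i) - f (l i)| + `|g (r i) - g (l i)|))).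
  apply: ler_sum => i _.
  rewrite (_ : _ - _ = (f (r i) - f (l i)) - (g (r i) - g (l i))); last by ring.
  exact: ler_normB.
by rewrite big_split/=; lra.
Qed.

Lemma absolutely_continuous_continuous a b f : absolutely_continuous a b f ->
  forall x e, a <= x <= b -> 0 < e -> exists2 d, 0 < d &
  forall y, a <= y <= b -> `|x - y| < d -> `|f x - f y| < e.
Proof.
move=> acf x e /andP[ax xb] e0; have [d d0 H] := acf e e0.
exists d => // y /andP[ay yb] xyd.
wlog xy : x y ax xb ay yb xyd / x <= y.
  move=> W; have [xy|/ltW yx] := leP x y; first exact: W.
  by rewrite distrC; apply: W => //; rewrite distrC.
have := H 1 (fun=> x) (fun=> y); rewrite !big_ord1 distrC; apply => //.
  by move=> i j; rewrite !ord1 eqxx.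
by apply: le_lt_trans xyd; rewrite distrC ler_norm.
Qed.

End absolute_continuity.

(** * Projection of the line onto an interval *)

Section clamp.
Context {R : realType}.
Variables (a b : R).
Hypothesis ab : a < b.

Definition clamp (x : R) := Num.max a (Num.min x b).

Lemma clamp_itv x : a <= clamp x <= b.
Proof. by rewrite /clamp le_max lexx ge_max ge_min lexx orbT (ltW ab). Qed.

Lemma clampE x : a <= x <= b -> clamp x = x.
Proof. by move=> /andP[ax xb]; rewrite /clamp min_l// max_r. Qed.

Lemma clamp_le x y : x <= y -> clamp x <= clamp y.
Proof.
move=> xy; rewrite /clamp; case: (leP x b) => xb; case: (leP y b) => yb.
- by case: (leP a x) => ax; case: (leP a y) => ay; lra.
- by case: (leP a x) => ax; case: (leP a b) => ay; lra.
- lra.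
- lra.
Qed.

Lemma clamp_dist x y : `|clamp x - clamp y| <= `|x - y|.
Proof.
wlog xy : x y / x <= y.
  move=> W; have [xy|/ltW yx] := leP x y; first exact: W.
  by rewrite (distrC (clamp x)) (distrC x); exact: W.
rewrite (distrC (clamp x)) (distrC x) !ger0_norm ?subr_ge0 ?clamp_le//.
rewrite /clamp; case: (leP x b) => xb; case: (leP y b) => yb.
- by case: (leP a x) => ax; case: (leP a y) => ay; lra.
- by case: (leP a x) => ax; case: (leP a b) => ay; lra.
- lra.
- lra.
Qed.

End clamp.

(** * Lebesgue-Stieltjes measure of a monotone absolutely continuous function *)

Section monotone_absolute_continuity.
Context {R : realType}.
Local Notation mu := (@lebesgue_measure R).
Variables (a b : R) (F : R -> R).
Hypothesis ab : a < b.
Hypothesis acF : absolutely_continuous a b F.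
Hypothesis ndF : forall x y, a <= x -> x <= y -> y <= b -> F x <= F y.

(** Extension by constants outside [[a, b]], which is nondecreasing and right-continuous on the
    whole line and so defines a Stieltjes measure. *)
Let Fc x := F (clamp a b x).

Let Fc_nd : nondecreasing Fc.
Proof.
move=> x y xy; have /andP[? ?] := clamp_itv ab x; have /andP[? ?] := clamp_itv ab y.
by apply: ndF => //; exact: clamp_le.
Qed.

Let Fc_rc : forall x, Fc @ at_right x --> Fc x.
Proof.
apply: right_continuousW => x; apply/cvgrPdist_lt => e e0.
have [d d0 H] := absolutely_continuous_continuous acF (clamp_itv ab x) e0.
near=> y; apply: H; first exact: (clamp_itv ab).
apply: le_lt_trans (clamp_dist a b _ _) _.
by near: y; exact: cvgr_dist_lt.
Unshelve. all: by end_near. Qed.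

Let Fc_mixin := isCumulative.Build R _ R Fc Fc_nd Fc_rc.
Let Fcum : cumulative R R := HB.pack Fc Fc_mixin.

Let nu : {measure set (measurableTypeR R) -> \bar R} :=
  lebesgue_stieltjes_measure Fcum.

Let nu_itv (x y : R) : x <= y -> nu `]x, y]%classic = (Fc y - Fc x)%:E.
Proof.
move=> xy; rewrite /nu /= /lebesgue_stieltjes_measure /measure_extension.
rewrite measurable_mu_extE/=; last exact: is_ocitv.
by rewrite wlength_itv_bnd.
Qed.

(** Dyadic points: each grid refines the preceding one, so the unions of cells taken below increase
    with [n]. *)
Let grid (n k : nat) : R := a + (b - a) * (k%:R / 2 ^+ n).

Let grid_le n k : grid n k <= grid n k.+1.
Proof.
by rewrite lerD2l ler_wpM2l ?subr_ge0 ?(ltW ab)// ler_wpM2r ?invr_ge0 ?exprn_ge0// ler_nat.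
Qed.

Let grid_homo n j k : (j <= k)%N -> grid n j <= grid n k.
Proof.
by move=> jk; rewrite lerD2l ler_wpM2l ?subr_ge0 ?(ltW ab)// ler_wpM2r ?invr_ge0 ?exprn_ge0// ler_nat.
Qed.

Let gridT n : grid n (2 ^ n) = b.
Proof. by rewrite /grid natrX divff ?expf_neq0// mulr1 addrC subrK. Qed.

Let grid0 n : grid n 0 = a.
Proof. by rewrite /grid mul0r mulr0 addr0. Qed.

Let grid_double n k : grid n.+1 (2 * k) = grid n k.
Proof. by rewrite /grid exprS natrM; congr (_ + _ * _); field; rewrite expf_neq0. Qed.

Let grid_itv n k : (k <= 2 ^ n)%N -> a <= grid n k <= b.
Proof.
by move=> kn; rewrite -(grid0 n) -(gridT n) !grid_homo.
Qed.

Section open_cover.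
Variable U : set R.

(** Cells contained in [U] are kept; the others are replaced by the empty interval []a, a]], so that
    every family is indexed by all [k < 2^n]. *)
Let good n k : bool := `[< `]grid n k, grid n k.+1]%classic `<=` U >].
Let l n (k : nat) := if good n k then grid n k else a.
Let r n (k : nat) := if good n k then grid n k.+1 else a.
Let cells n : set R := \big[setU/set0]_(k < 2 ^ n) `]l n k, r n k]%classic.

Let lr n (k : 'I_(2 ^ n)) : a <= l n k /\ l n k <= r n k /\ r n k <= b.
Proof.
rewrite /l /r; case: ifPn => _; last by rewrite lexx (ltW ab).
have /andP[? ?] := grid_itv (ltnW (ltn_ord k)).
have /andP[? ?] := grid_itv (ltn_ord k).
by split => //; split.
Qed.

Let lrP n k x : `]l n k, r n k]%classic x <-> good n k /\ grid n k < x <= grid n k.+1.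
Proof.
rewrite /= in_itv/= /l /r; case: ifPn => g; first by split => // -[].
by split => [/andP[ax xa]|[]//]; have := lt_le_trans ax xa; rewrite ltxx.
Qed.

Let disj n (i j : nat) : i != j ->
  `]l n i, r n i]%classic `&` `]l n j, r n j]%classic = set0.
Proof.
move=> ij; apply/seteqP; split => // x [/lrP[_ /andP[x1 x2]] /lrP[_ /andP[x3 x4]]].
have [lt|lt|/eqP] := ltngtP i j; last by rewrite (negbTE ij).
  by have := lt_le_trans (le_lt_trans (grid_homo n lt) x3) x2; rewrite ltxx.
by have := lt_le_trans (le_lt_trans (grid_homo n lt) x1) x4; rewrite ltxx.
Qed.

Let trivcells n : trivIset setT (fun k : 'I_(2 ^ n) => `]l n k, r n k]%classic).
Proof. by apply/trivIsetP => i j _ _ ij; exact: disj. Qed.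

Let mcells n : measurable (cells n).
Proof. by apply: bigsetU_measurable => i _; exact: measurable_itv. Qed.

Let cellsP n x : cells n x <-> exists2 k, (k < 2 ^ n)%N & good n k /\ grid n k < x <= grid n k.+1.
Proof.
rewrite /cells -(bigcup_mkord _ (fun k => `]l n k, r n k]%classic)); split.
  by move=> [k kn /lrP ?]; exists k.
by move=> [k kn h]; exists k => //; apply/lrP.
Qed.

Let cells_nd : nondecreasing_seq cells.
Proof.
apply/nondecreasing_seqP => n; apply/subsetPset => x /cellsP[k kn [g kx]].
have sub j : (j < 2 ^ n.+1)%N -> grid n.+1 j < x <= grid n.+1 j.+1 ->
    grid n k <= grid n.+1 j -> grid n.+1 j.+1 <= grid n k.+1 -> cells n.+1 x.
  move=> jn xj h1 h2; apply/cellsP; exists j => //; split => //.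
  apply/asboolP => y /=; rewrite in_itv/= => /andP[y1 y2].
  move/asboolP : g; apply; rewrite /= in_itv/=.
  by rewrite (le_lt_trans h1 y1) (le_trans y2 h2).
have E1 : grid n k = grid n.+1 (2 * k) by rewrite grid_double.
have E2 : grid n k.+1 = grid n.+1 (2 * k).+2 by rewrite -grid_double mulnS.
have kn2 : ((2 * k).+1 < 2 ^ n.+1)%N.
  have : (2 * k.+1 <= 2 * 2 ^ n)%N by rewrite leq_mul2l.
  by rewrite mulnS -expnS.
move: kx => /andP[kx xk].
have [xm|mx] := leP x (grid n.+1 (2 * k).+1).
  apply: (sub (2 * k)%N); first exact: ltnW.
  - by rewrite -E1 kx.
  - by rewrite E1.
  - by rewrite E2 grid_le.
apply: (sub (2 * k).+1) => //.
- by rewrite mx -E2.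
- by rewrite E1 grid_le.
- by rewrite E2.
Qed.

Hypothesis oU : open U.

Let cells_U : \bigcup_n cells n = U `&` `]a, b].
Proof.
apply/seteqP; split => x.
  move=> [n _ /cellsP[k kn [/asboolP g kx]]]; split.
    by apply: g; rewrite /= in_itv.
  rewrite /= in_itv/=; move: kx => /andP[kx xk].
  have /andP[h1 _] := grid_itv (ltnW kn); have /andP[_ h2] := grid_itv kn.
  by rewrite (le_lt_trans h1 kx) (le_trans xk h2).
move=> [Ux]; rewrite /= in_itv/= => /andP[ax xb].
have /nbhs_ballP[e /= e0 eU] : nbhs x U by apply: open_nbhs_nbhs.
have [n hn] : exists n : nat, (b - a) / 2 ^+ n < e.
  have [n hn] : exists n : nat, (b - a) / e < n%:R.
    by exists (Num.truncn ((b - a) / e)).+1; exact: truncnS_gt.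
  exists n; rewrite ltr_pdivrMr ?exprn_gt0// mulrC -ltr_pdivrMr//.
  by apply: lt_le_trans hn _; rewrite -natrX ler_nat ltnW// ltn_expl.
(* The least such [k] is the index of the cell containing [x], and this cell is shorter than [e]. *)
have exk : exists k, (x <= grid n k.+1).
  by exists (2 ^ n).-1; rewrite prednK ?expn_gt0// gridT.
have [k xk kmin] := ex_minnP exk.
have kx : grid n k < x.
  case: k xk kmin => [|k] xk kmin; first by rewrite grid0.
  by rewrite ltNge; apply/negP => /kmin; rewrite ltnn.
have kn : (k < 2 ^ n)%N.
  by rewrite -(prednK (expn_gt0 2 n)) ltnS kmin// prednK ?expn_gt0// gridT.
exists n => //; apply/cellsP; exists k => //; split; last by rewrite kx.
apply/asboolP => y; rewrite /= in_itv/= => /andP[y1 y2]; apply: eU.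
rewrite /ball/=; apply: le_lt_trans hn.
have : grid n k.+1 - grid n k = (b - a) / 2 ^+ n.
  rewrite /grid opprD addrACA subrr add0r -mulrBr -mulrBl -natr1.
  by rewrite addrAC subrr add0r mul1r.
by move=> <-; rewrite ler_distl; apply/andP; split; lra.
Qed.

(** [U] inside []a, b]] is the increasing union of finite disjoint unions of dyadic cells, each of
    total length less than [d]. Absolute continuity bounds their [nu]-measures by [e], and [nu] is
    continuous from below. *)
Lemma open_stieltjes_small e d : 0 < e ->
  (forall (n : nat) (l r : 'I_n -> R),
      (forall i, a <= l i /\ l i <= r i /\ r i <= b) ->
      (forall i j, i != j -> `]l i, r i[ `&` `]l j, r j[ = set0) ->
      \sum_(i < n) (r i - l i) < d ->
      \sum_(i < n) `|F (r i) - F (l i)| < e) ->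
  (mu U < d%:E)%E -> (nu (U `&` `]a, b]) <= e%:E)%E.
Proof.
move=> e0 H Ud.
have mU : measurable (\bigcup_n cells n) by exact: bigcup_measurable.
have h : nu (cells n) @[n --> \oo] --> nu (U `&` `]a, b]).
  by rewrite -cells_U; apply: nondecreasing_cvg_mu.
rewrite -(cvg_lim (@ereal_hausdorff R) h).
apply: lime_le; first by apply/cvg_ex; eexists; exact: h.
apply: nearW => n /=.
have mC (k : 'I_(2 ^ n)) : measurable `]l n k, r n k] by exact: measurable_itv.
have muE : mu (cells n) = (\sum_(k < 2 ^ n) (r n k - l n k))%:E.
  rewrite /cells measure_semi_additive_ord//; last exact: mcells.
  rewrite -sumEFin; apply: eq_bigr => k _.
  rewrite -[LHS]/(mu `]l n k, r n k]%classic) lebesgue_measure_itv/= lte_fin -EFinB.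
  have [_ [h1 _]] := lr k; case: ltP => // h2.
  by rewrite (le_anti (_ : l n k <= r n k <= l n k)) ?subrr// h1 h2.
have nuE : nu (cells n) = (\sum_(k < 2 ^ n) (F (r n k) - F (l n k)))%:E.
  rewrite /cells measure_semi_additive_ord//; last exact: mcells.
  rewrite -sumEFin; apply: eq_bigr => k _.
  have [h1 [h2 h3]] := lr k.
  rewrite -[LHS]/(nu `]l n k, r n k]%classic) nu_itv// /Fc !clampE//.
    by rewrite h1 (le_trans h2 h3).
  by rewrite h3 (le_trans h1 h2).
rewrite nuE lee_fin.
have := H (2 ^ n)%N (fun k => l n k) (fun k => r n k) (@lr n).
have dis (i j : 'I_(2 ^ n)) : i != j -> `]l n i, r n i[ `&` `]l n j, r n j[ = set0.
  move=> ij; apply/seteqP; split => // x [/= h1 h2].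
  suff : (`]l n i, r n i]%classic `&` `]l n j, r n j]%classic) x by rewrite disj.
  by split; apply: subset_itv_oo_oc.
move=> /(_ dis).
have small : \sum_(i < 2 ^ n) (r n i - l n i) < d.
  rewrite -lte_fin -muE; apply: le_lt_trans Ud; apply: le_measure.
  - by rewrite inE; exact: mcells.
  - by rewrite inE; exact: open_measurable.
  - move=> x xc; have : (\bigcup_n cells n) x by exists n.
    by rewrite cells_U => -[].
move=> /(_ small) /ltW; apply: le_trans; by apply: ler_sum => i _; exact: ler_norm.
Qed.

End open_cover.

(** By outer regularity a Lebesgue-null set lies in open sets of arbitrarily small measure, to which
    [open_stieltjes_small] applies. Restricting [nu] to []a, b]] makes it finite. *)
Lemma stieltjes_dominates :
  exists nu' : {finite_measure set (measurableTypeR R) -> \bar R},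
  nu' `<< mu /\ forall x : R, a <= x <= b -> nu' `]a, x]%classic = (F x - F a)%:E.
Proof.
have ny : (nu `]a, b]%classic < +oo)%E by rewrite nu_itv ?ltry// ltW.
have mab : measurable (`]a, b]%classic : set (measurableTypeR R)).
  exact: measurable_itv.
exists (mfrestr mab ny); split.
  apply/null_content_dominatesP => A mA A0.
  rewrite /= /mfrestr /mrestr.
  apply/eqP; rewrite eq_le measure_ge0 andbT; apply/lee_addgt0Pr => e e0.
  rewrite add0e; have [d d0 H] := acF e0.
  have Ay : (mu A < +oo)%E by rewrite A0 ltry.
  have [U [oU AU UA]] := lebesgue_regularity_outer mA Ay d0.
  have Ud : (mu U < d%:E)%E.
    apply: le_lt_trans UA; rewrite -{1}(setDUK AU).
    apply: le_trans (measureU2 _ _ _) _ => //.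
      by apply: measurableD => //; exact: open_measurable.
    by rewrite A0 add0e.
  apply: le_trans (open_stieltjes_small oU e0 H Ud).
  apply: le_measure; rewrite ?inE.
  - by apply: measurableI => //; exact: measurable_itv.
  - by apply: measurableI; [exact: open_measurable|exact: measurable_itv].
  - exact: setSI.
move=> x /andP[ax xb]; rewrite /= /mfrestr /mrestr setIidl; last first.
  by apply: subset_itvl; rewrite bnd_simp.
by rewrite nu_itv// /Fc !clampE ?lexx ?(ltW ab)// ax.
Qed.

(** The density is the Radon-Nikodym derivative of the Stieltjes measure of [F]. *)
Lemma monotone_absolutely_continuous_density : exists g : R -> R,
  mu.-integrable setT (EFin \o g) /\
  forall x, a <= x <= b -> \int[mu]_(t in `]a, x]) g t = F x - F a.
Proof.
have [nu' [dom nuE]] := stieltjes_dominates.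
have [g [g0 gf ig gE]] := radon_nikodym_sigma_finite dom.
exists (fine \o g); have gK : EFin \o (fine \o g) = g.
  by apply/funext => x; rewrite /= fineK.
split; first by rewrite gK.
move=> x xab; rewrite /Rintegral.
have -> : (\int[mu]_(t in `]a, x]) ((fine \o g) t)%:E = (F x - F a)%:E)%E.
  rewrite -nuE// gE; last exact: measurable_itv.
  by apply: eq_integral => t _; rewrite /= fineK.
by [].
Qed.

End monotone_absolute_continuity.

(** * Lebesgue's fundamental theorem of calculus *)

Section absolute_continuity_FTC.
Context {R : realType}.
Local Notation mu := (@lebesgue_measure R).
Variables (a b : R) (f : R -> R).
Hypothesis ab : a < b.
Hypothesis acf : absolutely_continuous a b f.

(** Jordan decomposition [f = V - (V - f)] with [V] the variation function: both terms are
    nondecreasing and absolutely continuous, so each has a density. *)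
Let density : exists g : R -> R, mu.-integrable setT (EFin \o g) /\
  forall x, a <= x <= b -> \int[mu]_(t in `]a, x]) g t = f x - f a.
Proof.
pose V t := fine (total_variation a t f).
have acV : absolutely_continuous a b V by apply: absolutely_continuous_TV => //; exact: ltW.
have bvf := absolutely_continuous_BV (ltW ab) acf.
have tvfin x y : a <= x -> x <= y -> y <= b -> total_variation x y f \is a fin_num.
  move=> ax xy yb; apply/(bounded_variationP _ xy).
  apply: (bounded_variationl xy yb); exact: (bounded_variationr ax (le_trans xy yb)).
have dV x y : a <= x -> x <= y -> y <= b -> `|f y - f x| <= V y - V x.
  move=> ax xy yb.
  have tx : total_variation a x f \is a fin_num by apply: tvfin => //; exact: le_trans xy yb.
  have txy : total_variation x y f \is a fin_num by apply: tvfin.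
  rewrite /V (total_variationD f ax xy) fineD//.
  rewrite [leRHS]addrC addKr -lee_fin fineK//.
  exact: total_variation_ge.
have ndV x y : a <= x -> x <= y -> y <= b -> V x <= V y.
  by move=> ax xy yb; rewrite -subr_ge0 (le_trans _ (dV _ _ ax xy yb)).
have ndVf x y : a <= x -> x <= y -> y <= b -> V x - f x <= V y - f y.
  move=> ax xy yb; have := le_trans (ler_norm _) (dV _ _ ax xy yb); lra.
have [g1 [i1 E1]] := monotone_absolutely_continuous_density ab acV ndV.
have [g2 [i2 E2]] := monotone_absolutely_continuous_density ab
  (absolutely_continuousB acV acf) ndVf.
exists (fun x => g1 x - g2 x); split; first exact: RintegrableB.
move=> x xab; rewrite RintegralB//; last 2 first.
- exact: integrableS i1.
- exact: integrableS i2.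
by rewrite E1// E2//; ring.
Qed.

(** Near an interior point [f] is [f a] plus the primitive of the density cut off to []a, b]], and
    Lebesgue's differentiation theorem differentiates that primitive almost everywhere. *)
Lemma absolutely_continuous_FTC : exists g : R -> R,
  [/\ mu.-integrable setT (EFin \o g),
   forall x, a <= x <= b -> \int[mu]_(t in `]a, x]) g t = f x - f a &
   {ae mu, forall x, a < x < b -> is_derive x 1 f (g x)}].
Proof.
have [g [ig gE]] := density; exists g; split => //.
pose h := g \_ `]a, b].
have ih : mu.-integrable setT (EFin \o h).
  have iab : mu.-integrable `]a, b] (EFin \o g) by exact: integrableS ig.
  have := (integrable_mkcond (mu := mu) (EFin \o g) (measurable_itv `]a, b])).1 iab.
  by rewrite restrict_EFin.
have loch : locally_integrable setT h by apply: open_integrable_locally; [exact: openT|].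
have ihy y : mu.-integrable `]-oo, y] (EFin \o h) by exact: integrableS ih.
have := FTC1Ny ihy loch.
apply: filterS; first exact: (ae_filter_ringOfSetsType mu).
move=> x [dh hx] /andP[ax xb].
have <- : h x = g x by rewrite /h patchE mem_set//= in_itv/= ax ltW.
rewrite -hx derive1E.
have dh' := derivableP dh.
pose H (y : R) := \int[mu]_(t in `]-oo, y]) h t.
have : is_derive x 1 (fun y => f a + H y) ('D_1 H x).
  by apply: (is_derive_eq (is_deriveD (is_derive_cst (f a) x 1) dh')); rewrite add0r.
apply: near_eq_is_derive; near=> y.
have ay : a < y by near: y; exact: lt_nbhsr.
have yb : y < b by near: y; exact: lt_nbhsl.
have -> : H y = \int[mu]_(t in `]a, y]) g t.
  rewrite /H Rintegral_mkcond [RHS]Rintegral_mkcond; apply: eq_Rintegral => z _.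
  rewrite /h /patch/= !mem_setE !in_itv/=.
  by have [zy|zy] := leP z y; rewrite ?andbF// ?andbT (le_trans zy (ltW yb)) andbT.
by rewrite gE ?(ltW ay) ?(ltW yb)// addrC subrK.
Unshelve. all: by end_near. Qed.

End absolute_continuity_FTC.

(** * Measurability of the extended solution and of its Caputo derivative *)

Section caratheodory_function.
Context {R : realType}.
Local Notation mu := (@lebesgue_measure R).

Lemma ae_itv_exists (P : R -> Prop) (l r : R) : l < r ->
  {ae mu, forall x, P x} -> exists2 x, l < x < r & P x.
Proof.
move=> lr [N [mN N0 PN]]; apply: contrapT => H.
have sub : `]l, r[%classic `<=` N.
  move=> x /=; rewrite in_itv/= => xlr; apply: PN => Px; apply: H.
  by exists x.
have : (mu `]l, r[%classic <= mu N)%E.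
  by apply: le_measure => //; rewrite inE.
rewrite [X in (_ <= X)%E]N0 lebesgue_measure_itv/= lte_fin lr -EFinB lee_fin.
by rewrite leNgt subr_gt0 lr.
Qed.

Lemma ae_dense01 (P : R -> Prop) (c e : R) : 0 <= c <= 1 -> 0 < e ->
  {ae mu, forall x, x \in `]0, 1[ -> P x} ->
  exists x, [/\ 0 < x < 1, P x & `|x - c| < e].
Proof.
move=> /andP[c0 c1] e0 aeP.
have lr : Num.max 0 (c - e) < Num.min 1 (c + e).
  by rewrite gt_max !lt_min; apply/andP; split; apply/andP; split; lra.
have [x] := ae_itv_exists lr aeP.
rewrite gt_max lt_min => /andP[/andP[x0 x1] /andP[x2 x3]] Px.
exists x; split; first by rewrite x0.
  by apply: Px; rewrite in_itv/= x0.
by rewrite ltr_norml; apply/andP; split; lra.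
Qed.

(** A Caratheodory function is a limit of functions that are step functions in [x]. Since the
    sections are measurable only for a.e. [x], the sample points are good points close to the grid
    points [k / (n + 1)], which suffices by continuity in [x]. *)
Lemma measurable_caratheodory (v : R -> R -> R) :
  (forall t, continuous (v^~ t)) ->
  {ae mu, forall x, x \in `]0, 1[ -> measurable_fun setT (v x)} ->
  measurable_fun setT (fun z : R * R => v (clamp 0 1 z.1) z.2).
Proof.
move=> cv aev.
have cl01 x := clamp_itv (@ltr01 R) x.
have /choice[p hp] : forall nk : nat * nat, exists x,
    measurable_fun setT (v x) /\ ((nk.2 <= nk.1.+1)%N ->
    `|x - nk.2%:R / nk.1.+1%:R| < nk.1.+1%:R^-1).
  move=> [n k] /=; have [kn|kn] := leqP k n.+1.
    have c01 : 0 <= (k%:R : R) / n.+1%:R <= 1.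
      by rewrite divr_ge0//= ler_pdivrMr// mul1r ler_nat.
    have n0 : 0 < n.+1%:R^-1 :> R by rewrite invr_gt0.
    have [x [_ mx xk]] := @ae_dense01 _ _ _ c01 n0 aev.
    by exists x.
  have h01 : 0 <= (0 : R) <= 1 by rewrite lexx ler01.
  have [x [_ mx xk]] := @ae_dense01 _ _ _ h01 (@ltr01 R) aev.
  by exists x.
pose cell (n k : nat) (x : R) := (k%:R <= n.+1%:R * clamp 0 1 x) &&
  (n.+1%:R * clamp 0 1 x < k.+1%:R).
(* There are [n + 2] cells: [clamp 0 1 x = 1] falls into the one of index [n + 1]. *)
pose G n (z : R * R) := \sum_(k < n.+2) if cell n k z.1 then v (p (n, val k)) z.2 else 0.
have mcl : measurable_fun setT (clamp 0 1 : R -> R).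
  apply: measurable_maxr => //; exact: measurable_minr.
have mG n : measurable_fun setT (G n).
  apply: measurable_sum => k; apply: measurable_fun_ifT => //.
    have mc : measurable_fun setT (fun z : R * R => n.+1%:R * clamp 0 1 z.1).
      by apply: measurable_funM => //; exact: measurableT_comp.
    by apply: measurable_and; [exact: measurable_fun_ler|exact: measurable_fun_ltr].
  by have [mp _] := hp (n, val k); exact: (measurableT_comp mp).
apply: (@measurable_fun_cvg _ _ _ setT G) => //.
move=> [x t] _ /=.
set c := clamp 0 1 x; have /andP[c0 c1] : 0 <= c <= 1 by exact: cl01.
pose K n := Num.truncn (n.+1%:R * c).
have KP n : (K n)%:R <= n.+1%:R * c < (K n).+1%:R by rewrite truncn_itv ?mulr_ge0.
have Kn n : (K n < n.+2)%N.
  have /andP[h _] := KP n; rewrite ltnS -(ler_nat R) (le_trans h)//.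
  by rewrite ler_piMr.
have GE n : G n (x, t) = v (p (n, K n)) t.
  rewrite /G (bigD1 (Ordinal (Kn n)))//= big1 ?addr0.
    by rewrite /cell -/c KP.
  move=> k kK; rewrite /cell -/c; case: ifPn => // /andP[k1 k2].
  have /andP[K1 K2] := KP n.
  have e1 : (k < (K n).+1)%N by rewrite -(ltr_nat R) (le_lt_trans k1).
  have e2 : (K n < k.+1)%N by rewrite -(ltr_nat R) (le_lt_trans K1).
  by move: kK; rewrite -val_eqE/= eqn_leq -ltnS e1 -ltnS e2.
under eq_fun do rewrite GE.
apply: (cvg_comp _ (v^~ t)); last exact: cv.
apply/cvgrPdist_lt => e e0; near=> n.
have [_ /(_ (Kn n))] := hp (n, K n) => /= h.
have n0 : 0 < n.+1%:R :> R by [].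
have /andP[K1 K2] := KP n.
have h2 : `|(K n)%:R / n.+1%:R - c| <= n.+1%:R^-1.
  rewrite -(mulfK (lt0r_neq0 n0) c) -mulrBl normrM [X in _ * X]gtr0_norm ?invr_gt0//.
  rewrite ler_piMl ?invr_ge0// ler_norml.
  move: K2; rewrite -natr1 [c * _]mulrC => K2.
  by apply/andP; split; lra.
rewrite distrC; apply: le_lt_trans (ler_distD ((K n)%:R / n.+1%:R) _ _) _.
apply: (@lt_le_trans _ _ (n.+1%:R^-1 + n.+1%:R^-1)).
  exact: ltr_leD.
have : n.+1%:R^-1 < e / 2.
  by near: n; exact: (near_infty_natSinv_lt (PosNum (divr_gt0 e0 (ltr0Sn R 1)))).
by move=> hlt; rewrite [e in X in _ <= X]splitr; apply: lerD; exact: ltW.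
Unshelve. all: by end_near. Qed.

End caratheodory_function.

Section space_time_regularity.
Context {R : realType}.
Local Notation mu := (@lebesgue_measure R).
Variables (alpha T : R) (u : R -> R -> R).
Hypotheses (alpha_gt0 : 0 < alpha) (alpha_lt1 : alpha < 1) (T_gt0 : 0 < T).
Hypothesis u_cont : forall t, t \in `[0, T] ->
  {within `[0, 1], continuous (fun x => u x t)}.
Hypothesis u_ac : {ae mu, forall x, x \in `]0, 1[ ->
  absolutely_continuous 0 T (u x)}.

(** Composition with the projections preserves continuity in each variable and makes joint
    measurability a statement about the whole plane, while the values on the closed rectangle are
    those of [u]. *)
Definition uext (x t : R) := u (clamp 0 1 x) (clamp 0 T t).

Lemma uextE x t : 0 <= x <= 1 -> 0 <= t <= T -> uext x t = u x t.
Proof. by move=> x01 tT; rewrite /uext !clampE. Qed.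

Lemma uext_continuous_space t : continuous (uext^~ t).
Proof.
have ct : clamp 0 T t \in `[0, T] by rewrite in_itv/= clamp_itv.
have /subspace_continuousP cu := u_cont ct.
move=> x; have x01 : (`[0, 1]%classic : set R) (clamp 0 1 x).
  by rewrite /= in_itv/= clamp_itv.
have := cu _ x01 => /cvgrPdist_lt h.
apply/cvgrPdist_lt => e e0; have := h e e0; rewrite near_withinE => /nbhs_ballP[d /= d0 H].
near=> y; apply: H; last by rewrite /= in_itv/= clamp_itv.
rewrite /ball/=; apply: le_lt_trans (clamp_dist _ _ _ _) _.
by near: y; exact: cvgr_dist_lt.
Unshelve. all: by end_near. Qed.

Lemma uext_continuous_time x : 0 < x < 1 -> absolutely_continuous 0 T (u x) ->
  continuous (uext x).
Proof.
move=> /andP[x0 x1] ac t; apply/cvgrPdist_lt => e e0.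
have [d d0 H] := absolutely_continuous_continuous ac (clamp_itv T_gt0 t) e0.
near=> y; rewrite /uext clampE ?(ltW x0) ?(ltW x1)//; apply: H; first exact: clamp_itv.
apply: le_lt_trans (clamp_dist _ _ _ _) _.
by near: y; exact: cvgr_dist_lt.
Unshelve. all: by end_near. Qed.

Lemma measurable_uext : measurable_fun setT (fun z : R * R => uext z.1 z.2).
Proof.
have -> : (fun z : R * R => uext z.1 z.2) = (fun z => uext (clamp 0 1 z.1) z.2).
  by apply/funext => z; rewrite /uext (clampE (clamp_itv ltr01 _)).
apply: measurable_caratheodory; first exact: uext_continuous_space.
apply: filterS (u_ac); first exact: (ae_filter_ringOfSetsType mu).
move=> x ac x01; apply: continuous_measurable_fun.
apply: uext_continuous_time; last exact: ac.
by move: x01; rewrite in_itv.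
Qed.

(** An upper limit of countably many measurable difference quotients, hence jointly measurable
    everywhere. It is the time derivative at each point of the open rectangle where that exists. *)
Definition uext_dt (x t : R) : R := fine (limn_esup (fun n : nat =>
  (n.+1%:R * (uext x (t + n.+1%:R^-1) - uext x t))%:E)).

Lemma measurable_uext_dt : measurable_fun setT (fun z : R * R => uext_dt z.1 z.2).
Proof.
apply: measurableT_comp => //.
apply: (measurable_fun_limn_esup (f := fun n (z : R * R) =>
  (n.+1%:R * (uext z.1 (z.2 + n.+1%:R^-1) - uext z.1 z.2))%:E)) => n.
apply/measurable_EFinP; apply: measurable_funM => //; apply: measurable_funB.
  apply: (measurableT_comp (g := fun z : R * R => (z.1, z.2 + n.+1%:R^-1)) measurable_uext).
  by apply: measurable_fun_pair => //; exact: measurable_funD.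
exact: measurable_uext.
Qed.

Lemma uext_dtE x t (g : R) : 0 < x < 1 -> 0 < t < T -> is_derive t 1 (u x) g ->
  uext_dt x t = g.
Proof.
move=> /andP[x0 x1] /andP[t0 tT] [du <-].
have x01 : 0 <= x <= 1 by rewrite (ltW x0) (ltW x1).
rewrite /uext_dt; suff -> : limn_esup (fun n : nat =>
    (n.+1%:R * (uext x (t + n.+1%:R^-1) - uext x t))%:E) = ('D_1 (u x) t)%:E by [].
have h : (n.+1%:R * (uext x (t + n.+1%:R^-1) - uext x t))%:E @[n --> \oo] -->
    ('D_1 (u x) t)%:E.
  apply: cvg_EFin; first exact: nearW.
  have /cvgr_dnbhsP/(_ harmonic) := du.
  have hpos (n : nat) : @harmonic R n != 0 by rewrite /harmonic /= invr_eq0.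
  move=> /(_ (conj hpos (@cvg_harmonic R))) hc.
  rewrite /derive; apply: cvg_trans hc; apply: near_eq_cvg; near=> n.
  rewrite /GRing.scale/= mulr1 invrK [_ + t]addrC.
  have tn : t + n.+1%:R^-1 < T.
    rewrite -ltrBrDl; near: n.
    by apply: (near_infty_natSinv_lt (PosNum (_ : 0 < T - t))); rewrite subr_gt0.
  have tn0 : 0 <= t + n.+1%:R^-1 <= T by rewrite (ltW tn) andbT addr_ge0 ?invr_ge0// ltW.
  have tT' : 0 <= t <= T by rewrite !ltW.
  by rewrite !uextE.
rewrite limn_esup_lim; apply/cvg_lim => //; exact: cvg_esups h.
Unshelve. all: by end_near. Qed.

End space_time_regularity.

(** * Integration of the Caputo derivative in time *)

Section caputo_identity.
Context {R : realType}.
Local Notation mu := (@lebesgue_measure R).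
Variables (alpha T : R) (u : R -> R -> R).
Hypotheses (alpha_gt0 : 0 < alpha) (alpha_lt1 : alpha < 1) (T_gt0 : 0 < T).

Local Notation uext := (uext T u).
Local Notation uext_dt := (uext_dt T u).

(** The Caputo derivative with the jointly measurable [uext_dt] in place of [derive1]. *)
Definition uext_caputo (x t : R) : R := (Gamma (1 - alpha))^-1 *
  \int[mu]_(s in `]0, t[) ((t - s) `^ (- alpha) * uext_dt x s).

(** The real integral is the [fine] of a difference of two Tonelli integrals, those of the positive
    and negative parts, and each is measurable in the parameter. *)
Lemma measurable_uext_caputo : measurable_fun setT (fun z : R * R => uext_dt z.1 z.2) ->
  measurable_fun setT (fun z : R * R => uext_caputo z.1 z.2).
Proof.
move=> mdt; apply: measurable_funM => //.
pose f (w : (R * R) * R) : \bar R := (if (0 < w.2) && (w.2 < w.1.2) then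
  (w.1.2 - w.2) `^ (- alpha) * uext_dt w.1.1 w.2 else 0)%:E.
have mf : measurable_fun setT f.
  apply/measurable_EFinP/measurable_fun_ifT => //.
    apply: measurable_and; first exact: measurable_fun_ltr.
    by apply: measurable_fun_ltr => //; exact: measurableT_comp.
  apply: measurable_funM.
    apply: (measurableT_comp (@measurable_powR R (- alpha))).
    by apply: measurable_funB => //; exact: measurableT_comp.
  apply: (measurableT_comp (g := fun w : (R * R) * R => (w.1.1, w.2)) mdt).
  by apply: measurable_fun_pair => //; exact: measurableT_comp.
have -> : (fun z : R * R => \int[mu]_(s in `]0, z.2[) ((z.2 - s) `^ (- alpha) * uext_dt z.1 s)) =
    (fun z => fine (\int[mu]_s f^\+ (z, s) - \int[mu]_s f^\- (z, s))%E).
  apply/funext => z; rewrite /Rintegral; congr fine.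
  rewrite integral_mkcond integralE; congr (_ - _)%E; apply: eq_integral => s _.
    by rewrite !funeposE /f /patch/= mem_setE in_itv/=; case: ifPn.
  by rewrite !funenegE /f /patch/= mem_setE in_itv/=; case: ifPn.
apply: measurableT_comp => //; apply: emeasurable_funB.
  apply: measurable_fun_fubini_tonelli_F => //; exact: measurable_funepos.
apply: measurable_fun_fubini_tonelli_F => //; exact: measurable_funeneg.
Qed.

Section fixed_point.
Variable x : R.
Hypotheses (x01 : 0 < x < 1) (acx : absolutely_continuous 0 T (u x)).

Let dens : exists g : R -> R,
  [/\ mu.-integrable setT (EFin \o g),
   forall t, 0 <= t <= T -> \int[mu]_(s in `]0, t[) g s = u x t - u x 0,
   {ae mu, forall t, 0 < t < T -> is_derive t 1 (u x) (g t)} &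
   {ae mu, forall t, 0 < t < T -> uext_dt x t = g t}].
Proof.
have [g [ig gE dg]] := absolutely_continuous_FTC T_gt0 acx.
exists g; split => //.
  move=> t tT; rewrite -gE// Rintegral_itv_bndo_bndc//.
  exact: integrableS ig.
apply: filterS dg; first exact: (ae_filter_ringOfSetsType mu).
by move=> t h tT; apply: uext_dtE => //; exact: h.
Qed.

Lemma caputoE t : 0 < t < T -> caputo alpha (u x) t = uext_caputo x t.
Proof.
move=> /andP[t0 tT]; have [g [_ _ dg ug]] := dens.
rewrite /caputo /uext_caputo; congr (_ * _); apply: Rintegral_ae_eq.
apply: (filterS2 _ _ dg ug); first exact: (ae_filter_ringOfSetsType mu).
move=> s ds us; rewrite /= in_itv/= => /andP[s0 st].
have sT : 0 < s < T by rewrite s0 (lt_trans st).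
by rewrite us// derive1E powRN mulrC; have h := ds sT; rewrite derive_val.
Qed.

Variable r : R.
Hypothesis r0T : 0 < r < T.

Let K s := (r - s) `^ (1 - alpha) / (1 - alpha).
Let C := r `^ (1 - alpha) / (1 - alpha).

Let K_le s : 0 < s < r -> K s <= C.
Proof.
move=> /andP[s0 sr]; rewrite ler_wpM2r ?invr_ge0 ?subr_ge0 ?(ltW alpha_lt1)//.
by rewrite ge0_ler_powR ?nnegrE ?subr_ge0 ?(ltW sr) ?(ltW alpha_lt1)//; lra.
Qed.

(** The kernels [(t - s)^-alpha] and [(r - t)^-alpha] have the same integral [K s] over [s < t < r].
    Hence, with [g] the density of [u x], both sides are the integral of [K s * g s]: the first
    kernel gives the Caputo derivative, the second the integral of [g] over []0, t[], which is
    [u x t - u x 0]. *)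
Lemma caputo_integral : mu.-integrable `]0, r[ (EFin \o uext_caputo x) /\
  \int[mu]_(t in `]0, r[) uext_caputo x t = (Gamma (1 - alpha))^-1 *
  \int[mu]_(t in `]0, r[) ((r - t) `^ (- alpha) * (uext x t - uext x 0)).
Proof.
have /andP[r0 rT] := r0T.
have [g [ig gE dg ug]] := dens.
have mg : measurable_fun setT g by have /integrableP[/measurable_EFinP] := ig.
have igr : mu.-integrable `]0, r[ (EFin \o g) by exact: integrableS ig.
pose k1 (t s : R) := (t - s) `^ (- alpha).
pose k2 (t s : R) := (r - t) `^ (- alpha).
have mk1 : measurable_fun setT (fun z : R * R => k1 z.1 z.2).
  by apply: (measurableT_comp (@measurable_powR R (- alpha))); exact: measurable_funB.
have mk2 : measurable_fun setT (fun z : R * R => k2 z.1 z.2).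
  by apply: (measurableT_comp (@measurable_powR R (- alpha))); exact: measurable_funB.
have k10 t s : 0 <= k1 t s by exact: powR_ge0.
have k20 t s : 0 <= k2 t s by exact: powR_ge0.
have k1K s : 0 < s < r -> (\int[mu]_(t in `]s, r[) (k1 t s)%:E = (K s)%:E)%E.
  by move=> /andP[_ sr]; exact: integral_powRN_left.
have k2K s : 0 < s < r -> (\int[mu]_(t in `]s, r[) (k2 t s)%:E = (K s)%:E)%E.
  by move=> /andP[_ sr]; exact: integral_powRN_right.
have E t : 0 < t < T -> uext_caputo x t =
    (Gamma (1 - alpha))^-1 * \int[mu]_(s in `]0, t[) (k1 t s * g s).
  move=> /andP[t0 tT]; congr (_ * _); apply: Rintegral_ae_eq.
  apply: filterS ug; first exact: (ae_filter_ringOfSetsType mu).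
  move=> s us; rewrite /= in_itv/= => /andP[s0 st].
  by rewrite us// s0 (lt_trans st).
have i1 := kernel_triangle_integrable2 mk1 k10 mg igr k1K K_le.
split.
  have : mu.-integrable `]0, r[ (EFin \o (fun t =>
      (Gamma (1 - alpha))^-1 * \int[mu]_(s in `]0, t[) (k1 t s * g s))).
    exact: RintegrableZl.
  apply: eq_integrable => // t; rewrite inE/= in_itv/= => /andP[t0 tr].
  by rewrite E// t0 (lt_trans tr).
transitivity (\int[mu]_(t in `]0, r[)
    ((Gamma (1 - alpha))^-1 * \int[mu]_(s in `]0, t[) (k1 t s * g s))).
  apply: eq_Rintegral => t; rewrite inE/= in_itv/= => /andP[t0 tr].
  by rewrite E// t0 (lt_trans tr).
rewrite RintegralZl//; congr (_ * _).
rewrite (kernel_triangle mk1 k10 mg igr k1K K_le).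
rewrite -(kernel_triangle mk2 k20 mg igr k2K K_le).
apply: eq_Rintegral => t; rewrite inE/= in_itv/= => /andP[t0 tr].
rewrite /k2 RintegralZl//; last exact: integrableS ig.
have tT : 0 <= t <= T by rewrite (ltW t0) (ltW (lt_trans tr rT)).
have x01' : 0 <= x <= 1 by case/andP: x01 => ? ?; rewrite !ltW.
by rewrite gE// !uextE// ?lexx ?(ltW T_gt0).
Qed.

End fixed_point.
End caputo_identity.

(** * Weak form of the equation *)

Section L2_bounds.
Context {R : realType}.
Local Notation mu := (@lebesgue_measure R).
Implicit Types (f F : R -> R) (M : R).

Lemma L2norm_ge0 f : (0 <= L2norm f)%E.
Proof. by rewrite /L2norm unlock poweR_ge0. Qed.

Lemma L2norm_H2norm f M : (H2norm f <= M%:E)%E -> (L2norm f <= M%:E)%E.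
Proof.
move=> fM; have E : L2norm f = ((L2norm f ^+ 2) `^ 2^-1)%E.
  have := L2norm_ge0 f; case: (L2norm f) => [r| |]//.
    rewrite lee_fin => r0; rewrite -EFin_expe poweR_EFin -powR_mulrn//.
    by rewrite -powRrM mulfV// powRr1.
  by rewrite expe2 mulyy poweRyr// invr_eq0.
rewrite E; apply: le_trans fM; rewrite /H2norm.
have sq0 (g : R -> R) : (0 <= L2norm g ^+ 2)%E.
  by rewrite expe2; apply: mule_ge0; exact: L2norm_ge0.
apply: gt0_ler_poweR.
- by rewrite invr_ge0.
- by rewrite in_itv/= leey andbT; exact: sq0.
- by rewrite in_itv/= leey andbT; apply: adde_ge0; [apply: adde_ge0|]; exact: sq0.
- by rewrite -addeA leeDl//; apply: adde_ge0; exact: sq0.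
Qed.

Lemma L2norm_integral_sqr f F M : ae_eq mu `]0, 1[%classic f F -> (L2norm f <= M%:E)%E ->
  (\int[mu]_(x in `]0%R, 1%R[) (F x ^+ 2)%:E <= (M ^+ 2)%:E)%E.
Proof.
move=> fF fM; have M0 : 0 <= M.
  by rewrite -lee_fin (le_trans _ fM)// L2norm_ge0.
have -> : (\int[mu]_(x in `]0%R, 1%R[) (F x ^+ 2)%:E =
    \int[mu]_x `|(EFin \o (f \_ `]0%R, 1%R[)) x| `^ 2)%E.
  rewrite integral_mkcond; apply/esym/integral_ae_eq.
  apply: filterS fF => x.
  move=> fFx _; rewrite /= /patch; case: ifPn => x01.
    by rewrite fFx ?powR_mulrn// ?real_normK ?num_real//; exact/set_mem.
  by rewrite normr0 powR0.
have : ((L2norm f) `^ 2 <= (M%:E) `^ 2)%E.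
  by apply: gt0_ler_poweR => //; rewrite in_itv/= leey andbT// L2norm_ge0.
rewrite /L2norm unlock -poweRrM mulVf// poweRe1; last first.
  by apply: integral_ge0 => x _; exact: poweR_ge0.
by rewrite poweR_EFin powR_mulrn.
Qed.

(** From [|F| <= 1 + F^2] on an interval of length 1. *)
Lemma integrable_of_sqr F M : measurable_fun (`]0, 1[%classic : set R) F ->
  (\int[mu]_(x in `]0%R, 1%R[) (F x ^+ 2)%:E <= (M ^+ 2)%:E)%E ->
  (\int[mu]_(x in `]0%R, 1%R[) `|F x|%:E <= (1 + M ^+ 2)%:E)%E.
Proof.
move=> mF F2.
have mF2 : measurable_fun (`]0, 1[%classic : set R) (fun x => (F x ^+ 2)%:E).
  by apply/measurable_EFinP; exact: measurable_funX.
apply: (@le_trans _ _ (\int[mu]_(x in `]0%R, 1%R[) (1%:E + (F x ^+ 2)%:E))%E).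
  apply: ge0_le_integral => //.
  - by apply/measurable_EFinP; apply: measurableT_comp.
  - exact: emeasurable_funD.
  - move=> x _; rewrite lee_fin -(real_normK (num_real (F x))).
    by have := sqr_ge0 (`|F x| - 1); have := normr_ge0 (F x); nra.
rewrite ge0_integralD//; last by move=> x _; rewrite lee_fin sqr_ge0.
have -> : (\int[mu]_(x in `]0%R, 1%R[) 1%:E = 1%:E)%E.
  rewrite integral_cst// -[X in (_ * X)%E]/(mu `]0%R, 1%R[%classic).
  by rewrite lebesgue_measure_itv/= lte_fin ltr01 oppr0 adde0 mule1.
by rewrite EFinD leeD2l.
Qed.

Lemma weak_derivative2 f g g' phi : is_weak_derivative f g ->
  is_weak_derivative g g' -> test_function phi ->
  \int[mu]_(x in `]0, 1[) (f x * derive1 (derive1 phi) x) =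
  \int[mu]_(x in `]0, 1[) (g' x * phi x).
Proof.
move=> [_ _ fg] [_ _ gg'] tphi.
by rewrite fg ?gg' ?opprK//; exact: test_function_derive1.
Qed.

End L2_bounds.

Section slices.
Context {R : realType}.
Local Notation mu := (@lebesgue_measure R).
Implicit Types (B : set R) (f : R -> R -> R).

Lemma measurable_integral_slice B (h : R * R -> \bar R) : measurable B ->
  measurable_fun setT h -> (forall z, 0 <= h z)%E ->
  measurable_fun setT (fun t => \int[mu]_(x in B) h (t, x))%E.
Proof.
move=> mB mh h0.
have mg : measurable_fun setT (h \_ (setT `*` B)).
  apply/(measurable_restrictT _ (measurableX measurableT mB)).
  exact: measurable_funTS.
have -> : (fun t => \int[mu]_(x in B) h (t, x))%E =
    (fun t => \int[mu]_x (h \_ (setT `*` B)) (t, x))%E.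
  apply/funext => t; rewrite integral_mkcond; apply: eq_integral => x _.
  rewrite /patch; congr (if _ then _ else _).
  by apply/idP/idP; rewrite !inE; [split|case].
apply: measurable_fun_fubini_tonelli_F => // z.
by rewrite /patch; case: ifPn.
Qed.

Lemma measurable_Rintegral_slice B f : measurable B ->
  measurable_fun setT (fun z : R * R => f z.1 z.2) ->
  measurable_fun setT (fun t => \int[mu]_(x in B) f t x).
Proof.
move=> mB mf; have mEf : measurable_fun setT (fun z : R * R => (f z.1 z.2)%:E).
  exact/measurable_EFinP.
have -> : (fun t => \int[mu]_(x in B) f t x) = (fun t =>
    fine (\int[mu]_(x in B) (fun z : R * R => (f z.1 z.2)%:E)^\+%E (t, x) -
          \int[mu]_(x in B) (fun z : R * R => (f z.1 z.2)%:E)^\-%E (t, x))%E).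
  apply/funext => t; rewrite /Rintegral integralE; congr (fine (_ - _)%E);
  by apply: eq_integral => x _; rewrite ?funeposE ?funenegE.
apply: measurableT_comp => //; apply: emeasurable_funB.
  by apply: measurable_integral_slice => //; exact: measurable_funepos.
by apply: measurable_integral_slice => //; exact: measurable_funeneg.
Qed.

(** Supplies the finiteness condition of Fubini's theorem from bounds on a.e. slice. *)
Lemma slice_integral_lty A B f (c : R -> R) : measurable A -> measurable B ->
  measurable_fun setT (fun z : R * R => f z.1 z.2) ->
  {ae mu, forall t, A t -> (\int[mu]_(x in B) `|f t x|%:E <= (c t)%:E)%E} ->
  mu.-integrable A (EFin \o c) ->
  (\int[mu]_(t in A) \int[mu]_(x in B) `|f t x|%:E < +oo)%E.
Proof.
move=> mA mB mf fc /integrableP[mc ic].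
have mfa : measurable_fun setT (fun z : R * R => `|f z.1 z.2|%:E).
  by apply/measurable_EFinP; exact: measurableT_comp.
apply: le_lt_trans ic.
apply: ae_ge0_le_integral => //.
- by move=> t _; apply: integral_ge0 => x _; rewrite lee_fin.
- by apply: measurable_funTS; apply: (measurable_integral_slice mB mfa) => z; rewrite lee_fin.
- exact: measurableT_comp.
- apply: filterS fc; first exact: (ae_filter_ringOfSetsType mu).
  move=> t h At; apply: le_trans (h At) _; rewrite lee_fin; exact: ler_norm.
Qed.

End slices.

Section pairing.
Context {R : realType}.
Local Notation mu := (@lebesgue_measure R).

Definition pairing (v : R -> R -> R) (phi : R -> R) (t : R) : R :=
  \int[mu]_(x in `]0, 1[) (v x t * phi x).

Variables (v : R -> R -> R).
Hypothesis cv : forall t, continuous (v^~ t).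
Hypothesis mv : measurable_fun setT (fun z : R * R => v z.1 z.2).
Variable phi : R -> R.
Hypothesis cphi : continuous phi.

Let mswap : measurable_fun setT (fun z : R * R => v z.2 z.1).
Proof.
apply: (measurableT_comp (g := fun z : R * R => (z.2, z.1)) mv).
exact: measurable_fun_pair.
Qed.

Lemma measurable_pairing : measurable_fun setT (pairing v phi).
Proof.
apply: (measurable_Rintegral_slice (f := fun t x => v x t * phi x)) => //.
apply: measurable_funM => //.
by apply: measurableT_comp => //; exact: continuous_measurable_fun.
Qed.

Lemma pairing_integrable t :
  mu.-integrable `]0, 1[ (EFin \o (fun x => v x t * phi x)).
Proof.
apply: (@integrableS _ _ _ mu `[0, 1]) => //; first exact: subset_itv_oo_cc.
apply: continuous_compact_integrable; first exact: segment_compact.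
by apply: continuous_subspaceT => x; apply: cvgM; [exact: cv|exact: cphi].
Qed.

Lemma slice_integrable t : mu.-integrable `]0, 1[ (EFin \o v^~ t).
Proof.
apply: (@integrableS _ _ _ mu `[0, 1]) => //; first exact: subset_itv_oo_cc.
apply: continuous_compact_integrable; first exact: segment_compact.
by apply: continuous_subspaceT => x; exact: cv.
Qed.

Lemma pairing_le t (B : R) : 0 <= B ->
  (forall x, 0 < x < 1 -> `|v x t * phi x| <= B * `|v x t|) ->
  `|pairing v phi t| <= B * \int[mu]_(x in `]0, 1[) `|v x t|.
Proof.
move=> B0 hB; apply: le_trans (le_normr_Rintegral _ (pairing_integrable t)) _ => //.
have ia : mu.-integrable `]0, 1[ (EFin \o (fun x => `|v x t|)).
  exact: (integrable_abse (slice_integrable t)).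
rewrite -RintegralZl//; apply: le_Rintegral => //.
- exact: (integrable_abse (pairing_integrable t)).
- exact: RintegrableZl.
Qed.

End pairing.

(** * The Volterra equation for the pairing with a test function *)

Section pairing_volterra.
Context {R : realType}.
Local Notation mu := (@lebesgue_measure R).
Variables (alpha T : R) (u : R -> R -> R).
Hypotheses (alpha_gt0 : 0 < alpha) (alpha_lt1 : alpha < 1) (T_gt0 : 0 < T).
Hypothesis u_cont : forall t, t \in `[0, T] ->
  {within `[0, 1], continuous (fun x => u x t)}.
Hypothesis u_ac : {ae mu, forall x, x \in `]0, 1[ ->
  absolutely_continuous 0 T (u x)}.
Hypothesis u_H2 : Linfty H2 H2norm T (fun t x => u x t).
Hypothesis Du_L2 : Linfty L2 L2norm T (fun t x => caputo alpha (u x) t).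
Hypothesis u_eq : {ae mu, forall t, t \in `]0, T[ ->
  {ae mu, forall x, x \in `]0, 1[ ->
    caputo alpha (u x) t - weakD (weakD (fun y => u y t)) x = 0}}.

Local Notation w := (uext T u).
Local Notation D := (uext_caputo alpha T u).

Let mw : measurable_fun setT (fun z : R * R => w z.1 z.2).
Proof. exact: measurable_uext. Qed.

Let mD : measurable_fun setT (fun z : R * R => D z.1 z.2).
Proof. by apply: measurable_uext_caputo; exact: measurable_uext_dt. Qed.

Let mslice (f : R -> R -> R) t : measurable_fun setT (fun z : R * R => f z.1 z.2) ->
  measurable_fun setT (f^~ t).
Proof.
move=> mf; apply: (measurableT_comp (g := fun x : R => (x, t)) mf).
exact: measurable_fun_pair.
Qed.

Let cDE t : 0 < t < T -> ae_eq mu `]0, 1[%classic (fun x => caputo alpha (u x) t) (D^~ t).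
Proof.
move=> tT; apply: filterS u_ac; first exact: (ae_filter_ringOfSetsType mu).
move=> x ac x01; apply: caputoE => //; last exact: ac.
Qed.

Lemma uext_L1_bound : exists M, {ae mu, forall t, 0 < t < T ->
  (\int[mu]_(x in `]0%R, 1%R[) `|w x t|%:E <= M%:E)%E}.
Proof.
have [_ _ [M hM]] := u_H2; exists (1 + M ^+ 2).
apply: filterS hM; first exact: (ae_filter_ringOfSetsType mu).
move=> t + tT; rewrite in_itv/= => /(_ tT) /L2norm_H2norm hL.
apply: integrable_of_sqr; first by apply: measurable_funTS; exact: mslice.
apply: L2norm_integral_sqr hL; apply: aeW => x; rewrite /= in_itv/= => /andP[x0 x1].
by case/andP: tT => t0 tT; rewrite uextE ?(ltW x0) ?(ltW x1) ?(ltW t0) ?(ltW tT).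
Qed.

Lemma caputo_L1_bound : exists M, {ae mu, forall t, 0 < t < T ->
  (\int[mu]_(x in `]0%R, 1%R[) `|D x t|%:E <= M%:E)%E}.
Proof.
have [_ _ [M hM]] := Du_L2; exists (1 + M ^+ 2).
apply: filterS hM; first exact: (ae_filter_ringOfSetsType mu).
move=> t + tT; rewrite in_itv/= => /(_ tT) hL.
apply: integrable_of_sqr; first by apply: measurable_funTS; exact: mslice.
by apply: L2norm_integral_sqr hL; exact: cDE.
Qed.

(** The exceptional times are those where the hypotheses on [u] fail, hence the same for all test
    functions. *)
Lemma weak_equation : {ae mu, forall t, 0 < t < T -> forall phi, test_function phi ->
  pairing w (derive1 (derive1 phi)) t = pairing D phi t}.
Proof.
have [uH _ _] := u_H2.
apply: (filterS2 _ _ uH u_eq); first exact: (ae_filter_ringOfSetsType mu).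
move=> t + + tT phi tphi; rewrite in_itv/= => /(_ tT)[d1 d2] /(_ tT) eqn.
transitivity (\int[mu]_(x in `]0, 1[) (u x t * derive1 (derive1 phi) x)).
  apply: eq_Rintegral => x; rewrite inE/= in_itv/= => /andP[x0 x1].
  by case/andP: tT => t0 tT; rewrite uextE ?(ltW x0) ?(ltW x1) ?(ltW t0) ?(ltW tT).
rewrite (weak_derivative2 d1 d2 tphi); apply: Rintegral_ae_eq.
apply: (filterS2 _ _ eqn (cDE tT)); first exact: (ae_filter_ringOfSetsType mu).
move=> x e1 e2 x01; rewrite -e2//.
by move: e1 => /(_ x01) /eqP; rewrite subr_eq0 => /eqP ->.
Qed.

(** Space and time integrals are exchanged, [caputo_integral] is applied for a.e. [x], and the
    integrals are exchanged back. The exchanges rest on bounds, uniform in time, for the L1 norms of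
    the Caputo derivative and of [w], multiplied in the second case by the integrable kernel
    [(r - t)^-alpha]. *)
Lemma pairing_volterra phi r : test_function phi -> 0 < r < T ->
  \int[mu]_(t in `]0, r[) pairing w (derive1 (derive1 phi)) t =
  (Gamma (1 - alpha))^-1 *
  \int[mu]_(t in `]0, r[) ((r - t) `^ (- alpha) * (pairing w phi t - pairing w phi 0)).
Proof.
move=> tphi r0T; have /andP[r0 rT] := r0T.
have cphi : continuous phi by apply: smooth_continuous; exact: test_function_smooth.
have mphi : measurable_fun setT phi by exact: continuous_measurable_fun.
have [B B0 hB] := continuous_bounded01 cphi.
have [M1 hM1] := uext_L1_bound; have [M2 hM2] := caputo_L1_bound.
have mr : measurable (`]0, r[%classic : set R) by exact: measurable_itv.
have m1 : measurable (`]0, 1[%classic : set R) by exact: measurable_itv.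
have icst (c : R) : mu.-integrable `]0, r[ (EFin \o cst c).
  apply/integrableP; split; first by apply/measurable_EFinP; exact: measurable_cst.
  rewrite (eq_integral (cst `|c|%:E)) ?integral_cst//= lebesgue_measure_itv/=.
  by rewrite lte_fin r0 oppr0 adde0 -EFinM ltry.
have mswap (f : R -> R -> R) : measurable_fun setT (fun z : R * R => f z.1 z.2) ->
    measurable_fun setT (fun z : R * R => f z.2 z.1).
  move=> mf; apply: (measurableT_comp (g := fun z : R * R => (z.2, z.1)) mf).
  exact: measurable_fun_pair.
have L1_pairing (f : R -> R -> R) (g : R -> R) (C M : R) (t : R) : 0 <= C ->
    measurable_fun setT g -> (forall x, 0 < x < 1 -> `|g x| <= C) ->
    measurable_fun setT (fun z : R * R => f z.1 z.2) ->
    (\int[mu]_(x in `]0%R, 1%R[) `|f x t|%:E <= M%:E)%E ->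
    (\int[mu]_(x in `]0%R, 1%R[) `|f x t * g x|%:E <= (C * M)%:E)%E.
  move=> C0 mg gC mf h.
  have mft : measurable_fun (`]0, 1[%classic : set R) (f^~ t).
    by apply: measurable_funTS; exact: mslice.
  have -> : ((C * M)%:E = C%:E * M%:E)%E by rewrite EFinM.
  apply: le_trans (lee_wpmul2l _ h); rewrite ?lee_fin//.
  rewrite -ge0_integralZl_EFin//; last first.
    by apply/measurable_EFinP; exact: measurableT_comp.
  apply: ge0_le_integral => //.
  - apply/measurable_EFinP/measurableT_comp => //; apply: measurable_funM => //.
    exact: measurable_funTS.
  - apply/measurable_EFinP; apply: measurable_funM => //.
    exact: measurableT_comp.
  - move=> x; rewrite /= in_itv/= => x01; rewrite -EFinM lee_fin normrM mulrC.
    by apply: ler_wpM2r => //; exact: gC.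
have hB' x : 0 < x < 1 -> `|phi x| <= B.
  by move=> /andP[x0 x1]; apply: hB; rewrite (ltW x0) (ltW x1).
have mf1 : measurable_fun setT (fun z : R * R => D z.2 z.1 * phi z.2).
  apply: measurable_funM; first exact: (mswap D).
  exact: measurableT_comp.
have fin1 : (\int[mu]_(t in `]0%R, r[) \int[mu]_(x in `]0%R, 1%R[) `|D x t * phi x|%:E < +oo)%E.
  apply: (slice_integral_lty (f := fun t x => D x t * phi x) mr m1 mf1 _ (icst (B * M2))).
  apply: filterS hM2; first exact: (ae_filter_ringOfSetsType mu).
  move=> t + tr; have tT : 0 < t < T.
    by move: tr; rewrite /= in_itv/= => /andP[-> /lt_trans]; apply.
  by move=> /(_ tT) h; apply: L1_pairing.
pose k t := (r - t) `^ (- alpha).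
have mk : measurable_fun setT k.
  exact: measurable_powRBr.
have ik : mu.-integrable `]0, r[ (EFin \o k).
  apply/integrableP; split; first by apply/measurable_EFinP; exact: measurable_funTS.
  under eq_integral => t _ do rewrite /= ger0_norm ?powR_ge0//.
  by rewrite integral_powRN_right ?ltry.
pose w0 x := w x 0.
have mw0 : measurable_fun setT w0 by exact: mslice.
have cw t : continuous (w^~ t) by exact: uext_continuous_space.
pose M0 := \int[mu]_(x in `]0, 1[) `|w0 x|.
have M0E : (\int[mu]_(x in `]0%R, 1%R[) `|w0 x|%:E = M0%:E)%E.
  rewrite /M0 /Rintegral fineK//; apply: integrable_fin_num => //.
  exact: integrable_abse (slice_integrable cw 0).
have mwd : measurable_fun setT (fun z : R * R => w z.1 z.2 - w0 z.1).
  apply: measurable_funB => //; exact: measurableT_comp.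
have wd_bound : {ae mu, forall t, 0 < t < T ->
    (\int[mu]_(x in `]0%R, 1%R[) `|w x t - w0 x|%:E <= (M1 + M0)%:E)%E}.
  apply: filterS hM1; first exact: (ae_filter_ringOfSetsType mu).
  move=> t + tT => /(_ tT) h; rewrite EFinD -M0E.
  apply: le_trans (leeD2r _ h); rewrite -ge0_integralD//; last 2 first.
    by apply/measurable_EFinP/measurableT_comp => //; apply: measurable_funTS; exact: mslice.
    by apply/measurable_EFinP/measurableT_comp => //; apply: measurable_funTS.
  apply: ge0_le_integral => //.
  - apply/measurable_EFinP/measurableT_comp => //; apply: measurable_funTS.
    by apply: measurable_funB => //; exact: mslice.
  - apply: emeasurable_funD; apply/measurable_EFinP/measurableT_comp => //;
      by apply: measurable_funTS => //; exact: mslice.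
  - by move=> x _; rewrite -EFinD lee_fin ler_normB.
have mf2 (g : R -> R) : measurable_fun setT g ->
    measurable_fun setT (fun z : R * R => k z.1 * ((w z.2 z.1 - w0 z.2) * g z.2)).
  move=> mg; apply: measurable_funM; first exact: measurableT_comp.
  apply: measurable_funM; last exact: measurableT_comp.
  exact: (mswap (fun x t => w x t - w0 x)).
have fin2 (g : R -> R) (C : R) : 0 <= C ->
    measurable_fun setT g -> (forall x, 0 < x < 1 -> `|g x| <= C) ->
    (\int[mu]_(t in `]0%R, r[) \int[mu]_(x in `]0%R, 1%R[)
      `|k t * ((w x t - w0 x) * g x)|%:E < +oo)%E.
  move=> C0 mg gC.
  apply: (slice_integral_lty (f := fun t x => k t * ((w x t - w0 x) * g x))
    (c := fun t => C * (M1 + M0) * k t) mr m1 (mf2 _ mg)); last exact: RintegrableZl.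
  apply: filterS wd_bound; first exact: (ae_filter_ringOfSetsType mu).
  move=> t + tr; have tT : 0 < t < T.
    by move: tr; rewrite /= in_itv/= => /andP[-> /lt_trans]; apply.
  move=> /(_ tT) h.
  have := L1_pairing (fun x t => w x t - w0 x) g C (M1 + M0) t C0 mg gC mwd h.
  move=> {}h; have -> : ((C * (M1 + M0) * k t)%:E = (k t)%:E * (C * (M1 + M0))%:E)%E.
    by rewrite -EFinM mulrC.
  apply: le_trans (lee_wpmul2l _ h); rewrite ?lee_fin ?powR_ge0//.
  rewrite -ge0_integralZl_EFin ?powR_ge0//; last first.
    apply/measurable_EFinP/measurableT_comp => //; apply: measurable_funTS.
    by apply: measurable_funM => //; apply: measurable_funB => //; exact: mslice.
  rewrite le_eqVlt; apply/orP; left; apply/eqP; apply: eq_integral => x _.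
  by rewrite -EFinM [in LHS]normrM ger0_norm// powR_ge0.
have mAB : measurable (`]0, r[%classic `*` `]0, 1[%classic : set (R * R)) by exact: measurableX.
transitivity (\int[mu]_(t in `]0, r[) \int[mu]_(x in `]0, 1[) (D x t * phi x)).
  apply: Rintegral_ae_eq; apply: filterS weak_equation; first exact: (ae_filter_ringOfSetsType mu).
  move=> t ht tr; apply: ht => //.
  by move: tr; rewrite /= in_itv/= => /andP[-> /lt_trans]; apply.
rewrite (Rfubini (m1 := mu) (m2 := mu) mr m1 (measurable_funTS mf1) fin1).
transitivity (\int[mu]_(x in `]0, 1[) ((Gamma (1 - alpha))^-1 *
   \int[mu]_(t in `]0, r[) (k t * ((w x t - w0 x) * phi x)))).
  apply: Rintegral_ae_eq.
  (* Fubini's theorem with the constant 1 in place of [phi] gives, for a.e. [x], integrability in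
     time of the kernel times [w x t - w0 x]; with [phi] it would say nothing where [phi x = 0]. *)
  have m1c : measurable_fun setT (cst 1 : R -> R) by exact: measurable_cst.
  have fin2' : (\int[mu]_(t in `]0%R, r[) \int[mu]_(x in `]0%R, 1%R[)
      `|k t * ((w x t - w0 x) * cst 1 x)|%:E < +oo)%E.
    by apply: (fin2 _ 1) => // x _; rewrite /= normr1.
  have := Rfubini_ae2 (m1 := mu) (m2 := mu) mr m1 (measurable_funTS (mf2 _ m1c)) fin2'.
  apply: (filterS2 _ _ u_ac); first exact: (ae_filter_ringOfSetsType mu).
  move=> x + + x01 => /(_ x01) ac /(_ x01) ikx.
  have x01' : 0 < x < 1 by move: x01; rewrite /= in_itv.
  have [iD DE] := caputo_integral alpha_gt0 alpha_lt1 T_gt0 x01' ac r0T.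
  rewrite RintegralZr// DE -mulrA; congr (_ * _).
  rewrite -RintegralZr//; last first.
    by apply: eq_integrable ikx => // t _; rewrite /= mulr1.
  by apply: eq_Rintegral => t _; rewrite mulrA.
have fin := fin2 _ _ B0 mphi hB'.
have iR := Rfubini_integrable2 (m1 := mu) (m2 := mu) mr m1 (measurable_funTS (mf2 _ mphi)) fin.
rewrite RintegralZl//; congr (_ * _).
rewrite -(Rfubini (m1 := mu) (m2 := mu) mr m1 (measurable_funTS (mf2 _ mphi)) fin).
apply: eq_Rintegral => t _.
have ip s : mu.-integrable `]0, 1[ (EFin \o (fun x => w x s * phi x)).
  exact: pairing_integrable.
rewrite RintegralZl//; last first.
  have := @RintegrableB _ _ _ mu _ _ _ _ (ip t) (ip 0).
  move=> /(_ m1); apply: eq_integrable => // x _.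
  by rewrite /= mulrBl.
congr (_ * _); rewrite /pairing -RintegralB//.
by apply: eq_Rintegral => x _; rewrite mulrBl.
Qed.

End pairing_volterra.

(** * Unique continuation *)

Section subexp.
Context {R : realType}.
Implicit Types (f g : nat -> R) (e p : R).

(** The growth condition of [phragmen], isolated because its stability under sums and products
    absorbs every polynomial factor of the estimates. *)
Definition subexp f := forall e, 0 < e ->
  exists C, forall n : nat, `|f n| <= C * expR (e * n%:R).

Lemma subexp_le f g : (forall n : nat, (0 < n)%N -> `|f n| <= g n) -> subexp g -> subexp f.
Proof.
move=> fg sg e e0; have [C hC] := sg e e0; exists (`|f 0%N| + `|C|) => -[|n].
  by rewrite mulr0 expR0 mulr1 lerDl.
apply: le_trans (fg n.+1 isT) _; apply: le_trans (ler_norm _) _.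
apply: le_trans (hC _) _; rewrite ler_pM2r ?expR_gt0//.
by apply: le_trans (ler_norm _) _; rewrite lerDr.
Qed.

Lemma subexpD f g : subexp f -> subexp g -> subexp (fun n => f n + g n).
Proof.
move=> sf sg e e0; have [C hC] := sf e e0; have [C' hC'] := sg e e0.
exists (C + C') => n; rewrite mulrDl; apply: le_trans (ler_normD _ _) _.
exact: lerD.
Qed.

Lemma subexpM f g : subexp f -> subexp g -> subexp (fun n => f n * g n).
Proof.
move=> sf sg e e0; have e2 : 0 < e / 2 by rewrite divr_gt0.
have [C hC] := sf _ e2; have [C' hC'] := sg _ e2.
exists (C * C') => n; rewrite normrM (splitr e) mulrDl expRD mulrACA.
exact: ler_pM.
Qed.

Lemma subexp_cst c : subexp (fun=> c).
Proof.
move=> e e0; exists `|c| => n; rewrite ler_peMr//.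
by rewrite -expR0 ler_expR mulr_ge0// ltW.
Qed.

Lemma subexp_nat : subexp (fun n => n%:R).
Proof.
move=> e e0; exists e^-1 => n; rewrite ger0_norm// ler_pdivlMl//.
by apply: le_trans (expR_ge1Dx _); rewrite lerDr.
Qed.

Lemma subexpX f k : subexp f -> subexp (fun n => f n ^+ k).
Proof.
move=> sf; elim: k => [|k IH].
  by under eq_fun do rewrite expr0; exact: subexp_cst.
by under eq_fun do rewrite exprS; exact: subexpM.
Qed.

Lemma subexp_powR p : 0 <= p -> subexp (fun n => n%:R `^ p).
Proof.
move=> p0; apply: (@subexp_le _ (fun n => n%:R ^+ Num.bound p)).
  move=> n n0; rewrite ger0_norm ?powR_ge0// -powR_mulrn//.
  by apply: ler_powR; rewrite ?ler1n// (ltW (archi_boundP p0)).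
by apply: subexpX; exact: subexp_nat.
Qed.

Lemma subexp_expR_powR p : p <= 2^-1 -> subexp (fun n => expR (n%:R `^ p)).
Proof.
move=> p2; pose f (n : nat) : R := expR (Num.sqrt n%:R).
apply: (@subexp_le _ f) => [n n0|e e0].
  rewrite ger0_norm ?expR_ge0// ler_expR -powR12_sqrt//.
  by apply: ler_powR; rewrite ?ler1n.
(* Completing the square: [sqrt n <= e n + 1 / (4e)]. *)
exists (expR (4 * e)^-1) => n; rewrite ger0_norm ?expR_ge0// -expRD ler_expR.
have := sqr_sqrtr (ler0n R n); set r := Num.sqrt _ => <-.
rewrite -subr_ge0 (_ : _ - r = e * (r - (2 * e)^-1) ^+ 2); last first.
  by field; rewrite gt_eqF.
by rewrite mulr_ge0 ?sqr_ge0// ltW.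
Qed.

End subexp.

Section ae_bounded.
Context {R : realType}.
Local Notation mu := (@lebesgue_measure R).

Lemma ae_bounded (T K : R) (f : R -> R) (T_gt0 : 0 < T) :
  measurable_fun setT f ->
  {ae mu, forall t, 0 < t < T -> `|f t| <= K} ->
  mu.-integrable `]0, T[ (EFin \o f) /\ \int[mu]_(t in `]0, T[) `|f t| <= T * K.
Proof.
move=> mf fK; have mT : measurable (`]0, T[%classic : set R) by exact: measurable_itv.
have mf' : measurable_fun (`]0, T[%classic : set R) (fun t => `|f t|).
  by apply: measurableT_comp => //; exact: measurable_funTS.
have le : (\int[mu]_(t in `]0%R, T[) `|f t|%:E <= (T * K)%:E)%E.
  have [t t0T h] := ae_itv_exists T_gt0 fK.
  have K0 : 0 <= K by apply: le_trans (h t0T).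
  have -> : ((T * K)%:E = \int[mu]_(t in `]0%R, T[) K%:E)%E.
    rewrite integral_cst//= lebesgue_measure_itv/= lte_fin T_gt0 oppr0 adde0.
    by rewrite -EFinM mulrC.
  apply: ae_ge0_le_integral => //.
  by apply/measurable_EFinP.
have fi : mu.-integrable `]0, T[ (EFin \o f).
  apply/integrableP; split; first by apply/measurable_EFinP; exact: measurable_funTS.
  exact: le_lt_trans le (ltry _).
split => //; rewrite -lee_fin /Rintegral fineK//.
apply: integrable_fin_num => //.
exact: (integrable_abse fi).
Qed.

Lemma expRN_integrable (T s : R) (g : R -> R) : 0 <= s ->
  mu.-integrable `]0, T[ (EFin \o g) ->
  mu.-integrable `]0, T[ (EFin \o (fun t => expR (- (s * t)) * g t)).
Proof.
move=> s0 ig; have [mg _] := integrableP _ _ _ ig.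
apply: le_integrable ig => //.
  apply/measurable_EFinP/measurable_funM; first exact: measurable_expRN.
  exact/measurable_EFinP.
move=> t; rewrite /= in_itv/= => /andP[t0 _]; rewrite lee_fin normrM.
rewrite ger0_norm ?expR_ge0// ler_piMl// -expR0 ler_expR oppr_le0.
by rewrite mulr_ge0// ltW.
Qed.

End ae_bounded.

Lemma continuous_ae_eq0 (R : realType) (f : R -> R) (l r x : R) :
  {for x, continuous f} -> l < r -> l <= x <= r ->
  {ae @lebesgue_measure R, forall y, l < y < r -> f y = 0} -> f x = 0.
Proof.
move=> cf lr /andP[lx xr] f0; apply/eqP; apply: contrapT => /negP fx.
have : \forall y \near x, f y != 0 by apply: (@cvgr_neq0 R R^o _ (nbhs x) _ f (f x)); [exact: cf|exact: fx].
move=> /nbhs_ballP[e /= e0 xe].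
have lr' : Num.max l (x - e) < Num.min r (x + e).
  by rewrite gt_max !lt_min lr/=; apply/andP; split; [|apply/andP; split]; lra.
have [y] := ae_itv_exists lr' f0.
rewrite gt_max lt_min => /andP[/andP[ly xey] /andP[yr yxe]] /(_ _) fy.
have : f y != 0 by apply: xe; rewrite /ball/= ltr_norml; apply/andP; split; lra.
by rewrite fy ?eqxx ?ly.
Qed.

Section plateau.
Context {R : realType}.
Implicit Types (f : R -> R).

Lemma derive1_cst_itv f l r c : (forall y, l < y < r -> f y = c) ->
  forall y, l < y < r -> derive1 f y = 0.
Proof.
move=> fc y /andP[ly yr]; rewrite derive1E (@near_eq_derive _ _ _ _ (cst c))//.
  exact: derive_cst.
near=> z; apply: fc; apply/andP; split; near: z; [exact: lt_nbhsr|exact: lt_nbhsl].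
Unshelve. all: by end_near. Qed.

Lemma derive2_cst_itv f l r c : (forall y, l < y < r -> f y = c) ->
  forall y, l < y < r -> derive1 (derive1 f) y = 0.
Proof. by move=> fc; apply: (@derive1_cst_itv _ _ _ 0); exact: derive1_cst_itv fc. Qed.

Lemma plateau p q r s : p < q -> r < s -> exists f, [/\ smooth f,
  forall x, x <= p -> f x = 0, forall x, q <= x <= r -> f x = 1 &
  forall x, s <= x -> f x = 0].
Proof.
move=> pq rs; have [f [sf f0 f1]] := smooth_step pq.
have [g [sg g0 g1]] := smooth_step rs.
exists (fun x => f x * (1 + -1 * g x)); split.
- apply: smoothM => //; apply: smoothD; first exact: smooth_cst.
  exact: smoothZ.
- by move=> x /f0 ->; rewrite mul0r.
- by move=> x /andP[/f1 -> /g0 ->]; rewrite mulr0 addr0 mulr1.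
- by move=> x /g1 ->; rewrite mulr1 subrr mulr0.
Qed.

Lemma derive1_expRM (a : R) :
  derive1 (fun x => expR (a * x)) = (fun x => a * expR (a * x)).
Proof.
apply: derive1_funE => x.
have := @is_derive_affine _ expR expR a 0 x (is_derive_expR _).
by under eq_fun do rewrite addr0; rewrite addr0.
Qed.

(** [expR (- l x)] solves the homogeneous equation, so only terms containing a derivative of [f]
    survive. *)
Lemma helmholtz_expR f (l : R) : smooth f ->
  (fun x => derive1 (derive1 (fun y => f y * expR (- l * y))) x -
    l ^+ 2 * (f x * expR (- l * x))) =
  (fun x => expR (- l * x) * (derive1 (derive1 f) x - 2 * l * derive1 f x)).
Proof.
move=> sf; have se := smooth_expRM (- l).
rewrite smooth_derive2M// !derive1_expRM.
have -> : derive1 (fun x => - l * expR (- l * x)) = (fun x => l ^+ 2 * expR (- l * x)).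
  apply: derive1_funE => x; have := smooth_is_derive se x; rewrite derive1_expRM.
  move=> /(is_derive_cmul (- l)); rewrite mulrA => h.
  by apply: (is_derive_eq h); rewrite expr2 mulrNN.
by apply/funext => x; ring.
Qed.

End plateau.

(** * Vanishing to the right of the interval *)

Section right_zero.
Context {R : realType}.
Local Notation mu := (@lebesgue_measure R).
Variables (alpha T M : R) (v : R -> R -> R).
Hypotheses (alpha_gt0 : 0 < alpha) (alpha_lt1 : alpha < 1) (T_gt0 : 0 < T).
Hypothesis cv : forall t, continuous (v^~ t).
Hypothesis mv : measurable_fun setT (fun z : R * R => v z.1 z.2).
Hypothesis vM : {ae mu, forall t, 0 < t < T ->
  (\int[mu]_(x in `]0%R, 1%R[) `|v x t|%:E <= M%:E)%E}.
Hypothesis v_volterra : forall phi r, test_function phi -> 0 < r < T ->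
  \int[mu]_(t in `]0, r[) pairing v (derive1 (derive1 phi)) t =
  (Gamma (1 - alpha))^-1 *
  \int[mu]_(t in `]0, r[) ((r - t) `^ (- alpha) * (pairing v phi t - pairing v phi 0)).

Local Notation M0 := (\int[mu]_(x in `]0, 1[) `|v x 0|).

Lemma slice_RintegralE t (K : R) : (\int[mu]_(x in `]0%R, 1%R[) `|v x t|%:E <= K%:E)%E ->
  \int[mu]_(x in `]0, 1[) `|v x t| <= K.
Proof.
move=> h; rewrite -lee_fin /Rintegral fineK//; apply: integrable_fin_num => //.
exact: integrable_abse (slice_integrable cv t).
Qed.

Lemma pairing_ae_le phi (B : R) : continuous phi -> 0 <= B ->
  (forall x t, 0 < x < 1 -> `|v x t * phi x| <= B * `|v x t|) ->
  {ae mu, forall t, 0 < t < T -> `|pairing v phi t| <= B * M}.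
Proof.
move=> cphi B0 h; apply: filterS vM; first exact: (ae_filter_ringOfSetsType mu).
move=> t vMt /vMt /slice_RintegralE vMt'.
apply: le_trans (pairing_le cv cphi B0 (fun x => h x t)) _.
exact: ler_wpM2l.
Qed.

Lemma pairing_time_integrable phi : continuous phi ->
  mu.-integrable `]0, T[ (EFin \o pairing v phi).
Proof.
move=> cphi; have [B B0 hB] := continuous_bounded01 cphi.
have [|//] := ae_bounded T_gt0 (measurable_pairing mv cphi) (pairing_ae_le cphi B0 _).
move=> x t /andP[x0 x1]; rewrite normrM mulrC; apply: ler_wpM2r => //.
by apply: hB; rewrite (ltW x0) (ltW x1).
Qed.

(** [laplace_volterra] for the pairings of [v] with [phi] and [phi''], with the dependence on [phi]
    made explicit through its sup bounds [B] and [B2]: later [phi] varies with [s]. *)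
Lemma laplace_pairing phi (s B B2 : R) : test_function phi -> 0 < s ->
  0 <= B -> (forall x, 0 < x < 1 -> `|phi x| <= B) ->
  0 <= B2 -> (forall x, 0 < x < 1 -> `|derive1 (derive1 phi) x| <= B2) ->
  `|\int[mu]_(t in `]0, T[) (expR (- (s * t)) *
       pairing v (fun x => derive1 (derive1 phi) x - s `^ alpha * phi x) t) +
    s `^ alpha * (pairing v phi 0 * \int[mu]_(t in `]0, T[) expR (- (s * t)))| <=
  expR (- (s * T)) * (T * (B2 * M) + s `^ alpha * (T * (B * (M + M0)))).
Proof.
move=> tphi s0 B0 hB B20 hB2.
have sphi := test_function_smooth tphi.
have cphi := smooth_continuous sphi.
have cphi2 := smooth_continuous (smooth_derive1 (smooth_derive1 sphi)).
have i0 := pairing_time_integrable cphi.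
have i2 := pairing_time_integrable cphi2.
have m0 := measurable_pairing mv cphi.
have m2 := measurable_pairing mv cphi2.
have mT : measurable (`]0, T[%classic : set R) by exact: measurable_itv.
have le0 (f : R -> R) (C : R) : (forall x, 0 < x < 1 -> `|f x| <= C) ->
    forall x t, 0 < x < 1 -> `|v x t * f x| <= C * `|v x t|.
  by move=> h x t x01; rewrite normrM mulrC; apply: ler_wpM2r => //; exact: h.
have M00 : `|pairing v phi 0| <= B * M0.
  by apply: (pairing_le cv cphi B0) => x; exact: le0.
have [_ b2] := ae_bounded T_gt0 m2 (pairing_ae_le cphi2 B20 (le0 _ _ hB2)).
have [i00 b0] : mu.-integrable `]0, T[ (EFin \o (fun t => pairing v phi t - pairing v phi 0)) /\
    \int[mu]_(t in `]0, T[) `|pairing v phi t - pairing v phi 0| <= T * (B * (M + M0)).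
  apply: ae_bounded => //; first by apply: measurable_funB => //; exact: measurable_cst.
  apply: filterS (pairing_ae_le cphi B0 (le0 _ _ hB)); first exact: (ae_filter_ringOfSetsType mu).
  move=> t h /h {}h; rewrite mulrDr; apply: le_trans (ler_normB _ _) _.
  exact: lerD.
have := @laplace_volterra _ alpha T s (pairing v phi) (pairing v (derive1 (derive1 phi)))
  (pairing v phi 0) alpha_gt0 alpha_lt1 T_gt0 s0 m0 m2 i0 i2 (fun r => v_volterra tphi).
set E := \int[mu]_(t in _) expR (- (s * t)).
have iexp g := @expRN_integrable _ T s g (ltW s0).
move=> h; apply: le_trans (_ : expR (- (s * T)) * (\int[mu]_(t in `]0, T[)
    `|pairing v (derive1 (derive1 phi)) t| + s `^ alpha *
    \int[mu]_(t in `]0, T[) `|pairing v phi t - pairing v phi 0|) <= _); last first.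
  apply: ler_wpM2l; rewrite ?expR_ge0//; apply: lerD => //.
  by apply: ler_wpM2l => //; exact: powR_ge0.
move: h; congr (`|_| <= _).
have ie : mu.-integrable `]0, T[ (EFin \o (fun t => expR (- (s * t)))).
  have : mu.-integrable `]0, T[ (EFin \o (fun t => expR (- (s * t)) * cst 1 t)).
    apply: iexp; have [] // := @ae_bounded _ T 1 (cst 1) T_gt0 (measurable_cst _).
    by apply: aeW => t _ /=; rewrite normr1.
  by apply: eq_integrable => // t _; rewrite /= mulr1.
have -> : \int[mu]_(t in `]0, T[) (expR (- (s * t)) * (pairing v phi t - pairing v phi 0)) =
  \int[mu]_(t in `]0, T[) (expR (- (s * t)) * pairing v phi t) - pairing v phi 0 * E.
  rewrite -RintegralZl// -RintegralB//; first by apply: eq_Rintegral => t _; ring.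
  - exact: iexp.
  - exact: RintegrableZl.
have -> : \int[mu]_(t in `]0, T[) (expR (- (s * t)) *
       pairing v (fun x => derive1 (derive1 phi) x - s `^ alpha * phi x) t) =
    \int[mu]_(t in `]0, T[) (expR (- (s * t)) * pairing v (derive1 (derive1 phi)) t) -
    s `^ alpha * \int[mu]_(t in `]0, T[) (expR (- (s * t)) * pairing v phi t).
  rewrite -RintegralZl//; last exact: iexp.
  rewrite -RintegralB//; [|exact: iexp|by apply: RintegrableZl => //; exact: iexp].
  apply: eq_Rintegral => t _; rewrite {1}/pairing.
  transitivity (expR (- (s * t)) * (pairing v (derive1 (derive1 phi)) t -
    s `^ alpha * pairing v phi t)); last by ring.
  congr (_ * _); rewrite {2}/pairing -RintegralZl//; last exact: pairing_integrable.
  rewrite -RintegralB//.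
  - by apply: eq_Rintegral => x _; ring.
  - exact: pairing_integrable.
  - by apply: RintegrableZl => //; exact: pairing_integrable.
by rewrite mulrBr opprB [X in _ + X = _]addrC addrA.
Qed.

Variables (a b : R).
Hypotheses (a_ge0 : 0 <= a) (a_lt_b : a < b) (b_le1 : b <= 1).
Hypothesis v0 : forall x t, a < x < b -> v x t = 0.

Let M_ge0 : 0 <= M.
Proof.
have [t /[swap]] := ae_itv_exists T_gt0 vM.
move=> /[apply]; rewrite -lee_fin; apply: le_trans.
by apply: integral_ge0 => x _; rewrite lee_fin.
Qed.

Let M0_ge0 : 0 <= M0. Proof. by apply: Rintegral_ge0. Qed.

(** [s] times the integral is [1 - e^(-sT)], and [e^(-sT) <= 1 / (1 + sT)]. This lower bound allows
    division by the factor of the initial value at a polynomial cost. *)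
Lemma expRN_mass (s : R) : 0 < s ->
  T <= (1 + s * T) * \int[mu]_(t in `]0, T[) expR (- (s * t)).
Proof.
move=> s0; have E : s * \int[mu]_(t in `]0, T[) expR (- (s * t)) = 1 - expR (- (s * T)).
  rewrite -RintegralZl//; first by rewrite /Rintegral integral_expRN_itv ?(ltW T_gt0)//= mulr0 oppr0 expR0.
  have [] // := @ae_bounded _ T 1 (fun t => expR (- (s * t))) T_gt0.
    exact: measurable_expRN.
  apply: aeW => t /andP[t0 _]; rewrite ger0_norm ?expR_ge0// -expR0 ler_expR oppr_le0.
  by rewrite mulr_ge0// ltW.
rewrite -(ler_pM2l s0) mulrCA E.
have sT : 0 < 1 + s * T by rewrite ltr_pwDl// mulr_ge0// ltW.
have : expR (- (s * T)) <= (1 + s * T)^-1.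
  by rewrite expRN lef_pV2 ?posrE ?expR_gt0// expR_ge1Dx.
move=> h; have : (1 + s * T) * expR (- (s * T)) <= 1 by rewrite mulrC -ler_pdivlMr// mul1r.
by move=> {}h; lra.
Qed.

(** The Laplace parameter for which [l = s^(alpha/2)] is the integer [n], as [phragmen] in the
    variable [x] requires. *)
Let s_ n : R := n%:R `^ (2 / alpha).

Let s_alpha (n : nat) : (s_ n) `^ alpha = n%:R ^+ 2.
Proof. by rewrite /s_ -powRrM mulfVK ?gt_eqF// powR_mulrn. Qed.

Let s_gt0 n : (0 < n)%N -> 0 < s_ n.
Proof. by move=> n0; rewrite powR_gt0// ltr0n. Qed.

Let s_ge n : (0 < n)%N -> n%:R ^+ 2 <= s_ n.
Proof.
move=> n0; rewrite /s_ -powR_mulrn//; apply: ler_powR; first by rewrite ler1n.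
by rewrite ler_pdivlMr//; apply: ler_piMr => //; exact: ltW.
Qed.

(* [phi = theta * expR (- l * x)] is nearly in the kernel of [D^2 - l^2]: the
   defect lives where [theta] varies, hence where [v] vanishes or [x >= X]. *)
Lemma initial_growth theta X : 0 < X <= 1 -> test_function theta ->
  (forall x t, 0 < x < X -> v x t != 0 -> derive1 theta x = 0 /\ derive1 (derive1 theta) x = 0) ->
  subexp (fun n => \int[mu]_(x in `]0, 1[) (expR (n%:R * (X - x)) * (v x 0 * theta x))).
Proof.
move=> /andP[X0 X1] tt dtheta; have st := test_function_smooth tt.
have st1 := smooth_derive1 st; have st2 := smooth_derive1 st1.
have [K0 K00 hK0] := continuous_bounded01 (smooth_continuous st).
have [K1 K10 hK1] := continuous_bounded01 (smooth_continuous st1).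
have [K2 K20 hK2] := continuous_bounded01 (smooth_continuous st2).
(* [1 / (4T)] is the maximum of [l - T l^2]. As [s >= l^2] and [X <= 1], [Q] bounds
   [expR (l X - s T)]. *)
pose Q := expR (4 * T)^-1.
(* [expR (- l x) * G n] bounds the defect [phi'' - l^2 phi], and [T * H n] is the constant of
   [laplace_pairing]. *)
pose G n : R := K2 + 2 * n%:R * K1.
pose H n : R := (G n + n%:R ^+ 2 * K0) * M + n%:R ^+ 2 * (K0 * (M + M0)).
apply: (@subexp_le _ _ (fun n => (1 + s_ n * T) * (G n * M + Q * H n))); last first.
  have sn : @subexp R (fun n => n%:R ^+ 2) by apply: subexpX; exact: subexp_nat.
  have sc := @subexp_cst R.
  have sG : subexp G.
    by apply: subexpD => //; apply: subexpM => //; apply: subexpM => //; exact: subexp_nat.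
  apply: subexpM.
    apply: subexpD => //; apply: subexpM => //; apply: subexp_powR.
    by rewrite divr_ge0// ltW.
  apply: subexpD; first exact: subexpM.
  apply: subexpM => //; apply: subexpD; apply: subexpM => //.
  by apply: subexpD => //; apply: subexpM.
move=> n n0; pose l : R := n%:R.
have l0 : 0 <= l by [].
have l1 : 1 <= l by rewrite ler1n.
pose phi x := theta x * expR (- l * x).
have e1 x : 0 < x < 1 -> expR (- l * x) <= 1.
  by move=> /andP[x0 _]; rewrite -expR0 ler_expR mulNr oppr_le0 mulr_ge0// ltW.
have K01 (x : R) : 0 < x < 1 -> 0 <= x <= 1 by move=> /andP[/ltW -> /ltW ->].
have tphi : test_function phi.
  have [_ [c [d [c0 d1 h]]]] := tt.
  apply: (@test_functionP _ _ c d) => //.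
  - by apply: smoothM => //; exact: smooth_expRM.
  - by move=> x xc; rewrite /phi h ?mul0r// in_itv/= leNgt xc.
  - by move=> x dx; rewrite /phi h ?mul0r// in_itv/= [x <= d]leNgt dx andbF.
have phiB x : 0 < x < 1 -> `|phi x| <= K0.
  move=> x01; rewrite normrM (ger0_norm (expR_ge0 _)).
  by apply: (le_trans _ (hK0 _ (K01 _ x01))); rewrite ler_piMr// e1.
pose g x := expR (- l * x) * (derive1 (derive1 theta) x - 2 * l * derive1 theta x).
have E x : derive1 (derive1 phi) x = g x + l ^+ 2 * phi x.
  have := congr1 (fun f => f x) (helmholtz_expR l st).
  by move=> /= h; rewrite /g -h subrK.
have gB x : 0 < x < 1 -> `|g x| <= expR (- l * x) * G n.
  move=> x01; rewrite normrM (ger0_norm (expR_ge0 _)) ler_pM2l ?expR_gt0//.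
  apply: le_trans (ler_normB _ _) _; apply: lerD; first by apply: hK2; exact: K01.
  rewrite normrM ger0_norm ?mulr_ge0//; apply: ler_wpM2l; rewrite ?mulr_ge0//.
  by apply: hK1; exact: K01.
have G0 : 0 <= G n by rewrite addr_ge0 ?mulr_ge0.
have phi2B x : 0 < x < 1 -> `|derive1 (derive1 phi) x| <= G n + n%:R ^+ 2 * K0.
  move=> x01; rewrite E; apply: le_trans (ler_normD _ _) _; apply: lerD.
    by apply: le_trans (gB _ x01) _; rewrite ler_piMl// e1.
  by rewrite normrM ger0_norm ?exprn_ge0//; apply: ler_wpM2l; rewrite ?exprn_ge0// phiB.
have B20 : 0 <= G n + n%:R ^+ 2 * K0 by rewrite addr_ge0 ?mulr_ge0 ?exprn_ge0.
have s0 := s_gt0 n0.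
have := laplace_pairing tphi s0 K00 phiB B20 phi2B.
rewrite s_alpha.
have cg : continuous g.
  apply: smooth_continuous; apply: smoothM; first exact: smooth_expRM.
  by under eq_fun do rewrite -mulNr; apply: smoothD => //; exact: smoothZ.
have -> : (fun x => derive1 (derive1 phi) x - n%:R ^+ 2 * phi x) = g.
  by apply/funext => x; rewrite E addrK.
have vg x t : 0 < x < 1 -> `|v x t * g x| <= expR (- l * X) * G n * `|v x t|.
  move=> x01; have [->|vx] := eqVneq (v x t) 0; first by rewrite mul0r !normr0 mulr0.
  rewrite normrM mulrC; apply: ler_wpM2r => //.
  have /andP[x0 _] := x01.
  have [xX|Xx] := ltP x X; last first.
    apply: le_trans (gB _ x01) _; apply: ler_wpM2r => //.
    by rewrite ler_expR !mulNr lerN2; exact: ler_wpM2l.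
  have [|d1 d2] := dtheta x t _ vx; first by rewrite x0.
  by rewrite /g d1 d2 mulr0 subrr mulr0 normr0 mulr_ge0 ?expR_ge0.
set I := \int[mu]_(t in _) (_ * _).
have IB : `|I| <= T * (expR (- l * X) * G n * M).
  have [||i1 b1] := @ae_bounded R T (expR (- l * X) * G n * M)
      (fun t => expR (- (s_ n * t)) * pairing v g t) T_gt0.
  - apply: measurable_funM; first exact: measurable_expRN.
    exact: measurable_pairing.
  - have G'0 : 0 <= expR (- l * X) * G n by rewrite mulr_ge0 ?expR_ge0.
    apply: filterS (pairing_ae_le cg G'0 vg); first exact: (ae_filter_ringOfSetsType mu).
    move=> t h t0T; have /andP[t0 _] := t0T; apply: (le_trans _ (h t0T)).
    rewrite normrM ger0_norm ?expR_ge0//; apply: ler_piMl => //.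
    by rewrite -expR0 ler_expR oppr_le0 mulr_ge0// ltW.
  by apply: (le_trans _ b1); apply: le_normr_Rintegral.
move=> L; have := expRN_mass s0; move: L.
set EE := \int[mu]_(t in _) _; move=> L mass.
have -> : \int[mu]_(x in `]0, 1[) (expR (l * (X - x)) * (v x 0 * theta x)) =
    expR (l * X) * pairing v phi 0.
  rewrite -RintegralZl//; last first.
    by apply: pairing_integrable => //; exact/smooth_continuous/test_function_smooth.
  by apply: eq_Rintegral => x _; rewrite mulrBr expRD /phi mulNr; ring.
rewrite normrM (ger0_norm (expR_ge0 _)).
set y := pairing v phi 0 in L *.
have EE0 : 0 <= EE by apply: Rintegral_ge0 => t _; exact: expR_ge0.
have sT0 : 0 <= s_ n * T by rewrite mulr_ge0// ltW.
have b1 : l ^+ 2 * (`|y| * EE) <= T * (expR (- l * X) * G n * M) +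
    expR (- (s_ n * T)) * (T * H n).
  have -> : l ^+ 2 * (`|y| * EE) = `|l ^+ 2 * (y * EE)|.
    by rewrite (normrM (l ^+ 2)) (normrM y) (ger0_norm EE0) (ger0_norm (exprn_ge0 2 l0)).
  have -> : l ^+ 2 * (y * EE) = (I + l ^+ 2 * (y * EE)) - I by ring.
  apply: le_trans (ler_normB _ _) _; rewrite addrC; apply: lerD => //.
  apply: le_trans L _; rewrite le_eqVlt; apply/orP; left; apply/eqP; congr (_ * _).
  by rewrite /H; ring.
rewrite -(ler_pM2l T_gt0).
(* Division by the integral of [expR (- (s t))] through [expRN_mass]; the extra factor [l^2 >= 1] is
   inserted to match [b1]. *)
have b2 : T * (expR (l * X) * `|y|) <= (1 + s_ n * T) * (expR (l * X) * (l ^+ 2 * (`|y| * EE))).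
  apply: le_trans (ler_wpM2r _ mass) _; first by rewrite mulr_ge0 ?expR_ge0.
  rewrite -mulrA; apply: ler_wpM2l; first by rewrite addr_ge0.
  rewrite mulrCA; apply: ler_wpM2l; rewrite ?expR_ge0// [EE * _]mulrC.
  by rewrite ler_peMl ?mulr_ge0// exprn_ege1.
apply: le_trans b2 _; rewrite [leRHS]mulrCA; apply: ler_wpM2l; first by rewrite addr_ge0.
apply: le_trans (ler_wpM2l (expR_ge0 _) b1) _.
rewrite (mulrDr (expR _)) (mulrDr T (G n * M)); apply: lerD.
  rewrite le_eqVlt; apply/orP; left; apply/eqP.
  transitivity (expR (l * X) * expR (- l * X) * (T * (G n * M))); first by ring.
  by rewrite -expRD mulNr subrr expR0 mul1r.
have -> : expR (l * X) * (expR (- (s_ n * T)) * (T * H n)) =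
    expR (l * X - s_ n * T) * (T * H n) by rewrite expRD mulrA.
rewrite [leRHS]mulrCA; apply: ler_wpM2r.
  rewrite mulr_ge0 ?(ltW T_gt0)// /H addr_ge0// !mulr_ge0// ?exprn_ge0//.
  by rewrite addr_ge0.
rewrite ler_expR; have sl := s_ge n0.
have h1 : l * X <= l by rewrite ler_piMr.
have h2 : l ^+ 2 * T <= s_ n * T by rewrite ler_wpM2r// ltW.
have h3 : 0 <= T * (l - (2 * T)^-1) ^+ 2 by rewrite mulr_ge0 ?sqr_ge0 ?ltW.
have h4 : T * (l - (2 * T)^-1) ^+ 2 = l ^+ 2 * T - l + (4 * T)^-1.
  by field; rewrite gt_eqF.
by rewrite h4 in h3; lra.
Qed.

Lemma initial_zero x : a < x < 1 -> v x 0 = 0.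
Proof.
move=> /andP[ax x1]; have [xb|bx] := ltP x b; first by apply: v0; rewrite ax.
(* [theta] rises on the middle third of []a, b[], where [v] vanishes, and descends between [X] and
   [X']. The point [x] lies below [X], inside the plateau once [b <= x]. *)
pose p := (2 * a + b) / 3; pose q := (a + 2 * b) / 3.
pose X := (x + 1) / 2; pose X' := (X + 1) / 2.
have ab := a_lt_b; have a0 := a_ge0; have b1 := b_le1.
have pq : p < q by rewrite /p /q; lra.
have XX' : X < X' by rewrite /X' /X; lra.
have [theta [st t0 t1 t2]] := plateau pq XX'.
have tt : test_function theta.
  apply: (@test_functionP _ _ p X') => //; rewrite /p /X' /X.
  - lra.
  - lra.
  - by move=> y yp; apply: t0; apply: ltW.
  - by move=> y yp; apply: t2; apply: ltW.
have X0 : 0 < X <= 1 by rewrite /X; apply/andP; split; lra.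
have growth : subexp (fun n => \int[mu]_(x in `]0, 1[) (expR (n%:R * (X - x)) * (v x 0 * theta x))).
  apply: initial_growth => // y t /andP[y0 yX] vy.
  have [yp|py] := ltP y p.
    have H z : -1 < z < p -> theta z = 0 by move=> /andP[_ zp]; apply: t0; exact: ltW.
    have Hy : -1 < y < p by rewrite yp andbT; lra.
    by split; [exact: derive1_cst_itv H _ Hy|exact: derive2_cst_itv H _ Hy].
  have qy : q < y.
    rewrite ltNge; apply/negP => yq; move: vy; rewrite v0 ?eqxx//.
    by move: py yq; rewrite /p /q => ? ?; apply/andP; split; lra.
  have H z : q < z < X -> theta z = 1 by move=> /andP[? ?]; apply: t1; rewrite !ltW.
  have Hy : q < y < X by rewrite qy.
  by split; [exact: derive1_cst_itv H _ Hy|exact: derive2_cst_itv H _ Hy].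
have int : mu.-integrable `]0, 1[ (EFin \o (fun x => v x 0 * theta x)).
  by apply: pairing_integrable => //; exact/smooth_continuous.
have D0 (y : R) : `]0, 1[%classic y -> 0 <= y by rewrite /= in_itv/= => /andP[/ltW].
have ph := phragmen (measurable_itv _) D0 int growth.
have qX : q < X by rewrite /X /q; lra.
apply: (@continuous_ae_eq0 _ (v^~ 0) q X) => //; first exact: cv.
  by rewrite /X /q; apply/andP; split; lra.
apply: filterS ph; first exact: (ae_filter_ringOfSetsType mu).
move=> y + /andP[qy yX]; rewrite /= in_itv/= => h.
have := t1 y; rewrite (ltW qy) (ltW yX) => /(_ isT) ty.
move: h; rewrite ty mulr1; apply => //.
by move: qy yX; rewrite /X /q => qy yX; apply/andP; split; lra.
Qed.

(* With [phi'' - l^2 phi = bump p q] outside the region where [v] vanishes, the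
   cost [expR l] of [phi] is subexponential in [s = n], since
   [l = s^(alpha / 2)]. *)
Lemma bump_zero p q : b < p -> p < q -> q < 1 ->
  {ae mu, forall t, 0 < t < T -> pairing v (bump p q) t = 0}.
Proof.
move=> bp pq q1; have ab := a_lt_b; have a0 := a_ge0.
pose psi := bump p q.
have spsi : smooth psi by exact: smooth_bump.
have [N N0 hN] := continuous_bounded01 (smooth_continuous spsi).
have psi0 x : x <= p -> psi x = 0 by move=> xp; rewrite /psi bump_eq0// negb_and -leNgt xp.
have psi1 x : q <= x -> psi x = 0 by move=> qx; rewrite /psi bump_eq0// negb_and -!leNgt qx orbT.
pose p1 := (2 * a + b) / 3; pose q2 := (a + 2 * b) / 3.
have pq1 : p1 < q2 by rewrite /p1 /q2; lra.
have [chi [sc c0 c1]] := smooth_step pq1.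
have sc1 := smooth_derive1 sc; have sc2 := smooth_derive1 sc1.
have [K0 K00 hK0] := continuous_bounded01 (smooth_continuous sc).
have [K1 K10 hK1] := continuous_bounded01 (smooth_continuous sc1).
have [K2 K20 hK2] := continuous_bounded01 (smooth_continuous sc2).
have cpsi := smooth_continuous spsi.
(* Here the Laplace parameter is [s = n] itself, as [phragmen] is applied in time. [B] and [B2]
   below bound [chi * f] and its second derivative by the Leibniz rule, [f] and [f'] being at most
   [N * expR l]. *)
pose l_ (n : nat) : R := n%:R `^ (alpha / 2).
pose B n := K0 * (N * expR (l_ n)).
pose B2 n := K2 * (N * expR (l_ n)) + 2 * (K1 * (N * expR (l_ n))) +
  K0 * (l_ n ^+ 2 * (N * expR (l_ n)) + N).
have growth : subexp (fun n => \int[mu]_(t in `]0, T[) (expR (n%:R * (T - t)) * pairing v psi t)).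
  apply: (@subexp_le _ _ (fun n => T * (B2 n * M) + l_ n ^+ 2 * (T * (B n * (M + M0))))).
    move=> n n0; have l1 : 1 <= l_ n.
      by rewrite -[1](powRr0 n%:R) ler_powR ?ler1n// divr_ge0// ltW.
    have l0 : 0 <= l_ n by exact: le_trans l1.
    have p0 : 0 <= p by apply: ltW; lra.
    have [f [sf f1 f2 f3 f4]] := helmholtz l1 p0 pq (ltW q1) spsi psi0 psi1 hN.
    have sf1 := smooth_derive1 sf.
    pose phi x := chi x * f x.
    have tphi : test_function phi.
      apply: (@test_functionP _ _ p1 q) => //; rewrite /p1.
      - exact: smoothM.
      - lra.
      - by move=> x xp; rewrite /phi c0 ?mul0r// /p1 ltW.
      - by move=> x qx; rewrite /phi f1 ?mulr0// ltW.
    have n0' : 0 < n%:R :> R by rewrite ltr0n.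
    have K01 (x : R) : 0 < x < 1 -> 0 <= x <= 1 by move=> /andP[/ltW -> /ltW ->].
    have le0 (g h : R -> R) (C D x : R) : 0 <= C -> (forall x, 0 <= x <= 1 -> `|g x| <= C) ->
        (forall x, 0 <= x <= 1 -> `|h x| <= D) -> 0 < x < 1 -> `|g x * h x| <= C * D.
      by move=> C0 gC hD /K01 x01; rewrite normrM; apply: ler_pM => //; [exact: gC|exact: hD].
    have phiB x : 0 < x < 1 -> `|phi x| <= B n by exact: le0.
    have phi2E x : derive1 (derive1 phi) x = derive1 (derive1 chi) x * f x +
        2 * (derive1 chi x * derive1 f x) + chi x * (l_ n ^+ 2 * f x + psi x).
      by rewrite -f2 /phi smooth_derive2M.
    have phi2B x : 0 < x < 1 -> `|derive1 (derive1 phi) x| <= B2 n.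
      move=> x01; rewrite phi2E; apply: le_trans (ler_normD _ _) _; apply: lerD.
        apply: le_trans (ler_normD _ _) _; apply: lerD; first exact: le0.
        by rewrite normrM ger0_norm//; apply: ler_wpM2l => //; exact: le0.
      apply: (le0 chi (fun x => l_ n ^+ 2 * f x + psi x)) => // z z01.
      apply: le_trans (ler_normD _ _) _; apply: lerD; last exact: hN.
      rewrite normrM ger0_norm ?exprn_ge0//; apply: ler_wpM2l; rewrite ?exprn_ge0//.
      exact: f3.
    have Ne0 : 0 <= N * expR (l_ n) by rewrite mulr_ge0 ?expR_ge0.
    have B0 : 0 <= B n by rewrite mulr_ge0.
    have B20 : 0 <= B2 n by rewrite !addr_ge0 ?mulr_ge0 ?addr_ge0 ?mulr_ge0 ?exprn_ge0.
    have := laplace_pairing tphi n0' B0 phiB B20 phi2B.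
    have -> : n%:R `^ alpha = l_ n ^+ 2.
      by rewrite /l_ -powR_mulrn ?powR_ge0// -powRrM divfK.
    (* [chi] vanishes up to [p1 > a], and the initial value vanishes beyond [a] by
       [initial_zero]. *)
    have -> : pairing v phi 0 = 0.
      transitivity (\int[mu]_(x in `]0, 1[) (0 : R)); last by rewrite /Rintegral integral0.
      apply: eq_Rintegral => x.
      rewrite inE/= in_itv/= => /andP[x0 x1].
      have [xp|px] := leP x p1; first by rewrite /phi c0// mul0r mulr0.
      rewrite initial_zero ?mul0r//.
      by rewrite x1 andbT; move: px; rewrite /p1 => px; lra.
    rewrite mul0r mulr0 addr0.
    (* Up to [p1] both [chi] and [psi] vanish, between [p1] and [q2] the function [v] does, and
       beyond [q2] the cut-off is 1, so that [phi] solves the equation for [f]. *)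
    have vpsi t : pairing v (fun x => derive1 (derive1 phi) x - l_ n ^+ 2 * phi x) t = pairing v psi t.
      apply: eq_Rintegral => x; rewrite inE/= in_itv/= => /andP[x0 x1].
      have [xp|px] := ltP x p1.
        have H z : -1 < z < p1 -> chi z = 0 by move=> /andP[_ zp]; apply: c0; exact: ltW.
        have Hy : -1 < x < p1 by rewrite xp andbT; lra.
        rewrite phi2E /phi (derive1_cst_itv H Hy) (derive2_cst_itv H Hy) (H _ Hy).
        rewrite psi0; first by congr (_ * _); ring.
        by move: xp; rewrite /p1 => xp; apply: ltW; lra.
      have [xq|qx] := leP x q2.
        by rewrite v0 ?mul0r//; move: px xq; rewrite /p1 /q2 => px xq; apply/andP; split; lra.
      have H z : q2 < z < x + 1 -> chi z = 1 by move=> /andP[zp _]; apply: c1; exact: ltW.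
      have Hy : q2 < x < x + 1 by rewrite qx/= ltrDl.
      rewrite phi2E /phi (derive1_cst_itv H Hy) (derive2_cst_itv H Hy) (H _ Hy).
      by congr (_ * _); ring.
    have -> : \int[mu]_(t in `]0, T[) (expR (n%:R * (T - t)) * pairing v psi t) =
      expR (n%:R * T) * \int[mu]_(t in `]0, T[) (expR (- (n%:R * t)) *
       pairing v (fun x => derive1 (derive1 phi) x - l_ n ^+ 2 * phi x) t).
      under [in RHS]eq_Rintegral do rewrite vpsi.
      rewrite -RintegralZl//; last first.
        apply: expRN_integrable; first exact: ltW.
        exact: pairing_time_integrable.
      by apply: eq_Rintegral => t _; rewrite mulrA -expRD mulrBr.
    rewrite normrM (ger0_norm (expR_ge0 _)) => h.
    apply: le_trans (ler_wpM2l (expR_ge0 _) h) _.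
    by rewrite [leLHS]mulrA -expRD subrr expR0 mul1r.
  have sc' := @subexp_cst R.
  have a20 : 0 <= alpha / 2 by rewrite divr_ge0// ltW.
  have sl : subexp l_ by exact: subexp_powR.
  have sl2 : subexp (fun n => l_ n ^+ 2) by exact: subexpX.
  have se : subexp (fun n => N * expR (l_ n)).
    by apply: subexpM => //; apply: subexp_expR_powR; have := alpha_lt1; lra.
  have sB : subexp B by exact: subexpM.
  have sB2 : subexp B2.
    apply: subexpD; first by apply: subexpD; apply: subexpM => //; exact: subexpM.
    by apply: subexpM => //; apply: subexpD => //; exact: subexpM.
  apply: subexpD; apply: subexpM => //; first exact: subexpM.
  by apply: subexpM => //; exact: subexpM.
have D0 (t : R) : `]0, T[%classic t -> 0 <= t by rewrite /= in_itv/= => /andP[/ltW].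
have := phragmen (measurable_itv _) D0 (pairing_time_integrable cpsi) growth.
apply: filterS; first exact: (ae_filter_ringOfSetsType mu).
by move=> t h /andP[t0 tT]; apply: h => //=; rewrite in_itv/= t0.
Qed.

(** Bumps with rational endpoints are countably many, so one null set of times serves them all. If
    [v x t] were non-zero, [v] would keep its sign near [x], and a bump supported there would have a
    non-zero pairing with it; multiplying by [v x t] reduces this to the positive case. *)
Lemma right_zero : {ae mu, forall t, 0 < t < T -> forall x, b < x < 1 -> v x t = 0}.
Proof.
pose P (n : nat) (t : R) := if @unpickle (rat * rat)%type n is Some pq then
  b < ratr pq.1 -> ratr pq.1 < ratr pq.2 :> R -> ratr pq.2 < 1 :> R -> 0 < t < T ->
  pairing v (bump (ratr pq.1) (ratr pq.2)) t = 0 else True.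
have : {ae mu, forall t, forall n, P n t}.
  apply/ae_foralln => n; rewrite /P; case: unpickle => [[p q]/=|]; last exact: aeW.
  have [bp|bp] := ltP b (ratr p); last by apply: aeW => t.
  have [pq|pq] := ltP (ratr p : R) (ratr q); last by apply: aeW => t.
  have [q1|q1] := ltP (ratr q : R) 1; last by apply: aeW => t.
  have := bump_zero bp pq q1; apply: filterS; first exact: (ae_filter_ringOfSetsType mu).
  by move=> t h _ _ _; exact: h.
apply: filterS; first exact: (ae_filter_ringOfSetsType mu).
move=> t Pt t0T x /andP[bx x1]; apply/eqP; apply: contrapT => /negP vx.
pose f y := v y t * v x t.
have cf : continuous f by move=> y; apply: cvgM; [exact: cv|exact: cvg_cst].
have fx : 0 < f x by rewrite /f -expr2 exprn_even_gt0.
have : \forall y \near x, 0 < f y by exact: (cf x _ (lt_nbhsr fx)).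
move=> /nbhs_ballP[e /= e0 xe].
have l1 : Num.max b (x - e) < x by rewrite gt_max bx/=; lra.
have l2 : x < Num.min 1 (x + e) by rewrite lt_min x1/=; lra.
have [p] := rat_in_itvoo l1; rewrite in_itv/= gt_max => /andP[/andP[bp xep] px].
have [q] := rat_in_itvoo l2; rewrite in_itv/= lt_min => /andP[xq /andP[q1 qxe]].
have pq : ratr p < ratr q :> R by exact: lt_trans px xq.
have := Pt (pickle (p, q)); rewrite /P pickleK => /(_ bp pq q1 t0T) /= h.
pose psi := bump (ratr p) (ratr q) : R -> R.
have cpsi : continuous psi by exact/smooth_continuous/smooth_bump.
have ih := pairing_integrable cv cpsi t.
have ifp : mu.-integrable `]0, 1[ (EFin \o (fun y => f y * psi y)).
  have := @RintegrableZl _ _ _ mu _ _ (v x t) _ ih.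
  move=> /(_ (measurable_itv _)); apply: eq_integrable => // y _ /=.
  by rewrite /f; congr (_%:E); ring.
have fpsi0 y : x - e < y < x + e -> 0 < f y.
  by move=> /andP[y1 y2]; apply: xe; rewrite /ball/= ltr_norml; apply/andP; split; lra.
have fpsi_ge0 y : 0 <= f y * psi y.
  have [ypq|ypq] := boolP (ratr p < y < ratr q); last by rewrite /psi bump_eq0 ?mulr0.
  rewrite mulr_ge0 ?bump_ge0// ltW// fpsi0//.
  by move: ypq => /andP[y1 y2]; rewrite (lt_trans xep y1) (lt_trans y2 qxe).
have i0 : (\int[mu]_(y in `]0%R, 1%R[) `|(f y * psi y)%:E| = 0)%E.
  under eq_integral do rewrite gee0_abs ?lee_fin//.
  rewrite -(fineK (integrable_fin_num _ ifp))//; congr (_%:E).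
  rewrite -[LHS]/(\int[mu]_(y in `]0, 1[) (f y * psi y)).
  transitivity (\int[mu]_(y in `]0, 1[) (v x t * (v y t * psi y))).
    by apply: eq_Rintegral => y _; rewrite /f; ring.
  by rewrite RintegralZl// -[X in _ * X]/(pairing v psi t) h mulr0.
have mfp : measurable_fun (`]0, 1[%classic : set R) (fun y => (f y * psi y)%:E).
  by have [] := integrableP _ _ _ ifp.
have m1 : measurable (`]0, 1[%classic : set R) by exact: measurable_itv.
have /(ae_eq_integral_abs mu m1 mfp) fpsi := i0.
have [y ypq] := ae_itv_exists pq fpsi.
have /andP[py yq] := ypq.
have y01 : `]0, 1[%classic y.
  rewrite /= in_itv/= (lt_trans yq q1) andbT.
  by apply: lt_trans py; apply: le_lt_trans bp; apply: ltW; exact: le_lt_trans a_ge0 a_lt_b.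
move=> /(_ y01) [] /eqP; rewrite gt_eqF// mulr_gt0 ?bump_gt0// fpsi0//.
by rewrite (lt_trans xep py) (lt_trans yq qxe).
Qed.

End right_zero.

(** * Reflection and vanishing to the left of the interval *)

Section reflect.
Context {R : realType}.
Local Notation mu := (@lebesgue_measure R).

Implicit Types f : R -> R.

Let reflect_itv01 : [set x : R | `]0, 1[%classic (1 - x)] = `]0, 1[%classic.
Proof.
apply/funext => x; apply/propext; rewrite /= !in_itv/=.
by split=> /andP[? ?]; apply/andP; split; lra.
Qed.

Lemma Rintegral_reflect01 f : measurable_fun setT f ->
  \int[mu]_(x in `]0, 1[) f (1 - x) = \int[mu]_(x in `]0, 1[) f x.
Proof.
move=> mf; have m1 : measurable (`]0, 1[%classic : set R) by exact: measurable_itv.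
by rewrite [RHS](Rintegral_reflect 1 m1 (measurable_funTS mf)) reflect_itv01.
Qed.

Lemma derive1_reflect f : smooth f ->
  derive1 (fun x => f (-1 * x + 1)) = (fun x => -1 * derive1 f (-1 * x + 1)).
Proof.
move=> sf; apply: derive1_funE => x; apply: is_derive_affine.
exact: smooth_is_derive.
Qed.

Lemma derive2_reflect f : smooth f ->
  derive1 (derive1 (fun x => f (-1 * x + 1))) = (fun x => derive1 (derive1 f) (-1 * x + 1)).
Proof.
move=> sf; rewrite derive1_reflect//; apply: derive1_funE => x.
have sf1 := smooth_derive1 sf.
have h := is_derive_cmul (-1) (is_derive_affine (smooth_is_derive sf1 (-1 * x + 1))).
by apply: (is_derive_eq h); ring.
Qed.

Lemma test_function_reflect f : test_function f -> test_function (fun x => f (-1 * x + 1)).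
Proof.
move=> tf; have [_ [c [d [c0 d1 h]]]] := tf.
apply: (@test_functionP _ _ (1 - d) (1 - c)); [|lra|lra| |].
- by apply: smooth_affine; exact: test_function_smooth.
- by move=> x xd; apply: h; rewrite in_itv/= negb_and -!ltNge; apply/orP; right; lra.
- by move=> x xd; apply: h; rewrite in_itv/= negb_and -!ltNge; apply/orP; left; lra.
Qed.

End reflect.

Section left_zero.
Context {R : realType}.
Local Notation mu := (@lebesgue_measure R).
Variables (alpha T M : R) (v : R -> R -> R) (a b : R).
Hypotheses (alpha_gt0 : 0 < alpha) (alpha_lt1 : alpha < 1) (T_gt0 : 0 < T).
Hypothesis cv : forall t, continuous (v^~ t).
Hypothesis mv : measurable_fun setT (fun z : R * R => v z.1 z.2).
Hypothesis vM : {ae mu, forall t, 0 < t < T ->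
  (\int[mu]_(x in `]0%R, 1%R[) `|v x t|%:E <= M%:E)%E}.
Hypothesis v_volterra : forall phi r, test_function phi -> 0 < r < T ->
  \int[mu]_(t in `]0, r[) pairing v (derive1 (derive1 phi)) t =
  (Gamma (1 - alpha))^-1 *
  \int[mu]_(t in `]0, r[) ((r - t) `^ (- alpha) * (pairing v phi t - pairing v phi 0)).
Hypotheses (a_ge0 : 0 <= a) (a_lt_b : a < b) (b_le1 : b <= 1).
Hypothesis v0 : forall x t, a < x < b -> v x t = 0.

Let v' x t := v (1 - x) t.

Let c1 : continuous (fun x : R => 1 - x).
Proof. by move=> x; apply: cvgB; [exact: cvg_cst|exact: cvg_id]. Qed.

Let cv' t : continuous (v'^~ t).
Proof.
by move=> x; apply: (continuous_comp (f := fun x : R => 1 - x) (g := v^~ t)); [exact: c1|exact: cv].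
Qed.

Let mv' : measurable_fun setT (fun z : R * R => v' z.1 z.2).
Proof.
apply: (measurableT_comp (g := fun z : R * R => (1 - z.1, z.2)) mv).
apply: measurable_fun_pair => //; apply: measurable_funB => //.
Qed.

Let vM' : {ae mu, forall t, 0 < t < T ->
  (\int[mu]_(x in `]0%R, 1%R[) `|v' x t|%:E <= M%:E)%E}.
Proof.
apply: filterS vM; first exact: (ae_filter_ringOfSetsType mu).
move=> t h /h {}h; have iv' := integrable_abse (slice_integrable cv' t).
have -> : (\int[mu]_(x in `]0%R, 1%R[) `|v' x t|%:E =
    (\int[mu]_(x in `]0, 1[) `|v' x t|)%:E)%E.
  by rewrite /Rintegral fineK//; exact: integrable_fin_num.
rewrite lee_fin.
apply: le_trans (slice_RintegralE cv h).
rewrite -(Rintegral_reflect01 (f := fun x => `|v x t|)); last first.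
  by apply: measurableT_comp => //; apply: continuous_measurable_fun; exact: cv.
exact: lexx.
Qed.

Let pairing' phi t : continuous phi ->
  pairing v' phi t = pairing v (fun x => phi (-1 * x + 1)) t.
Proof.
move=> cphi; rewrite /pairing -[LHS]Rintegral_reflect01; last first.
  apply: measurable_funM; first by apply: continuous_measurable_fun; exact: cv'.
  exact: continuous_measurable_fun.
by apply: eq_Rintegral => x _; rewrite /v' opprB addrCA subrr addr0 mulN1r addrC.
Qed.

Let v_volterra' phi r : test_function phi -> 0 < r < T ->
  \int[mu]_(t in `]0, r[) pairing v' (derive1 (derive1 phi)) t =
  (Gamma (1 - alpha))^-1 *
  \int[mu]_(t in `]0, r[) ((r - t) `^ (- alpha) * (pairing v' phi t - pairing v' phi 0)).
Proof.
move=> tphi rT; have sphi := test_function_smooth tphi.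
have cphi := smooth_continuous sphi.
have cphi2 := smooth_continuous (smooth_derive1 (smooth_derive1 sphi)).
have := v_volterra (test_function_reflect tphi) rT.
rewrite (derive2_reflect sphi) => E.
transitivity (\int[mu]_(t in `]0, r[) pairing v (fun x => derive1 (derive1 phi) (-1 * x + 1)) t).
  by apply: eq_Rintegral => t _; exact: pairing'.
rewrite E; congr (_ * _); apply: eq_Rintegral => t _.
by rewrite (pairing' t cphi) (pairing' 0 cphi).
Qed.

Lemma left_zero : {ae mu, forall t, 0 < t < T -> forall x, 0 < x < a -> v x t = 0}.
Proof.
have ab := a_lt_b; have a0 := a_ge0; have b1 := b_le1.
have v0' x t : 1 - b < x < 1 - a -> v' x t = 0.
  by move=> /andP[? ?]; apply: v0; apply/andP; split; lra.
have b'0 : 0 <= 1 - b by lra.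
have ab' : 1 - b < 1 - a by lra.
have a'1 : 1 - a <= 1 by lra.
have := right_zero alpha_gt0 alpha_lt1 T_gt0 cv' mv' vM' v_volterra' b'0 ab' a'1 v0'.
apply: filterS; first exact: (ae_filter_ringOfSetsType mu).
move=> t h /h {}h x /andP[x0 xa]; have := h (1 - x).
by rewrite /v' opprB addrCA subrr addr0; apply; apply/andP; split; lra.
Qed.

(** The points [a] and [b] and the ends of [[0, 1]], not covered by the one-sided results, are
    reached by continuity in [x]. *)
Lemma all_zero : {ae mu, forall t, 0 < t < T -> forall x, 0 <= x <= 1 -> v x t = 0}.
Proof.
have ab := a_lt_b; have a0 := a_ge0; have b1 := b_le1.
have := right_zero alpha_gt0 alpha_lt1 T_gt0 cv mv vM v_volterra a0 ab b1 v0.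
apply: (filterS2 _ _ left_zero); first exact: (ae_filter_ringOfSetsType mu).
move=> t hl hr t0T x x01.
apply: (@continuous_ae_eq0 _ (v^~ t) 0 1) => //; first exact: cv.
have na : {ae mu, forall y, y != a}.
  exists [set a]; split => //; first by rewrite lebesgue_measure_set1.
  by move=> y /= /negP; rewrite negbK => /eqP.
have nb : {ae mu, forall y, y != b}.
  exists [set b]; split => //; first by rewrite lebesgue_measure_set1.
  by move=> y /= /negP; rewrite negbK => /eqP.
apply: (filterS2 _ _ na nb); first exact: (ae_filter_ringOfSetsType mu).
move=> y ya yb /andP[y0 y1].
have [ya'|ay|/eqP] := ltgtP y a; last by rewrite (negPf ya).
  by apply: hl => //; rewrite y0.
have [yb'|by'|/eqP] := ltgtP y b; last by rewrite (negPf yb).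
  by apply: v0; rewrite ay.
by apply: hr => //; rewrite by'.
Qed.

End left_zero.

Theorem theorem1p1 (R : realType) (alpha T : R) (u : R -> R -> R) (a b : R)
  (alpha_gt0 : 0 < alpha) (alpha_lt1 : alpha < 1) (T_gt0 : 0 < T)
  (* u(.,t) is the continuous representative of its class, on all of [0,1] *)
  (u_cont : forall t, t \in `[0, T] ->
     {within `[0, 1], continuous (fun x => u x t)})
  (u_ac : {ae lebesgue_measure, forall x, x \in `]0, 1[ ->
     absolutely_continuous 0 T (u x)})
  (u_H2 : Linfty H2 H2norm T (fun t x => u x t))
  (Du_L2 : Linfty L2 L2norm T (fun t x => caputo alpha (u x) t))
  (u_eq : {ae lebesgue_measure, forall t, t \in `]0, T[ ->
     {ae lebesgue_measure, forall x, x \in `]0, 1[ ->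
       caputo alpha (u x) t - weakD (weakD (fun y => u y t)) x = 0}})
  (a_ge0 : 0 <= a) (a_lt_b : a < b) (b_le1 : b <= 1)
  (u_I : forall x t, x \in `]a, b[ -> t \in `[0, T] -> u x t = 0) :
  forall x t, x \in `[0, 1] -> t \in `[0, T] -> u x t = 0.
Proof.
have cw := uext_continuous_space T_gt0 u_cont.
have mw := measurable_uext T_gt0 u_cont u_ac.
have [M wM] := uext_L1_bound T_gt0 u_cont u_ac u_H2.
have w_volterra := pairing_volterra alpha_gt0 alpha_lt1 T_gt0 u_cont u_ac u_H2 Du_L2 u_eq.
have w0 x t : a < x < b -> uext T u x t = 0.
  move=> /andP[ax xb]; apply: u_I; last by rewrite in_itv/= clamp_itv.
  by rewrite clampE ?in_itv/= ?ax//; apply/andP; split; lra.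
have wt := all_zero alpha_gt0 alpha_lt1 T_gt0 cw mw wM w_volterra a_ge0 a_lt_b b_le1 w0.
move=> x t; rewrite !in_itv/= => x01 t0T; rewrite -(@uextE _ T)//.
(* The vanishing is known for a.e. time only. For a.e. [y] continuity in time extends it to the
   given [t], and then continuity in space extends it from a.e. [y] to the given [x]. *)
apply: (@continuous_ae_eq0 _ ((uext T u)^~ t) 0 1) => //; first exact: cw.
apply: filterS u_ac; first exact: (ae_filter_ringOfSetsType (@lebesgue_measure R)).
move=> y + y01; rewrite in_itv/= => /(_ y01) ac.
apply: (@continuous_ae_eq0 _ (uext T u y) 0 T) => //.
  exact: uext_continuous_time.
apply: filterS wt; first exact: (ae_filter_ringOfSetsType (@lebesgue_measure R)).
by move=> s hs /hs; apply; move: y01 => /andP[/ltW -> /ltW ->].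
Qed.
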